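(* Given any flat structure $(T^2,g_o)$ on the 2-torus, any simple closed geodesic $\sigma$ in $(T^2,g_o)$, and any $\beta_2>0$, there is a complete AH Einstein metric $g$ on the 4-manifold $\mathbb R^2\times T^2$ whose conformal infinity is (the conformal class of) the flat product $(T^2,g_o)\times S^1(\beta_2)$. These metrics on $\mathbb R^2\times T^2$ are all locally isometric, but the isometry type of a metric in this family is uniquely determined by the data $(T^2,g_o)$, $\beta_2$ and $\sigma$.
   Context: A complete AH (asymptotically hyperbolic) Einstein metric on a 4-manifold $M$ which is the interior of a compact manifold $\bar M$ with boundary is a complete metric $g$ with $Ric_g=-3g$ such that $\rho^2g$ extends to a metric on $\bar M$ for some defining function $\rho$ of $\partial M$ ($\rho>0$ on $M$, $\rho^{-1}(0)=\partial M$, $d\rho\neq 0$ on $\partial M$); the conformal class of $\rho^2g|_{\partial M}$ is its conformal infinity. $S^1(\beta_2)$ is the circle of length $\beta_2$. The family in question is the following. On $\mathbb R^2\times\mathbb R^2$ consider the metric $$g_1=V^{-1}dr^2+V\,d\theta^2+r^2(ds_1^2+ds_2^2),\qquad V(r)=r^2-\frac{2}{r},\quad r\ge r_+=2^{1/3},$$ where $(r,\theta)$ are polar-type coordinates on the first $\mathbb R^2$ with $\theta$ periodic of period $\beta=\frac{4\pi}{3r_+}$ (so that the metric is smooth at $r=r_+$), and $s_1,s_2\in\mathbb R$. Given $(T^2,g_o)$ and $\sigma$, there is a unique free isometric $\mathbb Z$-action on the flat cylinder $S^1(\beta)\times\mathbb R$ with coordinates $(\theta,s_1)$ and metric $d\theta^2+ds_1^2$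 whose quotient is homothetic to $(T^2,g_o)$ with the meridian $\theta$-circle mapped to $\sigma$; it extends to an isometric action on the $(r,\theta,s_1)$ space, the quotient being a solid torus in which $\sigma$ bounds a disc. The metric $g$ associated with $(g_o,\sigma,\beta_2)$ is the resulting quotient of $g_1$, with $s_2$ also made periodic so that the conformal infinity is the class of $(T^2,g_o)\times S^1(\beta_2)$. *)

(* Defs.v *)
From mathcomp Require Import all_boot all_order all_algebra.
From mathcomp Require Import all_classical all_reals all_analysis.
Set Implicit Arguments.
Unset Strict Implicit.
Unset Printing Implicit Defensive.
Import Order.TTheory GRing.Theory Num.Theory.
Import numFieldNormedType.Exports.
Local Open Scope classical_set_scope.
Local Open Scope ring_scope.

(* All manifolds involved are quotients of open subsets of
   some R^n by an explicit group: R^2 x T^2 is R^4 modulo integer translations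
   of the last two coordinates, a flat torus is R^n modulo a lattice, and so on.
   Tensors on the quotient are invariant tensors upstairs.  Vectors are rows,
   so a metric tensor at a point is the matrix G of the form
   (v, w) |-> v *m G *m w^T. *)

Section Calculus.
Variable R : realType.

Definition partial n (V : normedModType R) (i : 'I_n)
    (f : 'rV[R]_n -> V) (x : 'rV[R]_n) : V := 'D_(delta_mx 0 i) f x.

Definition iter_partial n (V : normedModType R) (s : seq 'I_n)
    (f : 'rV[R]_n -> V) : 'rV[R]_n -> V := foldr (@partial n V) f s.

(* C^infinity on the open set U; only the values of f on U matter. *)
Definition smooth_on n (V : normedModType R) (U : set 'rV[R]_n)
    (f : 'rV[R]_n -> V) : Prop :=
  forall (s : seq 'I_n) (x : 'rV[R]_n), U x ->
    {for x, continuous (iter_partial s f)} /\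
    forall i : 'I_n, derivable (iter_partial s f) x (delta_mx 0 i).

Definition pullback n m (f : 'rV[R]_n -> 'rV[R]_m)
    (g : 'rV[R]_m -> 'M[R]_m) (x : 'rV[R]_n) : 'M[R]_n :=
  'J f x *m g (f x) *m ('J f x)^T.

(* f : U -> U' covers a diffeomorphism U/E -> U'/E'.  For U, U' simply
   connected and E, E' the orbit relations of free, properly discontinuous
   groups, every diffeomorphism U/E -> U'/E' arises in this way. *)
Definition quotient_diffeo n m
    (U : set 'rV[R]_n) (E : 'rV[R]_n -> 'rV[R]_n -> Prop)
    (U' : set 'rV[R]_m) (E' : 'rV[R]_m -> 'rV[R]_m -> Prop)
    (f : 'rV[R]_n -> 'rV[R]_m) : Prop :=
  smooth_on U f /\ (forall x, U x -> U' (f x)) /\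
  (forall x y, U x -> U y -> E x y -> E' (f x) (f y)) /\
  exists h : 'rV[R]_m -> 'rV[R]_n,
    smooth_on U' h /\ (forall y, U' y -> U (h y)) /\
    (forall y z, U' y -> U' z -> E' y z -> E (h y) (h z)) /\
    (forall x, U x -> E (h (f x)) x) /\
    (forall y, U' y -> E' (f (h y)) y).

Definition posdef n (G : 'M[R]_n) : Prop :=
  G^T = G /\ forall v : 'rV[R]_n, v != 0 -> 0 < (v *m G *m v^T) 0 0.

Section Curvature.
Variables (n : nat) (g : 'rV[R]_n -> 'M[R]_n).

(* Gamma^k_{ij} *)
Definition christoffel (k i j : 'I_n) (x : 'rV[R]_n) : R :=
  2^-1 * \sum_(l < n) invmx (g x) k l *
    (partial i (fun y => g y j l : R) x + partial j (fun y => g y i l : R) x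
     - partial l (fun y => g y i j : R) x).

(* Sign convention: the round sphere has positive Ricci curvature. *)
Definition ricci (x : 'rV[R]_n) : 'M[R]_n := \matrix_(i, j)
  \sum_(k < n) (partial k (christoffel k i j) x - partial j (christoffel k i k) x
    + \sum_(l < n) (christoffel k k l x * christoffel l i j x
                    - christoffel k j l x * christoffel l i k x)).

End Curvature.
End Calculus.

Section FlatTori.
Variable R : realType.

Definition row2 (a b : R) : 'rV[R]_2 := \row_i [:: a; b]`_i.
Definition row4 (a b c d : R) : 'rV[R]_4 := \row_i [:: a; b; c; d]`_i.

(* x and y define the same point of R^n / L, L the integer span of the rows
   of B. *)
Definition lattice_rel n (B : 'M[R]_n) (x y : 'rV[R]_n) : Prop :=
  exists z : 'rV[int]_n, y = x + map_mx intr z *m B.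

Definition line n (p v : 'rV[R]_n) (t : R) : 'rV[R]_n := p + t *: v.

(* Geodesics of R^n / L are the images of straight lines. *)
Definition simple_closed_geodesic n (B : 'M[R]_n) (p v : 'rV[R]_n) : Prop :=
  [/\ v != 0, lattice_rel B (line p v 0) (line p v 1) &
      forall s t : R, 0 <= s < 1 -> 0 <= t < 1 ->
        lattice_rel B (line p v s) (line p v t) -> s = t].

(* A homothety of ratio lam from R^n / L(B) onto R^n / L(B') mapping the image
   of the curve c onto the image of the curve c'. *)
Definition marked_homothety n (lam : R) (B : 'M[R]_n) (c : R -> 'rV[R]_n)
    (B' : 'M[R]_n) (c' : R -> 'rV[R]_n) : Prop :=
  0 < lam /\ exists (A : 'M[R]_n) (b : 'rV[R]_n),
    [/\ A *m A^T = (lam ^+ 2)%:M,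
        forall x y, lattice_rel B x y <->
                    lattice_rel B' (x *m A + b) (y *m A + b) &
        forall w, (exists t, lattice_rel B' (c t *m A + b) w) <->
                  (exists t, lattice_rel B' (c' t) w)].

(* The data (T^2, g_o), sigma, beta_2, with T^2 = R^2 / L(fd_lattice). *)
Record filling_data := FillingData {
  fd_lattice : 'M[R]_2;
  fd_base : 'rV[R]_2;
  fd_dir : 'rV[R]_2;
  fd_beta2 : R;
  fd_lattice_unit : fd_lattice \in unitmx;
  fd_geodesic : simple_closed_geodesic fd_lattice fd_base fd_dir;
  fd_beta2_gt0 : 0 < fd_beta2
}.

Definition fd_sigma (D : filling_data) : R -> 'rV[R]_2 :=
  line (fd_base D) (fd_dir D).

(* The flat product (T^2, g_o) x S^1(beta_2), and sigma x {0} in it. *)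
Definition product_lattice (D : filling_data) : 'M[R]_3 :=
  block_mx (fd_lattice D) 0 0 ((fd_beta2 D)%:M : 'M[R]_1).

Definition product_sigma (D : filling_data) (t : R) : 'rV[R]_3 :=
  row_mx (fd_sigma D t) (0 : 'rV[R]_1).

(* D and D' define the same flat product with marked geodesic, up to homothety.
   The splitting of the 3-torus is not part of the invariant: if T^2 is the
   rectangular torus S^1(a) x S^1(b) and sigma its S^1(a) factor, exchanging b
   and beta_2 does not change the metric g. *)
Definition same_data (D D' : filling_data) : Prop :=
  exists mu : R, marked_homothety mu (product_lattice D) (product_sigma D)
                                     (product_lattice D') (product_sigma D').

End FlatTori.

Section Metrics.
Variable R : realType.
Implicit Types (g : 'rV[R]_4 -> 'M[R]_4) (x y p q : 'rV[R]_4).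

(* x and y define the same point of R^2 x T^2, T^2 = R^2 / Z^2 *)
Definition torus_rel x y : Prop :=
  exists k l : int, y = x + row4 0 0 k%:~R l%:~R.

Definition metric_R2T2 g : Prop :=
  [/\ smooth_on setT g, forall x, posdef (g x) &
      forall x y, torus_rel x y -> g x = g y].

Definition einstein g : Prop := forall x, ricci g x = - 3 *: g x.

(* Parametrizations need not be regular, so corners are allowed and C^1 paths
   give the same distance as piecewise C^1 ones. *)
Definition C1_path (c : R -> 'rV[R]_4) : Prop :=
  (forall t, derivable c t 1) /\ continuous (derive1 c).

Definition path_length g (c : R -> 'rV[R]_4) : R :=
  \int[lebesgue_measure]_(t in `[0, 1])
    Num.sqrt ((derive1 c t *m g (c t) *m (derive1 c t)^T) 0 0).

(* Distance between the points of R^2 x T^2 represented by p and q. *)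
Definition riem_dist g p q : R :=
  inf [set L | exists c, [/\ C1_path c, torus_rel p (c 0), torus_rel q (c 1)
                           & L = path_length g c]].

Definition complete_metric g : Prop :=
  forall u : nat -> 'rV[R]_4,
    (forall e : R, 0 < e -> exists N, forall m n,
       (N <= m)%N -> (N <= n)%N -> riem_dist g (u m) (u n) < e) ->
    exists p, forall e : R, 0 < e -> exists N, forall n,
       (N <= n)%N -> riem_dist g (u n) p < e.

Definition isometric g g' : Prop :=
  exists2 f, quotient_diffeo setT torus_rel setT torus_rel f &
             forall x, pullback f g' x = g x.

(* Being local, this can be checked on R^4. *)
Definition locally_isometric g g' : Prop :=
  forall p, exists (U : set 'rV[R]_4) (f : 'rV[R]_4 -> 'rV[R]_4),
    [/\ open U, U p, smooth_on U f & forall x, U x -> pullback f g' x = g x].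

(* The compact manifold with boundary is (closed unit disc) x T^2. *)
Definition disc_norm2 x : R := x 0 0 ^+ 2 + x 0 1 ^+ 2.
Definition disc_interior : set 'rV[R]_4 := [set x | disc_norm2 x < 1].
Definition disc_boundary : set 'rV[R]_4 := [set x | disc_norm2 x = 1].
Definition disc_closed : set 'rV[R]_4 := [set x | disc_norm2 x <= 1].

(* j identifies R^2 x T^2 with the interior; rho is a defining function of the
   boundary, and gbar a metric on the compact manifold extending rho^2 g.
   Smoothness up to the boundary means having a smooth extension to an open
   neighbourhood W. *)
Definition conformal_compactification g (j : 'rV[R]_4 -> 'rV[R]_4)
    (rho : 'rV[R]_4 -> R) (gbar : 'rV[R]_4 -> 'M[R]_4) : Prop :=
  quotient_diffeo setT torus_rel disc_interior torus_rel j /\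
  (exists W : set 'rV[R]_4,
     [/\ open W, disc_closed `<=` W, smooth_on W rho & smooth_on W gbar]) /\
  (forall x y, disc_closed x -> torus_rel x y ->
     rho x = rho y /\ gbar x = gbar y) /\
  (forall x, disc_interior x -> 0 < rho x) /\
  (forall x, disc_boundary x ->
     rho x = 0 /\ exists i : 'I_4, partial i rho x != 0) /\
  (forall x, disc_closed x -> posdef (gbar x)) /\
  (forall x, rho (j x) ^+ 2 *: g x = pullback j gbar x).

Definition complete_AH_einstein g : Prop :=
  [/\ metric_R2T2 g, complete_metric g, einstein g &
      exists j rho gbar, conformal_compactification g j rho gbar].

(* The conformal infinity is the class of the flat torus R^3 / L(B): f induces
   a bijection from that torus onto the boundary, and it is conformal (hence an
   immersion, hence a diffeomorphism). *)
Definition has_conformal_infinity g (B : 'M[R]_3) : Prop :=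
  exists j rho gbar, conformal_compactification g j rho gbar /\
  exists f : 'rV[R]_3 -> 'rV[R]_4,
    smooth_on setT f /\ (forall u, disc_boundary (f u)) /\
    (forall u v, lattice_rel B u v <-> torus_rel (f u) (f v)) /\
    (forall y, disc_boundary y -> exists u, torus_rel (f u) y) /\
    (forall u, exists2 mu : R, 0 < mu & pullback f gbar u = mu%:M).

End Metrics.

Section Family.
Variable R : realType.

Definition rplus : R := 2 `^ (3^-1).
Definition beta : R := 4 * pi / (3 * rplus).
Definition Vfun (r : R) : R := r ^+ 2 - 2 / r.

(* (r, theta, s1, s2) |-> point of R^2 x R^2.  Since Vfun has a simple zero at
   rplus, the distance to the core {r = rplus} is of order sqrt (r - rplus),
   whence the radius. *)
Definition polar (x : 'rV[R]_4) : 'rV[R]_4 :=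
  let rad := Num.sqrt (x 0 0 - rplus) in
  let phi := 2 * pi * x 0 1 / beta in
  row4 (rad * cos phi) (rad * sin phi) (x 0 2) (x 0 3).

(* G is a smooth metric on R^2 x R^2 which, off the core, is
   Vfun^-1 dr^2 + Vfun dtheta^2 + r^2 (ds1^2 + ds2^2); it is unique by continuity. *)
Definition is_g1 (G : 'rV[R]_4 -> 'M[R]_4) : Prop :=
  [/\ smooth_on setT G, forall x, posdef (G x) &
      forall r theta s1 s2 : R, rplus < r ->
        pullback polar G (row4 r theta s1 s2)
        = diag_mx (row4 (Vfun r)^-1 (Vfun r) (r ^+ 2) (r ^+ 2))].

(* (r, theta, s1, s2) |-> (r, theta + a, s1 + b, s2 + c) *)
Definition shift (a b c : R) (x : 'rV[R]_4) : 'rV[R]_4 :=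
  let phi := 2 * pi * a / beta in
  row4 (cos phi * x 0 0 - sin phi * x 0 1)
       (sin phi * x 0 0 + cos phi * x 0 1) (x 0 2 + b) (x 0 3 + c).

(* Orbits of the group generated by the isometry (theta, s1) |->
   (theta + alpha, s1 + ell) and by s2 |-> s2 + L. *)
Definition action_rel (alpha ell L : R) (x y : 'rV[R]_4) : Prop :=
  exists m n : int, y = shift (m%:~R * alpha) (m%:~R * ell) (n%:~R * L) x.

(* S^1(beta) x R modulo (theta, s1) |-> (theta + alpha, s1 + ell), as a quotient
   of the (theta, s1)-plane. *)
Definition cylinder_lattice (alpha ell : R) : 'M[R]_2 :=
  col_mx (row2 beta 0) (row2 alpha ell).

(* g is (isometric to) the metric on R^2 x T^2 associated with D.  A free
   isometric Z-action on the cylinder with quotient a torus is generated by a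
   translation (alpha, ell).  If the homothety onto (T^2, g_o) has ratio lam,
   the period of s2 is beta_2 / lam. *)
Definition associated (D : filling_data R) (g : 'rV[R]_4 -> 'M[R]_4) : Prop :=
  exists (G : 'rV[R]_4 -> 'M[R]_4) (alpha ell lam : R)
         (f : 'rV[R]_4 -> 'rV[R]_4),
    [/\ is_g1 G,
        marked_homothety lam (cylinder_lattice alpha ell)
          (fun theta => row2 theta 0) (fd_lattice D) (fd_sigma D),
        quotient_diffeo setT (@torus_rel R)
          setT (action_rel alpha ell (fd_beta2 D / lam)) f &
        forall x, g x = pullback f G x].

End Family.

(* Main.v *)
Require Import Defs.
From HB Require Import structures.
From mathcomp Require Import all_boot all_order all_algebra.
From mathcomp Require Import all_classical all_reals all_analysis.
From mathcomp Require Import ring lra.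
Set Implicit Arguments.
Unset Strict Implicit.
Unset Printing Implicit Defensive.
Import Order.TTheory GRing.Theory Num.Theory.
Import numFieldNormedType.Exports.
Local Open Scope classical_set_scope.
Local Open Scope ring_scope.

(* In the coordinates (x, s) with |x|^2 = r - r_+, the metric g1 extends smoothly
   over the core {x = 0} and is invariant under rotations of x and translations
   of s.  A screw motion carries R^2 x T^2 onto the quotient of g1, which is
   Einstein by an explicit computation of its connection, compactifies through
   x |-> x / sqrt (1 + |x|^2), and is complete because ln (1 + |x|^2),
   x_i / (1 + |x|^2) and s are Lipschitz functions.
   An isometry between two such quotients lifts to an isometry F of g1 which
   carries the translation part lambda of a deck transformation to some lambda'.
   As |ds| is smallest on the core, |lambda'| <= |lambda|; by symmetry equality
   holds, so F preserves the core and acts on it through some P in O(2).  Since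
   second derivatives commute, F does not rotate the normal planes along the
   core, so it preserves the rotation parts of deck transformations up to one
   sign e, and diag(e, P) is a homothety between the data. *)

(** * Differential calculus on R^n *)

Section DirectionalDerivatives.
Variable R : realType.

(** The classification works without geodesics of g1 and without its isometry group: all that is
    extracted from a lift [F] is its first and second derivatives on the core. A lift has an inverse
    only up to a deck transformation. As the deck groups are abelian and labelled by integers, and
    labels depend continuously on the point, each deck transformation has one well-defined partner,
    and the length comparison can be run for [F] and for its quasi-inverse. Equality of lengths
    alone says nothing yet about single points of the core. It becomes pointwise through a
    calibration: along the line from a core point in the direction lambda, the pairing of lambda'
    with the s-part of [F], minus [t |lambda|^2], is nonincreasing and periodic, hence has zero
    derivative, and every inequality used on the way is an equality. No scale ambiguity survives,
    although the data are compared up to homothety: every filling is a quotient of the same g1, so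
    the theta-circle has the fixed length [beta], and a homothety of period lattices that preserves
    the theta-direction has ratio 1. *)

Lemma is_derive_line (V W : normedModType R) (f : V -> W) (z e : V) (t : R) :
  derivable f (z + t *: e) e ->
  is_derive t 1 (fun s : R => f (z + s *: e)) ('D_e f (z + t *: e)).
Proof.
move=> df; rewrite /derivable in df.
have E : (fun h : R => h^-1 *: ((fun s : R => f (z + s *: e)) (h *: (1 : R) + t)
           - f (z + t *: e)))
       = (fun h : R => h^-1 *: (f (h *: e + (z + t *: e)) - f (z + t *: e))).
  apply/funext => h /=.
  by rewrite [h *: _]mulr1 scalerDl addrCA.
by split; [rewrite /derivable E|rewrite /derive E].
Qed.

(** Allowing [s] of either sign lets increments along coordinate directions and lines be estimated
    without separate cases. *)
Lemma mean_value_abs (f df : R -> R) (s : R) :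
  (forall t : R, `|t| <= `|s| -> is_derive t 1 f (df t)) ->
  exists2 c, `|c| <= `|s| & f s - f 0 = df c * s.
Proof.
move=> Hf.
have cont a b : (forall t, a <= t <= b -> `|t| <= `|s|) ->
    {within `[a, b], continuous f}.
  move=> ab; apply: derivable_within_continuous => x; rewrite in_itv /= => xab.
  by have [] := Hf x (ab x xab).
have [s0|s0] := leP 0 s.
  have ab t : 0 <= t <= s -> `|t| <= `|s|.
    by move=> /andP[t0 ts]; rewrite !ger0_norm.
  have [|c cs ->] := @MVT_segment R f df 0 s s0 _ (cont _ _ ab).
    by move=> x; rewrite in_itv /= => /andP[/ltW x0 /ltW x1]; apply: Hf;
      apply: ab; rewrite x0.
  by exists c; [apply: ab; move: cs; rewrite in_itv|rewrite subr0].
have ab t : s <= t <= 0 -> `|t| <= `|s|.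
  by move=> /andP[t0 ts]; rewrite !ler0_norm ?lerN2// ltW.
have [|c cs E] := @MVT_segment R f df s 0 (ltW s0) _ (cont _ _ ab).
  by move=> x; rewrite in_itv /= => /andP[/ltW x0 /ltW x1]; apply: Hf;
    apply: ab; rewrite x0.
exists c; first by apply: ab; move: cs; rewrite in_itv.
by rewrite -opprB E sub0r mulrN opprK.
Qed.

Lemma continuous_mxP (T : topologicalType) m n (M : T -> 'M[R]_(m, n)) (x : T) :
  {for x, continuous M} <-> forall i j, {for x, continuous (fun y => M y i j)}.
Proof.
split=> [cM i j|cM].
  exact: (@continuous_comp _ _ _ M (fun N : 'M[R]_(m, n) => N i j) x cM
    (@coord_continuous R m n i j (M x))).
apply/cvgrPdist_le => /= e e0; near=> y.
rewrite /Num.Def.normr/= mx_normrE (bigmax_le _ (ltW e0))//= => i _.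
rewrite !mxE/=; move: i; near: y; apply: filter_forall => /= i.
by have /cvgrPdist_le := cM i.1 i.2; apply.
Unshelve. all: by end_near. Qed.

Lemma row_ball n (x y : 'rV[R]_n) (e : R) : 0 < e ->
  (forall j, `|x 0 j - y 0 j| < e) -> ball x e y.
Proof.
move=> e0 H; split => // i j.
by rewrite (ord1 i); exact: H.
Qed.

Lemma row_norm_ge n (v : 'rV[R]_n) j : `|v 0 j| <= `|v|.
Proof.
by rewrite [leRHS]/Num.Def.normr/= mx_normrE; exact: (le_bigmax _ _ (0, j)).
Qed.

(* Difference along the coordinate directions one at a time, using the mean
   value theorem for each. *)
Lemma coordinate_telescope m (h : 'rV[R]_m -> R) (y : 'rV[R]_m) (e d : R)
    (v : 'rV[R]_m) :
  0 < d -> 0 <= e -> `|v| < d ->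
  (forall z j, ball y d z -> derivable h z (delta_mx 0 j)) ->
  (forall z j, ball y d z -> `|partial j h z - partial j h y| <= e) ->
  `|h (y + v) - h y - \sum_j v 0 j * partial j h y| <= m%:R * e * `|v|.
Proof.
move=> d0 e0 vd hd hc.
pose tr k : 'rV[R]_m := \row_j (if (j < k)%N then v 0 j else 0).
have tr0 : tr 0%N = 0 by apply/rowP => j; rewrite !mxE.
have trm : tr m = v by apply/rowP => j; rewrite !mxE ltn_ord.
have trS (j : 'I_m) : tr j.+1 = tr j + v 0 j *: delta_mx 0 j.
  apply/rowP => i; rewrite !mxE ltnS eqxx /= leq_eqVlt.
  have [->|ij] /= := eqVneq i j; first by rewrite eqxx ltnn mulr1 add0r.
  have -> : (i == j :> nat) = false by apply/negbTE.
  by rewrite mulr0 addr0.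
have step (j : 'I_m) :
    `|h (y + tr j.+1) - h (y + tr j) - v 0 j * partial j h y| <= e * `|v|.
  pose f t := h (y + tr j + t *: delta_mx 0 j).
  have inb t : `|t| <= `|v 0 j| -> ball y d (y + tr j + t *: delta_mx 0 j).
    move=> tv; apply: row_ball => // i.
    apply: le_lt_trans vd; rewrite !mxE eqxx /= -addrA opprD addrA subrr add0r normrN.
    have [->|ij] := eqVneq i j.
      by rewrite ltnn add0r mulr1 (le_trans tv)// row_norm_ge.
    rewrite mulr0 addr0; case: ifP => _; first exact: row_norm_ge.
    by rewrite normr0.
  have [c cv] := @mean_value_abs f (fun t => partial j h (y + tr j + t *: delta_mx 0 j))
       (v 0 j) (fun t tv => is_derive_line (hd _ _ (inb t tv))).
  rewrite /f trS scale0r addr0 addrA => ->.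
  rewrite [v 0 j * _]mulrC -mulrBl normrM; apply: ler_pM => //.
    exact: hc (inb _ cv).
  exact: row_norm_ge.
have -> : h (y + v) - h y = \sum_(j < m) (h (y + tr j.+1) - h (y + tr j)).
  rewrite -(big_mkord xpredT (fun j => h (y + tr j.+1) - h (y + tr j))).
  by rewrite telescope_sumr// trm tr0 addr0.
rewrite -sumrB (le_trans (ler_norm_sum _ _ _))//.
rewrite (le_trans (ler_sum _ (fun j _ => step j)))//.
by rewrite sumr_const card_ord -mulrA mulr_natl.
Qed.

Lemma continuous_sum_pt (T : topologicalType) m (f : 'I_m -> T -> R) (x : T) :
  (forall j, {for x, continuous (f j)}) ->
  {for x, continuous (fun y => \sum_j f j y)}.
Proof.
move=> cf; apply: cvg_big; last by move=> j _; exact: cf.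
by move=> p; apply: cvgD; [exact: cvg_fst|exact: cvg_snd].
Qed.

Lemma linear_combination_linear m (c : 'I_m -> R) :
  linear (fun v : 'rV[R]_m => \sum_j v 0 j * c j : R^o).
Proof.
move=> a u v; rewrite scaler_sumr -big_split; apply: eq_bigr => j _ /=.
by rewrite !mxE mulrDl /GRing.scale /= mulrA.
Qed.

Lemma continuous_sum_coord m (c : 'I_m -> R) :
  continuous (fun v : 'rV[R]_m => \sum_j v 0 j * c j : R).
Proof.
move=> x; apply: (@continuous_sum_pt) => j.
exact: (cvgM (@coord_continuous R 1 m 0 j x) (cvg_cst (c j))).
Qed.

(** Each of the [m] coordinate steps contributes an error of at most [e / m.+1] times [|v|], so the
    total is negligible against [|v|]. This passes from the coordinatewise notion [smooth_on] to
    differentiability, on which Jacobians and pullbacks rest. *)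
Lemma continuous_partials_diff m (U : set 'rV[R]_m) (h : 'rV[R]_m -> R) (y : 'rV[R]_m) :
  open U -> U y ->
  (forall z, U z -> forall j, derivable h z (delta_mx 0 j)) ->
  (forall j, {for y, continuous (partial j h)}) ->
  differentiable h y /\ forall v, 'D_v h y = \sum_j v 0 j * partial j h y.
Proof.
move=> oU Uy hd hc.
pose L := GRing.isLinear.Build _ _ _ _ _
  (linear_combination_linear (fun j => partial j h y)).
pose l : {linear 'rV[R]_m -> R^o} := HB.pack (fun v : 'rV[R]_m => \sum_j v 0 j * partial j h y : R^o) L.
have lc : continuous (l : 'rV[R]_m -> R) by exact: continuous_sum_coord.
have E : h \o shift y = cst (h y) + (l : 'rV[R]_m -> R) +o_ (0 : 'rV[R]_m) id.
  apply/eqaddoP => e e0.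
  (* The successor makes the denominator nonzero in dimension 0 too. *)
  have e'0 : 0 < e / m.+1%:R by rewrite divr_gt0.
  have [d d0 Hd] : exists2 d, 0 < d & forall z, ball y d z -> U z /\
      forall j, `|partial j h z - partial j h y| <= e / m.+1%:R.
    have : \forall z \near y, U z /\ forall j, `|partial j h z - partial j h y| <= e / m.+1%:R.
      near=> z; split; first by near: z; exact: open_nbhs_nbhs.
      move=> j; rewrite distrC; move: j; near: z; apply: filter_forall => j.
      by have /cvgrPdist_le := hc j; apply.
    by move=> /nbhs_ballP[d /= d0 Hd]; exists d.
  near=> v.
  rewrite /= /cst /shift /=.
  have vd : `|v| < d by near: v; exact: (@nbhs0_lt R 'rV[R]_m d d0).
  have := @coordinate_telescope m h y (e / m.+1%:R) d v d0 (ltW e'0) vd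
    (fun z j zb => hd z (Hd z zb).1 j) (fun z j zb => (Hd z zb).2 j).
  rewrite -[(_ - _) v]/(h (v + y) - (h y + l v)) [v + y]addrC opprD addrA => H.
  apply: le_trans H _; apply: ler_wpM2r => //.
  rewrite mulrCA ger_pMr// ler_pdivrMr// mul1r ler_nat//.
have hdif : 'd h y = l :> ('rV[R]_m -> R) by exact: diff_unique.
have dh : differentiable h y.
  by apply/diff_locallyP; rewrite hdif.
by split=> // v; rewrite deriveE// hdif.
Unshelve. all: by end_near. Qed.

End DirectionalDerivatives.

(** * Functions of class C^k and their algebra *)

Section ContinuouslyDifferentiable.
Variable R : realType.

(** Peels off the derivative taken first, which suits induction on the order; in [iter_partial] that
    derivative is the last letter of the word, whence the use of [rcons] when the two notions are
    compared. *)
Fixpoint Ck n (V : normedModType R) (k : nat) (U : set 'rV[R]_n)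
    (f : 'rV[R]_n -> V) : Prop :=
  (forall x, U x -> {for x, continuous f}) /\
  if k is k'.+1 then
    (forall x, U x -> forall i : 'I_n, derivable f x (delta_mx 0 i)) /\
    forall i : 'I_n, Ck k' U (partial i f)
  else True.

Lemma smooth_onE n (V : normedModType R) (U : set 'rV[R]_n) (f : 'rV[R]_n -> V) :
  smooth_on U f <->
  [/\ forall x, U x -> {for x, continuous f},
      forall x, U x -> forall i : 'I_n, derivable f x (delta_mx 0 i) &
      forall i, smooth_on U (partial i f)].
Proof.
split=> [sf|[cf df pf] s].
  split=> [x Ux|x Ux i|i s x Ux].
  - exact: (sf [::] x Ux).1.
  - exact: (sf [::] x Ux).2.
  - by have := sf (rcons s i) x Ux; rewrite /iter_partial foldr_rcons.
elim/last_ind: s => [|s i _] x Ux /=; first by split=> [|i]; [exact: cf|exact: df].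
by rewrite /iter_partial foldr_rcons; exact: pf.
Qed.

Lemma smooth_onP n (V : normedModType R) (U : set 'rV[R]_n) (f : 'rV[R]_n -> V) :
  smooth_on U f <-> forall k, Ck k U f.
Proof.
split=> [sf k|].
  elim: k f sf => [|k IH] f /smooth_onE[cf df pf] /=; split=> //.
  by split=> // i; exact: IH.
move=> H s; elim/last_ind: s f H => [|s i IH] f H x Ux.
  by have [cf [df _]] := H 1%N; split=> [|i]; [exact: cf|exact: df].
rewrite /iter_partial foldr_rcons; apply: IH => // k.
by have [_ [_]] := H k.+1; apply.
Qed.

Lemma CkS n (V : normedModType R) k U (f : 'rV[R]_n -> V) : Ck k.+1 U f -> Ck k U f.
Proof.
elim: k f => [|k IH] f [cf [df pf]]; split=> //; split=> // i.
exact: IH.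
Qed.

Lemma Ck_le n (V : normedModType R) j k U (f : 'rV[R]_n -> V) :
  (j <= k)%N -> Ck k U f -> Ck j U f.
Proof.
move=> /subnK <-; elim: (k - j)%N => [//|i IH] H; apply: IH; exact: CkS H.
Qed.

Lemma open_near_eq n (V : Type) (U : set 'rV[R]_n) (f g : 'rV[R]_n -> V) x :
  open U -> (forall y, U y -> f y = g y) -> U x -> {near x, f =1 g}.
Proof.
move=> oU fg Ux; near=> y; apply: fg; near: y; exact: open_nbhs_nbhs.
Unshelve. all: by end_near. Qed.

Lemma continuous_congr n (V : normedModType R) (U : set 'rV[R]_n)
    (f g : 'rV[R]_n -> V) x :
  open U -> (forall y, U y -> f y = g y) -> U x ->
  {for x, continuous f} -> {for x, continuous g}.
Proof.
move=> oU fg Ux cf.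
have : g @ x --> f x.
  exact: cvg_trans (near_eq_cvg (open_near_eq oU fg Ux)) cf.
by rewrite fg.
Qed.

Lemma Ck_congr n (V : normedModType R) k U (f g : 'rV[R]_n -> V) :
  open U -> (forall x, U x -> f x = g x) -> Ck k U f -> Ck k U g.
Proof.
move=> oU; elim: k f g => [|k IH] f g fg [cf H].
  by split=> // x Ux; exact: (continuous_congr oU fg Ux (cf x Ux)).
have [df pf] := H; split.
  by move=> x Ux; exact: (continuous_congr oU fg Ux (cf x Ux)).
split=> [x Ux i|i].
  by apply: near_eq_derivable (df x Ux i); exact: (open_near_eq oU).
apply: IH (pf i) => x Ux; rewrite /partial.
by apply: near_eq_derive; exact: (open_near_eq oU).
Qed.

Lemma smooth_congr n (V : normedModType R) U (f g : 'rV[R]_n -> V) :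
  open U -> (forall x, U x -> f x = g x) -> smooth_on U f -> smooth_on U g.
Proof. by move=> oU fg /smooth_onP sf; apply/smooth_onP => k; exact: Ck_congr (sf k). Qed.

Lemma Ck_mx n m p k U (f : 'rV[R]_n -> 'M[R]_(m, p)) : open U ->
  Ck k U f <-> forall i j, Ck k U (fun x => f x i j : R).
Proof.
move=> oU; split.
  elim: k f => [|k IH] f [cf H] i j.
    by split=> // x Ux; have /continuous_mxP := cf x Ux; apply.
  have [df pf] := H; split.
    by move=> x Ux; have /continuous_mxP := cf x Ux; apply.
  split=> [x Ux l|l]; first by have /derivable_mxP := df x Ux l; apply.
  apply: Ck_congr (IH _ (pf l) i j) => // x Ux.
  by rewrite /partial derive_mx ?mxE//; exact: df.
elim: k f => [|k IH] f H.
  split=> // x Ux; apply/continuous_mxP => i j; exact: (H i j).1.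
have df x : U x -> forall l : 'I_n, derivable f x (delta_mx 0 l).
  by move=> Ux l; apply/derivable_mxP => i j; have [_ [+ _]] := H i j; apply.
split; first by move=> x Ux; apply/continuous_mxP => i j; exact: (H i j).1.
split=> // l; apply: IH => i j; have [_ [_ /(_ l)]] := H i j.
apply: Ck_congr => // x Ux.
by rewrite /partial (derive_mx (df x Ux l)) mxE.
Qed.

Lemma smooth_mx n m p U (f : 'rV[R]_n -> 'M[R]_(m, p)) : open U ->
  smooth_on U f <-> forall i j, smooth_on U (fun x => f x i j : R).
Proof.
move=> oU; rewrite smooth_onP; split=> H.
  by move=> i j; apply/smooth_onP => k; have /Ck_mx := H k; apply.
by move=> k; apply/Ck_mx => // i j; have /smooth_onP := H i j; apply.
Qed.

Lemma Ck_cst n (V : normedModType R) k U (c : V) : Ck k U (fun _ : 'rV[R]_n => c).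
Proof.
have cc (c' : V) (x : 'rV[R]_n) : {for x, continuous (fun=> c')}.
  exact: (@cst_continuous 'rV[R]_n V c' x).
elim: k c => [|k IH] c; first by split=> // x _; exact: cc.
split; first by move=> x _; exact: cc.
split=> [x _ i|i]; first exact: derivable_cst.
have -> : partial i (fun=> c) = (fun=> 0) :> ('rV[R]_n -> V).
  by apply/funext => x; rewrite /partial derive_cst.
exact: IH.
Qed.

Lemma is_derive_coord n (x v : 'rV[R]_n) j : is_derive x v (fun y => y 0 j : R) (v 0 j).
Proof.
have dm : derivable (id : 'rV[R]_n -> _) x v by exact: derivable_id.
split; first by have /derivable_mxP := dm; apply.
by have := derive_mx dm; rewrite derive_id => /(congr1 (fun M : 'rV[R]_n => M 0 j)); rewrite mxE.
Qed.

Lemma Ck_coord n k U j : Ck k U (fun x : 'rV[R]_n => x 0 j : R).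
Proof.
have cc x : {for x, continuous (fun x : 'rV[R]_n => x 0 j : R)}.
  exact: (@coord_continuous R 1 n 0 j x).
case: k => [|k]; (split; first by move=> x _; exact: cc); first by [].
split=> [x _ i|i].
  by have [] := is_derive_coord x (delta_mx 0 i) j.
have -> : partial i (fun x : 'rV[R]_n => x 0 j : R) = (fun=> (delta_mx 0 i : 'rV[R]_n) 0 j).
  by apply/funext => x; have [] := is_derive_coord x (delta_mx 0 i) j.
exact: Ck_cst.
Qed.

Implicit Types (k : nat).

Lemma CkD n k U (f g : 'rV[R]_n -> R) : open U ->
  Ck k U f -> Ck k U g -> Ck k U (fun x => f x + g x).
Proof.
move=> oU; elim: k f g => [|k IH] f g [cf Hf] [cg Hg].
  by split=> // x Ux; exact: (cvgD (cf x Ux) (cg x Ux)).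
split; first by move=> x Ux; exact: (cvgD (cf x Ux) (cg x Ux)).
have [df pf] := Hf; have [dg pg] := Hg.
split=> [x Ux i|i]; first by apply: derivableD; [exact: df|exact: dg].
apply: Ck_congr (IH _ _ (pf i) (pg i)) => // x Ux.
by rewrite /partial deriveD//; [exact: df|exact: dg].
Qed.

Lemma CkM n k U (f g : 'rV[R]_n -> R) : open U ->
  Ck k U f -> Ck k U g -> Ck k U (fun x => f x * g x).
Proof.
move=> oU; elim: k f g => [|k IH] f g Hf Hg.
  by split=> // x Ux; exact: (cvgM (Hf.1 x Ux) (Hg.1 x Ux)).
split; first by move=> x Ux; exact: (cvgM (Hf.1 x Ux) (Hg.1 x Ux)).
have [_ [df pf]] := Hf; have [_ [dg pg]] := Hg.
split=> [x Ux i|i]; first by apply: derivableM; [exact: df|exact: dg].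
apply: Ck_congr (CkD oU (IH _ _ (CkS Hf) (pg i)) (IH _ _ (CkS Hg) (pf i))) => // x Ux.
by rewrite /partial deriveM//; [exact: df|exact: dg].
Qed.

Lemma Ck_sum n m k U (f : 'I_m -> 'rV[R]_n -> R) : open U ->
  (forall j, Ck k U (f j)) -> Ck k U (fun x => \sum_j f j x).
Proof.
move=> oU; elim: m f => [|m IH] f H.
  by apply: (Ck_congr oU _ (@Ck_cst n R k U 0)) => // x _; rewrite big_ord0.
apply: (@Ck_congr _ _ _ _ (fun x => f ord0 x + \sum_j f (lift ord0 j) x)) => //.
  by move=> x _; rewrite big_ord_recl.
by apply: CkD => //; exact: IH.
Qed.

Lemma CkN n k U (f : 'rV[R]_n -> R) : open U -> Ck k U f -> Ck k U (fun x => - f x).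
Proof.
move=> oU Hf; apply: Ck_congr (CkM oU (@Ck_cst n R k U (-1)) Hf) => // x _.
by rewrite mulN1r.
Qed.

(* If y is a composite phi(f), then F = phi'(f) is an expression in y, hence as
   smooth as y, so that y gains one derivative at a time. *)
Lemma Ck_bootstrap n U (f : 'rV[R]_n -> R) (y F : 'rV[R]_n -> R) : open U ->
  (forall x, U x -> forall i : 'I_n,
     is_derive x (delta_mx 0 i) y (F x * partial i f x)) ->
  (forall x, U x -> {for x, continuous y}) ->
  forall k, Ck k U F -> Ck k.+1 U f -> Ck k.+1 U y.
Proof.
move=> oU dy cy k HF [_ [df pf]]; split; first exact: cy.
split=> [x Ux i|i].
  by have [] := dy x Ux i.
apply: Ck_congr (CkM oU HF (pf i)) => // x Ux.
by have [_ <-] := dy x Ux i.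
Qed.

(** Only a derivative of [f] in the direction [v] is given, so everything is restricted to the line
    through [x] along [v], where the one-variable chain rule applies. *)
Lemma is_derive_comp1 (V : normedModType R) (f : V -> R) (phi : R -> R) (x v : V) (d df : R) :
  is_derive (f x) 1 phi d -> is_derive x v f df ->
  is_derive x v (fun y => phi (f y)) (d * df).
Proof.
move=> [dphi <-] [dfx <-].
pose l : R -> R := fun t => f (x + t *: v).
have x0 : x + 0 *: v = x by rewrite scale0r addr0.
have l1 : is_derive (0 : R) 1 l ('D_v f x).
  by have := @is_derive_line R V R f x v 0; rewrite x0; apply.
have l0 : l 0 = f x by rewrite /l x0.
have E0 (g : V -> R) : (fun h : R => h^-1 *: (g (h *: v + x) - g x)) =
    (fun h : R => h^-1 *: (g (x + (h *: (1 : R) + 0) *: v) - g (x + 0 *: v))).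
  apply/funext => h; have -> : h *: (1 : R) + 0 = h by rewrite addr0; exact: mulr1.
  by rewrite x0 [x + _]addrC.
have l1d : derivable l 0 1 by have [] := l1.
have pd : derivable phi (l 0) 1 by rewrite l0; exact: dphi.
have dl : derivable (phi \o l) 0 1.
  apply/derivable1_diffP; apply: differentiable_comp; apply/derivable1_diffP.
    exact: l1d.
  exact: pd.
split.
  rewrite /derivable (E0 (phi \o f)); exact: dl.
rewrite [LHS]/derive (E0 (phi \o f)).
have <- : 'D_1 l 0 = 'D_v f x by have [] := l1.
have E := derive1_comp l1d pd; rewrite !derive1E l0 in E; exact: E.
Qed.

End ContinuouslyDifferentiable.

(** * Chain rule and smoothness of elementary functions *)

Section ChainRule.
Variable R : realType.

Lemma differentiable_rowP (V : normedModType R) m (f : V -> 'rV[R]_m) (x : V) :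
  (forall j, differentiable (fun y => f y 0 j : R) x) -> differentiable f x.
Proof.
move=> df.
have -> : f = \sum_j (fun y => f y 0 j *: (delta_mx 0 j : 'rV[R]_m)).
  apply/funext => y; rewrite fct_sumE [LHS]matrix_sum_delta big_ord1.
  by [].
by apply: differentiable_sum => j; apply: differentiableZl.
Qed.

Lemma Ck1_differentiable n U (h : 'rV[R]_n -> R) x : open U -> Ck 1 U h -> U x ->
  differentiable h x /\ forall v, 'D_v h x = \sum_j v 0 j * partial j h x.
Proof.
move=> oU [_ [dh ph]] Ux; apply: (continuous_partials_diff oU Ux) => // j.
exact: (ph j).1.
Qed.

Lemma is_derive_comp (V : normedModType R) m (f : V -> 'rV[R]_m) (h : 'rV[R]_m -> R)
    (x v : V) :
  differentiable f x -> differentiable h (f x) ->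
  is_derive x v (fun y => h (f y)) ('D_('D_v f x) h (f x)).
Proof.
move=> df dh; have dc : differentiable (h \o f) x by exact: differentiable_comp.
split; first exact: diff_derivable.
by rewrite deriveE// diff_comp//= -deriveE// -deriveE.
Qed.

Lemma Ck1_row_differentiable n m U (f : 'rV[R]_n -> 'rV[R]_m) x : open U ->
  Ck 1 U f -> U x -> differentiable f x.
Proof.
move=> oU /Ck_mx cf Ux; apply: differentiable_rowP => j.
by have [] := Ck1_differentiable oU (cf oU 0 j) Ux.
Qed.

Lemma derive_row n m (f : 'rV[R]_n -> 'rV[R]_m) x v j : derivable f x v ->
  ('D_v f x) 0 j = 'D_v (fun y => f y 0 j : R) x.
Proof. by move=> df; rewrite derive_mx// mxE. Qed.

(** A partial derivative of the composite is a sum of products of partials of [f] with composites of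
    partials of [h], so the induction on [k] runs over all [h] with [f] fixed. *)
Lemma Ck_comp n m k U U' (f : 'rV[R]_n -> 'rV[R]_m) (h : 'rV[R]_m -> R) :
  open U -> open U' -> (forall x, U x -> U' (f x)) ->
  Ck k U f -> Ck k U' h -> Ck k U (fun x => h (f x)).
Proof.
move=> oU oU' fU; elim: k h => [|k IH] h Hf Hh.
  split=> // x Ux; apply: (@continuous_comp _ _ _ f h).
    exact: Hf.1.
  exact: Hh.1 (fU x Ux).
have df x : U x -> differentiable f x.
  by move=> Ux; apply: Ck1_row_differentiable Ux => //; apply: Ck_le Hf.
have dh x : U x -> differentiable h (f x) /\
    forall v, 'D_v h (f x) = \sum_j v 0 j * partial j h (f x).
  by move=> Ux; apply: Ck1_differentiable (fU x Ux) => //; apply: Ck_le Hh.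
split.
  move=> x Ux; apply: (@continuous_comp _ _ _ f h).
    exact: Hf.1.
  exact: Hh.1 (fU x Ux).
split=> [x Ux i|i].
  by have [] := is_derive_comp (delta_mx 0 i) (df x Ux) (dh x Ux).1.
have [_ [dfi pf]] := Hf; have [_ [_ ph]] := Hh.
apply: (@Ck_congr _ _ _ _ _
  (fun x => \sum_j partial i f x 0 j * partial j h (f x))) => //.
  move=> x Ux; rewrite /partial.
  have [_ ->] := is_derive_comp (delta_mx 0 i) (df x Ux) (dh x Ux).1.
  by rewrite (dh x Ux).2.
apply: Ck_sum => // j; apply: CkM => //.
  exact: ((Ck_mx _ _ oU).1 (pf i)).
exact: IH (CkS Hf) (ph j).
Qed.

Lemma smooth_comp n m p q U U' (f : 'rV[R]_n -> 'rV[R]_m) (h : 'rV[R]_m -> 'M[R]_(p, q)) :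
  open U -> open U' -> (forall x, U x -> U' (f x)) ->
  smooth_on U f -> smooth_on U' h -> smooth_on U (fun x => h (f x)).
Proof.
move=> oU oU' fU /smooth_onP sf /smooth_onP sh; apply/smooth_mx => // i j.
apply/smooth_onP => k; apply: (@Ck_comp _ _ _ U U' f (fun y => h y i j)) => //.
exact: ((Ck_mx _ _ oU').1 (sh k)).
Qed.

Lemma smoothD n U (f g : 'rV[R]_n -> R) : open U ->
  smooth_on U f -> smooth_on U g -> smooth_on U (fun x => f x + g x).
Proof.
by move=> oU /smooth_onP sf /smooth_onP sg; apply/smooth_onP => k; exact: CkD.
Qed.

Lemma smoothM n U (f g : 'rV[R]_n -> R) : open U ->
  smooth_on U f -> smooth_on U g -> smooth_on U (fun x => f x * g x).
Proof.
by move=> oU /smooth_onP sf /smooth_onP sg; apply/smooth_onP => k; exact: CkM.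
Qed.

Lemma smoothN n U (f : 'rV[R]_n -> R) : open U ->
  smooth_on U f -> smooth_on U (fun x => - f x).
Proof. by move=> oU /smooth_onP sf; apply/smooth_onP => k; exact: CkN. Qed.

Lemma smooth_cst n (V : normedModType R) U (c : V) : smooth_on U (fun _ : 'rV[R]_n => c).
Proof. by apply/smooth_onP => k; exact: Ck_cst. Qed.

Lemma smooth_coord n U j : smooth_on U (fun x : 'rV[R]_n => x 0 j : R).
Proof. by apply/smooth_onP => k; exact: Ck_coord. Qed.

Lemma smoothX n U (f : 'rV[R]_n -> R) k : open U ->
  smooth_on U f -> smooth_on U (fun x => f x ^+ k).
Proof.
move=> oU sf; elim: k => [|k IH]; first exact: (@smooth_cst n R).
apply: (smooth_congr oU _ (smoothM oU sf IH)) => x _.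
by rewrite exprS.
Qed.

Lemma smooth_partial_derive n U (f : 'rV[R]_n -> R) x i : smooth_on U f -> U x ->
  is_derive x (delta_mx 0 i) f (partial i f x).
Proof. by move=> /smooth_onE[_ df _] Ux; apply/derivableP/df. Qed.

(** Meant for [y = phi(f)] where phi solves a first-order equation: [F = - y^2] for the inverse,
    [F = - y^3 / 2] for the inverse square root, and the already smooth [F = 1 / f] for the
    logarithm. *)
Lemma smooth_comp_bootstrap n U (f F : 'rV[R]_n -> R) (y : 'rV[R]_n -> R) : open U ->
  smooth_on U f ->
  (forall x, U x -> forall i : 'I_n,
     is_derive x (delta_mx 0 i) y (F x * partial i f x)) ->
  (forall x, U x -> {for x, continuous y}) ->
  (forall k, Ck k U y -> Ck k U F) -> smooth_on U y.
Proof.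
move=> oU /smooth_onP sf dy cy H; apply/smooth_onP; elim=> [|k IH]; first by split.
by apply: (Ck_bootstrap oU dy cy) => //; exact: H.
Qed.

Lemma smoothV n U (f : 'rV[R]_n -> R) : open U -> (forall x, U x -> f x != 0) ->
  smooth_on U f -> smooth_on U (fun x => (f x)^-1).
Proof.
move=> oU f0 sf.
have cf x : U x -> {for x, continuous f} by move: sf => /smooth_onE[+ _ _]; apply.
apply: (@smooth_comp_bootstrap _ _ f (fun x => - ((f x)^-1 * (f x)^-1))) => //.
- move=> x Ux i; have [df dE] := smooth_partial_derive i sf Ux.
  split; first by apply: derivableV => //; exact: f0.
  rewrite (deriveV (f0 x Ux) df).
  by rewrite expr2 invfM; congr (_ * _).
- by move=> x Ux; exact: (cvgV (f0 x Ux) (cf x Ux)).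
- by move=> k Hk; apply: CkN => //; exact: CkM.
Qed.

Lemma smooth_cos_sin n U (f : 'rV[R]_n -> R) : open U -> smooth_on U f ->
  smooth_on U (fun x => cos (f x)) /\ smooth_on U (fun x => sin (f x)).
Proof.
move=> oU sf.
have cf x : U x -> {for x, continuous f} by move: sf => /smooth_onE[+ _ _]; apply.
have cc x : U x -> {for x, continuous (fun x => cos (f x))}.
  move=> Ux; apply: (@continuous_comp _ _ _ f (@cos R)); first exact: cf.
  exact: continuous_cos.
have cs x : U x -> {for x, continuous (fun x => sin (f x))}.
  move=> Ux; apply: (@continuous_comp _ _ _ f (@sin R)); first exact: cf.
  exact: continuous_sin.
have dc x i : U x -> is_derive x (delta_mx 0 i) (fun x => cos (f x)) (- sin (f x) * partial i f x).
  move=> Ux; apply: is_derive_comp1; exact: smooth_partial_derive sf Ux.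
have ds x i : U x -> is_derive x (delta_mx 0 i) (fun x => sin (f x)) (cos (f x) * partial i f x).
  move=> Ux; apply: is_derive_comp1; exact: smooth_partial_derive sf Ux.
(* Each of the two functions appears in the derivative of the other, so they gain derivatives
   together. *)
suff H k : Ck k U (fun x => cos (f x)) /\ Ck k U (fun x => sin (f x)).
  by split; apply/smooth_onP => k; have [] := H k.
move: sf => /smooth_onP sf; elim: k => [//|k [IHc IHs]].
split.
  apply: (@Ck_bootstrap _ _ _ f _ (fun x => - sin (f x))) => //.
    by move=> x Ux i; exact: dc.
  exact: CkN.
apply: (@Ck_bootstrap _ _ _ f _ (fun x => cos (f x))) => //.
by move=> x Ux i; exact: ds.
Qed.

(** Near a positive point the square root is [expR (ln y / 2)]. *)
Lemma is_derive1_sqrt (x : R) : 0 < x ->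
  is_derive x 1 Num.sqrt ((2 * Num.sqrt x)^-1).
Proof.
move=> x0.
have E y : 0 < y -> expR (ln y / 2) = Num.sqrt y.
  move=> y0; apply/eqP; rewrite -(eqrXn2 (_ : 0 < 2)%N) ?expR_ge0 ?sqrtr_ge0//.
  by rewrite sqr_sqrtr ?ltW// -expRM_natl mulrC divfK ?lnK// pnatr_eq0.
apply: (@near_eq_is_derive _ _ _ (fun y => expR (ln y / 2))).
  near=> y; apply: E; near: y; exact: lt_nbhsr.
have dl : is_derive x 1 (fun y : R => ln y / 2) (x^-1 / 2).
  have := is_deriveM (is_derive1_ln x0) (is_derive_cst (2^-1 : R) x 1).
  by rewrite /GRing.scale /= mulr0 add0r [2^-1 * _]mulrC.
apply: is_derive_eq (is_derive_comp1 (is_derive_expR _) dl) _.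
rewrite E// -{2}(sqr_sqrtr (ltW x0)); field.
by rewrite gt_eqF ?sqrtr_gt0.
Unshelve. all: by end_near. Qed.

(** The inverse square root is preferred to the square root because its derivative is polynomial in
    itself; the square root is recovered as [f] times it. *)
Lemma smooth_rsqrt n U (f : 'rV[R]_n -> R) : open U -> (forall x, U x -> 0 < f x) ->
  smooth_on U f -> smooth_on U (fun x => (Num.sqrt (f x))^-1).
Proof.
move=> oU f0 sf.
have cf x : U x -> {for x, continuous f} by move: sf => /smooth_onE[+ _ _]; apply.
apply: (@smooth_comp_bootstrap _ _ f (fun x => - (2^-1) *
   ((Num.sqrt (f x))^-1 * ((Num.sqrt (f x))^-1 * (Num.sqrt (f x))^-1)))) => //.
- move=> x Ux i.
  have s0 : Num.sqrt (f x) != 0 by rewrite gt_eqF ?sqrtr_gt0 ?f0.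
  have [d1 d2] := is_derive_comp1 (is_derive1_sqrt (f0 x Ux)) (smooth_partial_derive i sf Ux).
  split; first exact: derivableV.
  rewrite (deriveV (f := fun y => Num.sqrt (f y)) s0 d1) d2 /GRing.scale /=; field; exact: s0.
- move=> x Ux; have s0 : Num.sqrt (f x) != 0 by rewrite gt_eqF ?sqrtr_gt0 ?f0.
  exact: (cvgV s0 (@continuous_comp _ _ _ f Num.sqrt _ (cf x Ux) (@sqrt_continuous R _))).
- move=> k Hk; apply: CkM => //; first exact: (@Ck_cst R n R).
  by apply: CkM => //; exact: CkM.
Qed.

End ChainRule.

(** * Symmetry of second derivatives *)

Section Clairaut.
Variable R : realType.

Let corner n (x : 'rV[R]_n) (i j : 'I_n) (s t : R) : 'rV[R]_n :=
  x + s *: delta_mx 0 i + t *: delta_mx 0 j.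

Let corner_ball n (x : 'rV[R]_n) i j (d s t : R) : 0 < d ->
  `|s| < d / 2 -> `|t| < d / 2 -> ball x d (corner x i j s t).
Proof.
move=> d0 sd td; apply: row_ball => // l.
rewrite !mxE eqxx /= -addrA opprD addrA subrr add0r normrN.
apply: le_lt_trans (ler_normD _ _) _; rewrite (splitr d) !normrM.
apply: ltr_leD.
  by apply: le_lt_trans sd; case: eqP => _; rewrite ?normr1 ?normr0 ?mulr1 ?mulr0.
by apply: le_trans (ltW td); case: eqP => _; rewrite ?normr1 ?normr0 ?mulr1 ?mulr0.
Qed.

Let second_difference n (U : set 'rV[R]_n) (f : 'rV[R]_n -> R) (x : 'rV[R]_n) i j (d t : R) :
  0 < d -> (forall y, ball x d y -> U y) -> Ck 2 U f -> `|t| < d / 2 ->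
  exists2 y, ball x d y &
    f (corner x i j t t) - f (corner x i j t 0) - (f (corner x i j 0 t) - f (corner x i j 0 0))
    = partial j (partial i f) y * t * t.
Proof.
move=> d0 dU [_ [df pf]] td; have [_ [dpf _]] := pf i.
have inU s t' : `|s| <= `|t| -> `|t'| <= `|t| -> U (corner x i j s t').
  by move=> st t't; apply/dU/corner_ball => //; [apply: le_lt_trans td|apply: le_lt_trans td].
have dphi (s t' : R) : `|s| <= `|t| -> `|t'| <= `|t| ->
    is_derive s 1 (fun s : R => f (corner x i j s t')) (partial i f (corner x i j s t')).
  move=> st t't.
  have E s' : corner x i j s' t' = x + t' *: delta_mx 0 j + s' *: delta_mx 0 i.
    by rewrite /corner addrAC.
  have -> : (fun s => f (corner x i j s t')) =
     (fun s => f (x + t' *: delta_mx 0 j + s *: delta_mx 0 i)).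
    by apply/funext => s'; rewrite E.
  rewrite E; apply: is_derive_line; rewrite -E.
  by apply: df; exact: inU.
have dpsi (s t' : R) : `|s| <= `|t| -> `|t'| <= `|t| ->
    is_derive t' 1 (fun t' : R => partial i f (corner x i j s t'))
      (partial j (partial i f) (corner x i j s t')).
  by move=> st t't; apply: is_derive_line; apply: dpf; exact: inU.
have t0 : `|0 : R| <= `|t| by rewrite normr0.
have [c ct /= E1] := @mean_value_abs R
  (fun s => f (corner x i j s t) - f (corner x i j s 0))
  (fun s => partial i f (corner x i j s t) - partial i f (corner x i j s 0)) t
  (fun s st => is_deriveB (dphi s t st (lexx _)) (dphi s 0 st t0)).
have [e et E2] := @mean_value_abs R (fun t' => partial i f (corner x i j c t'))
  (fun t' => partial j (partial i f) (corner x i j c t')) t (fun t' => dpsi c t' ct).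
exists (corner x i j c e).
  by apply: corner_ball => //; [apply: le_lt_trans td|apply: le_lt_trans td].
by rewrite E1 E2.
Qed.

Lemma continuous_at_ball n (g : 'rV[R]_n -> R) (x : 'rV[R]_n) (e : R) :
  {for x, continuous g} -> 0 < e ->
  exists2 d, 0 < d & forall y, ball x d y -> `|g x - g y| <= e.
Proof.
move=> /cvgrPdist_le cg e0; have /nbhs_ballP[d /= d0 Hd] := cg _ e0.
by exists d.
Qed.

Lemma eq_close (a b : R) :
  (forall e, 0 < e -> exists2 c, `|a - c| <= e / 2 & `|b - c| <= e / 2) -> a = b.
Proof.
move=> H; apply/eqP; rewrite -subr_eq0 -normr_le0; apply/ler_addgt0Pr => e e0.
have [c ac bc] := H e e0.
rewrite add0r (splitr e) -(subrKA c) (le_trans (ler_normD _ _))//.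
by rewrite lerD// distrC.
Qed.

(** The second difference of [f] over a small square does not depend on the order of the two
    directions. By two applications of the mean value theorem it equals the squared side times
    either mixed partial at some nearby point, and continuity at [x] concludes. *)
Lemma partialC n U (f : 'rV[R]_n -> R) x (i j : 'I_n) :
  open U -> Ck 2 U f -> U x ->
  partial i (partial j f) x = partial j (partial i f) x.
Proof.
move=> oU Hf Ux; apply: eq_close => e e0.
have e2 : 0 < e / 2 by rewrite divr_gt0.
have cp k l : {for x, continuous (partial k (partial l f))}.
  by have [_ [_ pf]] := Hf; have [_ [_ ppf]] := pf l; have [] := ppf k => + _; apply.
have [d1 d10 Hd1] := continuous_at_ball (cp i j) e2.
have [d2 d20 Hd2] := continuous_at_ball (cp j i) e2.
have /nbhs_ballP[d3 /= d30 Hd3] : nbhs x U by exact: open_nbhs_nbhs.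
pose d := Num.min d1 (Num.min d2 d3).
have d0 : 0 < d by rewrite /d !lt_min d10 d20.
have dd1 : d <= d1 by rewrite /d ge_min lexx.
have dd2 : d <= d2 by rewrite /d !ge_min lexx orbT.
have dd3 : d <= d3 by rewrite /d !ge_min lexx !orbT.
have td : `|d / 3| < d / 2.
  rewrite ger0_norm ?divr_ge0// ?ltW//; lra.
have dU y : ball x d y -> U y by move=> /(le_ball dd3)/Hd3.
have [y yb E1] := second_difference i j d0 dU Hf td.
have [z zb E2] := second_difference j i d0 dU Hf td.
have E : partial j (partial i f) y = partial i (partial j f) z.
  have Ht (a b t : R) : t != 0 -> a * t * t = b * t * t -> a = b.
    by move=> t0 /(mulIf t0)/(mulIf t0).
  apply: (Ht _ _ (d / 3)); first by rewrite gt_eqF// divr_gt0.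
  have C s t : corner x j i s t = corner x i j t s by rewrite /corner addrAC.
  apply: etrans (esym E1) (etrans _ E2); rewrite !C.
  have Hr (a b c e' : R) : a - b - (c - e') = a - c - (b - e') by ring.
  exact: Hr.
have H1 := Hd2 y (le_ball dd2 yb); have H2 := Hd1 z (le_ball dd1 zb).
by exists (partial i (partial j f) z); [|rewrite -E].
Qed.

End Clairaut.

(** * Pullbacks of metrics *)

Section Pullback.
Variable R : realType.

Lemma mulmx_eq_row n m (A B : 'M[R]_(n, m)) :
  (forall v : 'rV[R]_n, v *m A = v *m B) -> A = B.
Proof. by move=> H; apply/row_matrixP => i; rewrite !rowE. Qed.

Lemma jacobian_comp n m p (f : 'rV[R]_n -> 'rV[R]_m) (h : 'rV[R]_m -> 'rV[R]_p) x :
  differentiable f x -> differentiable h (f x) ->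
  'J (fun y => h (f y)) x = 'J f x *m 'J h (f x).
Proof.
move=> df dh; apply: mulmx_eq_row => v.
have dc : differentiable (h \o f) x by exact: differentiable_comp.
rewrite -deriveEjacobian// mulmxA -(deriveEjacobian v df) -(deriveEjacobian _ dh).
by rewrite deriveE// diff_comp//= -!deriveE.
Qed.

Lemma pullback_comp n m p (f : 'rV[R]_n -> 'rV[R]_m) (h : 'rV[R]_m -> 'rV[R]_p) g x :
  differentiable f x -> differentiable h (f x) ->
  pullback (fun y => h (f y)) g x = pullback f (pullback h g) x.
Proof.
by move=> df dh; rewrite /pullback (jacobian_comp df dh) trmx_mul !mulmxA.
Qed.

Lemma pullback_form n m (f : 'rV[R]_n -> 'rV[R]_m) g x (v w : 'rV[R]_n) :
  differentiable f x ->
  v *m pullback f g x *m w^T = 'D_v f x *m g (f x) *m ('D_w f x)^T.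
Proof.
by move=> df; rewrite /pullback !(deriveEjacobian _ df) trmx_mul !mulmxA.
Qed.

(** Polarization. It reduces identities between pulled-back metrics to scalar identities in a single
    vector. *)
Lemma symmetric_form_eq n (A B : 'M[R]_n) : A^T = A -> B^T = B ->
  (forall v : 'rV[R]_n, (v *m A *m v^T) 0 0 = (v *m B *m v^T) 0 0) -> A = B.
Proof.
move=> sA sB H; apply/eqP; rewrite -subr_eq0; apply/eqP.
have mxE_sub (M N : 'M[R]_1) : (M - N) 0 0 = M 0 0 - N 0 0 by rewrite !mxE.
have mxE_add (M N : 'M[R]_1) : (M + N) 0 0 = M 0 0 + N 0 0 by rewrite !mxE.
set C := A - B.
have sC : C^T = C by rewrite /C linearB /= sA sB.
have C0 (v : 'rV[R]_n) : (v *m C *m v^T) 0 0 = 0.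
  by rewrite /C mulmxBr mulmxBl !mxE_sub H subrr.
have E i j : C i j = ((delta_mx 0 i : 'rV[R]_n) *m C *m (delta_mx 0 j : 'rV[R]_n)^T) 0 0.
  by rewrite -rowE trmx_delta -colE !mxE.
apply/matrixP => i j; rewrite [RHS]mxE.
have := C0 (delta_mx 0 i + delta_mx 0 j).
rewrite [(_ + _)^T]linearD /= mulmxDl mulmxDr !mulmxDl.
rewrite !mxE_add.
rewrite -!E; have := C0 (delta_mx 0 i); have := C0 (delta_mx 0 j).
have Cji : C j i = C i j by have /matrixP/(_ i j) := sC; rewrite [LHS]mxE.
have Hr (a b c : R) : a = 0 -> b = 0 -> b + c + (c + a) = 0 -> c = 0 by move=> *; lra.
rewrite -!E => Cjj Cii; rewrite Cji; exact: (Hr _ _ _ Cjj Cii).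
Qed.

Lemma pullback_sym n m (f : 'rV[R]_n -> 'rV[R]_m) g x :
  (g (f x))^T = g (f x) -> (pullback f g x)^T = pullback f g x.
Proof. by move=> sg; rewrite /pullback !trmx_mul trmxK sg mulmxA. Qed.

Lemma smooth_row_differentiable n m U (f : 'rV[R]_n -> 'rV[R]_m) x : open U ->
  smooth_on U f -> U x -> differentiable f x.
Proof. by move=> oU /smooth_onP sf; apply: Ck1_row_differentiable => //; exact: sf. Qed.

Lemma smooth_continuous n (V : normedModType R) (f : 'rV[R]_n -> V) :
  smooth_on setT f -> continuous f.
Proof. by move=> /smooth_onE[cf _ _] x; exact: cf. Qed.

End Pullback.

(** * Metrics invariant under rotations of the disc *)

Section DerivativeRules.
Variables (R : realType) (V : normedModType R).
Implicit Types (f g : V -> R) (x v : V) (df dg : R).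

Lemma is_derive_cstE (c : R) x v : is_derive x v (fun=> c) (0 : R).
Proof. exact: is_derive_cst. Qed.

Lemma is_derive_val f x v df df' : is_derive x v f df -> df = df' -> is_derive x v f df'.
Proof. by move=> H <-. Qed.

Lemma is_derive_add f g x v df dg : is_derive x v f df -> is_derive x v g dg ->
  is_derive x v (fun y => f y + g y) (df + dg).
Proof. by move=> H1 H2; exact: is_deriveD. Qed.

Lemma is_derive_opp f x v df : is_derive x v f df ->
  is_derive x v (fun y => - f y) (- df).
Proof. by move=> H1; exact: is_deriveN. Qed.

Lemma is_derive_mul f g x v df dg : is_derive x v f df -> is_derive x v g dg ->
  is_derive x v (fun y => f y * g y) (df * g x + f x * dg).
Proof.
move=> [f1 <-] [g1 <-]; split; first by apply: derivableM; [exact: f1|exact: g1].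
by rewrite (deriveM f1 g1) /GRing.scale /= addrC mulrC.
Qed.

Lemma is_derive_sqr f x v df : is_derive x v f df ->
  is_derive x v (fun y => f y ^+ 2) (2 * f x * df).
Proof.
move=> H; have -> : (fun y => f y ^+ 2) = (fun y => f y * f y).
  by apply/funext => y; rewrite expr2.
by apply: is_derive_eq (is_derive_mul H H) _; ring.
Qed.

Lemma is_derive_exp f x v df n : is_derive x v f df ->
  is_derive x v (fun y => f y ^+ n.+1) (n.+1%:R * f x ^+ n * df).
Proof.
move=> H; elim: n => [|n IH].
  by rewrite expr0 mulr1 mul1r (_ : (fun y => _) = f)//; apply/funext => y; rewrite expr1.
have -> : (fun y => f y ^+ n.+2) = (fun y => f y * f y ^+ n.+1).
  by apply/funext => y; rewrite exprS.
apply: is_derive_eq (is_derive_mul H IH) _.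
by rewrite -[n.+2%:R]natr1 exprS; ring.
Qed.

Lemma is_derive_inv f x v df : f x != 0 -> is_derive x v f df ->
  is_derive x v (fun y => (f y)^-1) (- (f x ^+ 2)^-1 * df).
Proof.
move=> f0 [d <-]; split; first exact: derivableV.
by rewrite deriveV// .
Qed.

Lemma is_derive_cos_comp f x v df : is_derive x v f df ->
  is_derive x v (fun y => cos (f y)) (- sin (f x) * df).
Proof. by move=> H; apply: is_derive_comp1. Qed.

Lemma is_derive_sin_comp f x v df : is_derive x v f df ->
  is_derive x v (fun y => sin (f y)) (cos (f x) * df).
Proof. by move=> H; apply: is_derive_comp1. Qed.

Lemma is_derive_sqrt_comp f x v df : 0 < f x -> is_derive x v f df ->
  is_derive x v (fun y => Num.sqrt (f y)) ((2 * Num.sqrt (f x))^-1 * df).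
Proof. by move=> f0 H; exact: (is_derive_comp1 (is_derive1_sqrt f0) H). Qed.

End DerivativeRules.

(** Differentiation directed by the syntax of the function: the derivative is built by unification,
    and side conditions on denominators and radicands are left as goals. [derive_with] then only has
    to identify the result with the expected value. *)
Ltac derive_rules :=
  lazymatch goal with
  | H : is_derive ?x ?v ?f _ |- is_derive ?x ?v ?f _ => exact: H
  | |- is_derive _ _ (fun _ => ?c) _ => notypeclasses refine (is_derive_cstE _ _ _)
  | |- is_derive _ _ (fun x => fun_of_matrix x _ _) _ => notypeclasses refine (is_derive_coord _ _ _)
  | |- is_derive _ _ (fun x => x) _ => notypeclasses refine (is_derive_id _ _)
  | |- is_derive _ _ (fun x => @?f x + @?g x) _ =>
      notypeclasses refine (is_derive_add (f := f) (g := g) _ _); derive_rules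
  | |- is_derive _ _ (fun x => - @?f x) _ =>
      notypeclasses refine (is_derive_opp (f := f) _); derive_rules
  | |- is_derive _ _ (fun x => @?f x * @?g x) _ =>
      notypeclasses refine (is_derive_mul (f := f) (g := g) _ _); derive_rules
  | |- is_derive _ _ (fun x => @?f x ^+ 2) _ =>
      notypeclasses refine (is_derive_sqr (f := f) _); derive_rules
  | |- is_derive _ _ (fun x => @?f x ^+ _) _ =>
      notypeclasses refine (is_derive_exp (f := f) _ _); derive_rules
  | |- is_derive _ _ (fun x => (@?f x)^-1) _ =>
      notypeclasses refine (is_derive_inv (f := f) _ _); [|derive_rules]
  | |- is_derive _ _ (fun x => Num.sqrt (@?f x)) _ =>
      notypeclasses refine (is_derive_sqrt_comp (f := f) _ _); [|derive_rules]
  | |- is_derive _ _ (fun x => cos (@?f x)) _ =>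
      notypeclasses refine (is_derive_cos_comp (f := f) _); derive_rules
  | |- is_derive _ _ (fun x => sin (@?f x)) _ =>
      notypeclasses refine (is_derive_sin_comp (f := f) _); derive_rules
  | |- _ => idtac
  end.

Ltac derive_with tac :=
  notypeclasses refine (is_derive_val _ _); [derive_rules | cbv beta; tac].

Ltac smooth_rules :=
  lazymatch goal with
  | H : smooth_on ?U ?f |- smooth_on ?U ?f => exact: H
  | |- open _ => first [assumption | exact: openT | idtac]
  | |- smooth_on _ (fun _ => ?c) => apply: smooth_cst
  | |- smooth_on _ (fun x => fun_of_matrix x _ _) => apply: smooth_coord
  | |- smooth_on _ (fun x => @?f x + @?g x) =>
      apply: (smoothD (f := f) (g := g)); smooth_rules
  | |- smooth_on _ (fun x => - @?f x) => apply: (smoothN (f := f)); smooth_rules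
  | |- smooth_on _ (fun x => @?f x * @?g x) =>
      apply: (smoothM (f := f) (g := g)); smooth_rules
  | |- smooth_on _ (fun x => @?f x ^+ _) => apply: (smoothX (f := f)); smooth_rules
  | |- smooth_on _ (fun x => (@?f x)^-1) => apply: (smoothV (f := f)); [smooth_rules| |smooth_rules]
  | |- smooth_on _ (fun x => cos (@?f x)) =>
      apply: (proj1 (smooth_cos_sin (f := f) _ _)); smooth_rules
  | |- smooth_on _ (fun x => sin (@?f x)) =>
      apply: (proj2 (smooth_cos_sin (f := f) _ _)); smooth_rules
  | |- _ => idtac
  end.

(** * Coordinates on R^4 and twisted metrics *)

Section Coordinates.
Variable R : realType.

Lemma ord4P (P : 'I_4 -> Prop) : P 0 -> P 1 -> P 2 -> P 3 -> forall j, P j.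
Proof.
move=> P0 P1 P2 P3 [[|[|[|[|//]]]] Hj].
- by rewrite (_ : Ordinal Hj = 0)//; exact: val_inj.
- by rewrite (_ : Ordinal Hj = 1)//; exact: val_inj.
- by rewrite (_ : Ordinal Hj = 2)//; exact: val_inj.
- by rewrite (_ : Ordinal Hj = 3)//; exact: val_inj.
Qed.

Lemma sum4 (F : 'I_4 -> R) : \sum_(j < 4) F j = F 0 + F 1 + F 2 + F 3.
Proof.
rewrite !big_ord_recl big_ord0 addr0 !addrA.
by congr (F _ + F _ + F _ + F _); exact: val_inj.
Qed.

Lemma row4_0 (a b c d : R) : row4 a b c d 0 0 = a. Proof. by rewrite mxE. Qed.
Lemma row4_1 (a b c d : R) : row4 a b c d 0 1 = b. Proof. by rewrite mxE. Qed.
Lemma row4_2 (a b c d : R) : row4 a b c d 0 2 = c. Proof. by rewrite mxE. Qed.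
Lemma row4_3 (a b c d : R) : row4 a b c d 0 3 = d. Proof. by rewrite mxE. Qed.

Definition row4s := (row4_0, row4_1, row4_2, row4_3).

Lemma row4_eta (x : 'rV[R]_4) : x = row4 (x 0 0) (x 0 1) (x 0 2) (x 0 3).
Proof. by apply/rowP; apply: ord4P; rewrite row4s. Qed.

Lemma row4_eq (x y : 'rV[R]_4) : x 0 0 = y 0 0 -> x 0 1 = y 0 1 -> x 0 2 = y 0 2 ->
  x 0 3 = y 0 3 -> x = y.
Proof. by move=> *; apply/rowP; exact: ord4P. Qed.

Lemma smooth_row4 n U (a b c d : 'rV[R]_n -> R) : open U ->
  smooth_on U a -> smooth_on U b -> smooth_on U c -> smooth_on U d ->
  smooth_on U (fun x => row4 (a x) (b x) (c x) (d x)).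
Proof.
move=> oU sa sb sc sd; apply: (smooth_mx _ oU).2 => i j; rewrite (ord1 i).
move: j; apply: ord4P.
- by rewrite (_ : (fun x => _) = a)//; apply/funext => x; rewrite row4s.
- by rewrite (_ : (fun x => _) = b)//; apply/funext => x; rewrite row4s.
- by rewrite (_ : (fun x => _) = c)//; apply/funext => x; rewrite row4s.
- by rewrite (_ : (fun x => _) = d)//; apply/funext => x; rewrite row4s.
Qed.

Lemma is_derive_row4 (V : normedModType R) (a b c d : V -> R) x v da db dc dd :
  is_derive x v a da -> is_derive x v b db -> is_derive x v c dc -> is_derive x v d dd ->
  is_derive x v (fun x => row4 (a x) (b x) (c x) (d x)) (row4 da db dc dd).
Proof.
move=> ia ib ic id'.
have E j : is_derive x v (fun x => row4 (a x) (b x) (c x) (d x) 0 j) (row4 da db dc dd 0 j).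
  move: j; apply: ord4P.
  - by rewrite (_ : (fun x => _) = a) ?row4s//; apply/funext => y; rewrite row4s.
  - by rewrite (_ : (fun x => _) = b) ?row4s//; apply/funext => y; rewrite row4s.
  - by rewrite (_ : (fun x => _) = c) ?row4s//; apply/funext => y; rewrite row4s.
  - by rewrite (_ : (fun x => _) = d) ?row4s//; apply/funext => y; rewrite row4s.
have dv : derivable (fun x => row4 (a x) (b x) (c x) (d x)) x v.
  by apply/derivable_mxP => i j; rewrite (ord1 i); have [] := E j.
by split=> //; apply/rowP => j; rewrite derive_mx// mxE; have [] := E j.
Qed.

Lemma form4E (M : 'M[R]_4) (v w : 'rV[R]_4) :
  (v *m M *m w^T) 0 0 = \sum_(i < 4) \sum_(j < 4) v 0 i * M i j * w 0 j.
Proof.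
rewrite mxE exchange_big /=; apply: eq_bigr => j _.
by rewrite !mxE mulr_suml.
Qed.

(* The metrics
   [A |vu + kap v2 J x|^2 + B (x.v)^2 + C (l^2 v2^2 + L^2 v3^2)],
   where [J x = (- x1, x0)], [vu = (v0, v1)] and A, B, C are functions of
   [q = x0^2 + x1^2].  The parameter kap is the rotation of the disc per unit of
   the third coordinate. *)
Definition twisted_metric (A B C : R -> R) (kap l L : R) (x : 'rV[R]_4) : 'M[R]_4 :=
  let a0 := row4 1 0 (- (kap * x 0 1)) 0 in
  let a1 := row4 0 1 (kap * x 0 0) 0 in
  let ch := row4 (x 0 0) (x 0 1) 0 0 in
  let s1 := row4 0 0 l 0 in
  let s2 := row4 0 0 0 L in
  let q := disc_norm2 x in
  \matrix_(i, j) (A q * (a0 0 i * a0 0 j + a1 0 i * a1 0 j) + B q * (ch 0 i * ch 0 j)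
    + C q * (s1 0 i * s1 0 j + s2 0 i * s2 0 j)).

(** The bilinear form of [twisted_metric] with the three coefficients frozen to numbers. They may
    then be replaced by derivatives or by Ricci coefficients, and are atoms for [ring]. *)
Definition twisted_form (A B C kap l L : R) (x v w : 'rV[R]_4) : R :=
  A * ((v 0 0 - kap * x 0 1 * v 0 2) * (w 0 0 - kap * x 0 1 * w 0 2)
       + (v 0 1 + kap * x 0 0 * v 0 2) * (w 0 1 + kap * x 0 0 * w 0 2))
  + B * ((x 0 0 * v 0 0 + x 0 1 * v 0 1) * (x 0 0 * w 0 0 + x 0 1 * w 0 1))
  + C * (l ^+ 2 * (v 0 2 * w 0 2) + L ^+ 2 * (v 0 3 * w 0 3)).

Lemma twisted_metricE A B C kap l L (x v w : 'rV[R]_4) :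
  (v *m twisted_metric A B C kap l L x *m w^T) 0 0 =
  twisted_form (A (disc_norm2 x)) (B (disc_norm2 x)) (C (disc_norm2 x)) kap l L x v w.
Proof.
rewrite form4E !sum4 /twisted_metric !mxE /=; rewrite /twisted_form.
by ring.
Qed.

Lemma twisted_metric_sym A B C kap l L (x : 'rV[R]_4) :
  (twisted_metric A B C kap l L x)^T = twisted_metric A B C kap l L x.
Proof.
apply/matrixP => i j; rewrite mxE [LHS]mxE [RHS]mxE.
by ring.
Qed.

Lemma smooth_disc_norm2 U : open U -> smooth_on U (@disc_norm2 R).
Proof.
move=> oU; rewrite (_ : @disc_norm2 R = (fun x => x 0 0 ^+ 2 + x 0 1 ^+ 2))//.
smooth_rules.
Qed.

Lemma smooth_twisted_metric A B C kap l L (U : set 'rV[R]_4) : open U ->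
  smooth_on U (fun x => A (disc_norm2 x)) -> smooth_on U (fun x => B (disc_norm2 x)) ->
  smooth_on U (fun x => C (disc_norm2 x)) ->
  smooth_on U (twisted_metric A B C kap l L).
Proof.
move=> oU sA sB sC; apply: (smooth_mx _ oU).2 => i j.
have sc k (a b c d : 'rV[R]_4 -> R) :
  smooth_on U a -> smooth_on U b -> smooth_on U c -> smooth_on U d ->
  smooth_on U (fun x => row4 (a x) (b x) (c x) (d x) 0 k).
  by move=> *; apply: ((smooth_mx _ oU).1 (smooth_row4 oU _ _ _ _)).
have s0 c : smooth_on U (fun=> c : R) by exact: smooth_cst.
have -> : (fun x => twisted_metric A B C kap l L x i j) = (fun x =>
  let a0 := row4 1 0 (- (kap * x 0 1)) 0 in
  let a1 := row4 0 1 (kap * x 0 0) 0 in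
  let ch := row4 (x 0 0) (x 0 1) 0 0 in
  let s1 := row4 0 0 l 0 in
  let s2 := row4 0 0 0 L in
  let q := disc_norm2 x in
  (A q * (a0 0 i * a0 0 j + a1 0 i * a1 0 j) + B q * (ch 0 i * ch 0 j)
    + C q * (s1 0 i * s1 0 j + s2 0 i * s2 0 j))).
  by apply/funext => x; rewrite /twisted_metric mxE.
have sx m : smooth_on U (fun x : 'rV[R]_4 => x 0 m : R) by exact: smooth_coord.
have n1 : smooth_on U (fun x : 'rV[R]_4 => - (kap * x 0 1) : R) by smooth_rules.
have n2 : smooth_on U (fun x : 'rV[R]_4 => kap * x 0 0 : R) by smooth_rules.
have R1 k := sc k _ _ _ _ (s0 1) (s0 0) n1 (s0 0).
have R2 k := sc k _ _ _ _ (s0 0) (s0 1) n2 (s0 0).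
have R3 k := sc k _ _ _ _ (sx 0) (sx 1) (s0 0) (s0 0).
cbv zeta; have R1i := R1 i; have R1j := R1 j; have R2i := R2 i; have R2j := R2 j.
have R3i := R3 i; have R3j := R3 j.
smooth_rules.
Qed.

(** In the untwisted components [w] of the disc part, the form [A |w|^2 + B (x.w)^2] has the
    eigenvalue [A] across [x] and [A + B |x|^2] along [x]. The coefficient [B] may be negative, in
    which case Cauchy-Schwarz bounds its term. *)
Lemma twisted_form_gt0 (A B C kap l L : R) (x v : 'rV[R]_4) :
  0 < A -> 0 < A + B * disc_norm2 x -> 0 < C -> l != 0 -> L != 0 -> v != 0 ->
  0 < twisted_form A B C kap l L x v v.
Proof.
move=> A0 D0 C0 l0 L0 v0.
pose w0 := v 0 0 - kap * x 0 1 * v 0 2; pose w1 := v 0 1 + kap * x 0 0 * v 0 2.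
have E : twisted_form A B C kap l L x v v =
   A * (w0 ^+ 2 + w1 ^+ 2) + B * (x 0 0 * w0 + x 0 1 * w1) ^+ 2
   + C * ((l * v 0 2) ^+ 2 + (L * v 0 3) ^+ 2).
  by rewrite /twisted_form /w0 /w1; ring.
have base : 0 <= A * (w0 ^+ 2 + w1 ^+ 2) + B * (x 0 0 * w0 + x 0 1 * w1) ^+ 2 /\
    (A * (w0 ^+ 2 + w1 ^+ 2) + B * (x 0 0 * w0 + x 0 1 * w1) ^+ 2 = 0 ->
      w0 ^+ 2 + w1 ^+ 2 = 0).
  have cs : (x 0 0 * w0 + x 0 1 * w1) ^+ 2 <= disc_norm2 x * (w0 ^+ 2 + w1 ^+ 2).
    rewrite -subr_ge0 (_ : _ - _ = (x 0 0 * w1 - x 0 1 * w0) ^+ 2) ?sqr_ge0//.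
    by rewrite /disc_norm2; ring.
  have n0 : 0 <= w0 ^+ 2 + w1 ^+ 2 by rewrite addr_ge0// sqr_ge0.
  have s0 := sqr_ge0 (x 0 0 * w0 + x 0 1 * w1).
  move: (w0 ^+ 2 + w1 ^+ 2) ((_ + _) ^+ 2) n0 s0 cs => n s n0 s0 cs.
  have [B0|B0] := leP 0 B.
    have := mulr_ge0 (ltW A0) n0; have := mulr_ge0 B0 s0 => h1 h2; split; first lra.
    by move=> h; have : A * n = 0 by [lra]; move/eqP; rewrite mulf_eq0 gt_eqF//= => /eqP.
  have h1 : B * (disc_norm2 x * n) <= B * s by rewrite ler_nM2l.
  have h2 := mulr_ge0 (ltW D0) n0.
  rewrite mulrA in h1; rewrite mulrDl in h2; split; first lra.
  move=> h; have : (A + B * disc_norm2 x) * n = 0 by rewrite mulrDl; lra.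
  by move/eqP; rewrite mulf_eq0 gt_eqF//= => /eqP.
rewrite E lt_neqAle eq_sym; have [b1 b2] := base.
have c1 : 0 <= C * ((l * v 0 2) ^+ 2 + (L * v 0 3) ^+ 2).
  by apply: mulr_ge0; [exact: ltW|apply: addr_ge0; exact: sqr_ge0].
rewrite addr_ge0// andbT; apply: contraNneq v0 => /eqP.
rewrite paddr_eq0// => /andP[/eqP/b2/eqP].
rewrite paddr_eq0 ?sqr_ge0// !sqrf_eq0 => /andP[/eqP h0 /eqP h1].
rewrite mulf_eq0 gt_eqF//= paddr_eq0 ?sqr_ge0// !sqrf_eq0 !mulf_eq0.
rewrite (negbTE l0) (negbTE L0) /= => /andP[/eqP v2 /eqP v3].
move: h0 h1; rewrite /w0 /w1 v2 !mulr0 subr0 addr0 => v00 v01.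
by apply/eqP/row4_eq; rewrite ?v00 ?v01 ?v2 ?v3 mxE.
Qed.

Lemma twisted_metric_posdef A B C kap l L (x : 'rV[R]_4) :
  0 < A (disc_norm2 x) -> 0 < A (disc_norm2 x) + B (disc_norm2 x) * disc_norm2 x ->
  0 < C (disc_norm2 x) -> l != 0 -> L != 0 -> posdef (twisted_metric A B C kap l L x).
Proof.
move=> A0 D0 C0 l0 L0; split; first exact: twisted_metric_sym.
by move=> v v0; rewrite twisted_metricE; exact: twisted_form_gt0.
Qed.

End Coordinates.

Section UnitCircle.
Variable R : realType.

Lemma unit_circle_angle (a b : R) : a ^+ 2 + b ^+ 2 = 1 ->
  exists t, a = cos t /\ b = sin t.
Proof.
move=> ab1.
have a1 : -1 <= a <= 1.
  rewrite -ler_norml -(@ler_pXn2r _ 2)// ?nnegrE// expr1n real_normK ?num_real//.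
  by rewrite -ab1 lerDl sqr_ge0.
have b2 : b ^+ 2 = 1 - a ^+ 2 by rewrite -ab1; ring.
have [b0|b0] := leP 0 b.
  exists (acos a); rewrite acosK ?in_itv//= sin_acos//; split=> //.
  by rewrite -b2 sqrtr_sqr ger0_norm.
exists (- acos a); rewrite cosN sinN acosK ?in_itv//= sin_acos//; split=> //.
by rewrite -b2 sqrtr_sqr ltr0_norm// opprK.
Qed.

Lemma cos_sin_eq0 (t : R) : 0 <= t < 2 * pi -> cos t = 1 -> t = 0.
Proof.
move=> /andP[t0 t2] ct1.
have p0 := pi_gt0 R.
have [tp|tp] := leP t pi.
  by apply: (@cos_inj R) => //; rewrite ?in_itv/= ?t0 ?tp ?lexx ?ltW// cos0.
have ct' : cos (2 * pi - t) = 1.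
  have -> : 2 * pi - t = - t + pi *+ 2 by rewrite mulr2n; ring.
  by rewrite cosD2pi cosN.
have : 2 * pi - t = 0.
  by apply: (@cos_inj R) => //; rewrite ?in_itv/= ?lexx ?ltW// ?cos0//; lra.
lra.
Qed.

Lemma cos_sin_int (t : R) (k : int) : cos (t + k%:~R * (2 * pi)) = cos t /\
  sin (t + k%:~R * (2 * pi)) = sin t.
Proof.
have H (n : nat) (s : R) : cos (s + n%:R * (2 * pi)) = cos s /\ sin (s + n%:R * (2 * pi)) = sin s.
  elim: n => [|n [IHc IHs]]; first by rewrite mul0r addr0.
  have -> : s + n.+1%:R * (2 * pi) = s + n%:R * (2 * pi) + pi *+ 2.
    by rewrite -natr1 mulr2n; ring.
  by rewrite cosD2pi sinD2pi.
case: k => n; first exact: H.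
have [h1 h2] := H n.+1 (t + (Negz n)%:~R * (2 * pi)).
rewrite -h1 -h2 NegzE mulrNz.
by rewrite (_ : _ + n.+1%:R * _ = t)//; rewrite -[n.+1%:R]/(n.+1%:~R); ring.
Qed.

Lemma cos_sin_eqP (s t : R) : cos s = cos t -> sin s = sin t ->
  exists k : int, s = t + k%:~R * (2 * pi).
Proof.
move=> cst sst.
have p0 : 0 < 2 * pi :> R by rewrite mulr_gt0 ?pi_gt0.
pose k := Num.floor ((s - t) / (2 * pi)); exists k.
pose u := s - t - k%:~R * (2 * pi).
have u0 : u = 0.
  apply: cos_sin_eq0.
    have := floor_itv ((s - t) / (2 * pi)).
    rewrite -/k => /andP[]; rewrite ler_pdivlMr// ltr_pdivrMr// intrD mulrDl mul1r /u => *.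
    by apply/andP; split; lra.
  have := (cos_sin_int u k).1; rewrite /u subrK => <-.
  by rewrite cosB cst sst -!expr2 cos2Dsin2.
by move: u0; rewrite /u => /eqP; rewrite subr_eq0 subr_eq => /eqP ->; rewrite addrC.
Qed.

End UnitCircle.

(** * The metric g1 in Cartesian coordinates around the core *)

Section CoreMetric.
Variable R : realType.
Local Notation p := (@rplus R).

Lemma rplus_gt0 : 0 < p. Proof. exact: powR_gt0. Qed.

Lemma rplus_neq0 : p != 0. Proof. by rewrite gt_eqF ?rplus_gt0. Qed.

Lemma rplus_cube : p ^+ 3 = 2.
Proof.
rewrite /rplus -powR_mulrn ?powR_ge0// -powRrM mulVf ?powRr1//.
Qed.

(** The radius of the theta-circle, [beta = 2 pi k], so that [theta / k] is the polar angle. The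
    value is [2 / V'(p)], since [V'(p) = 2 p + 2 / p^2 = 3 p] by [p^3 = 2]. *)
Definition theta_radius : R := 2 / (3 * p).
Local Notation k := theta_radius.

Lemma theta_radius_gt0 : 0 < k.
Proof. by rewrite divr_gt0// mulr_gt0// rplus_gt0. Qed.

Lemma theta_radius_neq0 : k != 0. Proof. by rewrite gt_eqF ?theta_radius_gt0. Qed.

Lemma betaE : beta R = 2 * pi * k.
Proof. rewrite /beta /k; field. exact: rplus_neq0. Qed.

Lemma beta_gt0 : 0 < beta R.
Proof. by rewrite betaE mulr_gt0 ?theta_radius_gt0// mulr_gt0// pi_gt0. Qed.

Lemma angleE (t : R) : 2 * pi * t / beta R = t / k.
Proof.
have pi0 : (pi : R) != 0 by rewrite gt_eqF ?pi_gt0.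
by rewrite betaE invfM mulrACA divff ?mul1r// mulf_neq0.
Qed.

(* With r = p + q, q = |x|^2 and N = numer q one has V = q N / r.  Since
   dr = 2 x.dx and q dphi^2 = |dx|^2 - (x.dx)^2 / q, the metric g1 becomes
   A |dx|^2 + B (x.dx)^2 + C |ds|^2 with B = (4 r / N - k^2 N / r) / q, where
   the pole at q = 0 cancels because k = 2 / (3 p). *)
Definition numer (q : R) : R := (p + q) ^+ 2 + (p + q) * p + p ^+ 2.
Definition coefA (q : R) : R := k ^+ 2 * numer q / (p + q).
Definition coefB (q : R) : R :=
  - (2 * q / (3 * p)) * (2 * (p + q) + k * numer q) / ((p + q) * numer q).
Definition coefC (q : R) : R := (p + q) ^+ 2.

Lemma numer_gt0 q : 0 <= q -> 0 < numer q.
Proof.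
move=> q0; have p0 := rplus_gt0; have pq : 0 < p + q by rewrite ltr_wpDr.
by rewrite /numer !addr_gt0 ?exprn_gt0// mulr_gt0.
Qed.

Lemma coefA_gt0 q : 0 <= q -> 0 < coefA q.
Proof.
move=> q0; have p0 := rplus_gt0; have pq : 0 < p + q by rewrite ltr_wpDr.
by rewrite /coefA divr_gt0// mulr_gt0 ?numer_gt0// exprn_gt0// theta_radius_gt0.
Qed.

Lemma coefC_gt0 q : 0 <= q -> 0 < coefC q.
Proof. by move=> q0; rewrite exprn_gt0// ltr_wpDr// rplus_gt0. Qed.

(** The radial eigenvalue. The form of [coefB] comes from factoring [4 r^2 - k^2 N^2], where
    [N = 3 p^2 + 3 p q + q^2] yields [2 r - k N = - 2 q^2 / (3 p)]. *)
Lemma coefD q : 0 <= q -> coefA q + coefB q * q = 4 * (p + q) / numer q.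
Proof.
move=> q0; have p0 := rplus_neq0; have N0 : numer q != 0 by rewrite gt_eqF ?numer_gt0.
have pq : p + q != 0 by rewrite gt_eqF// ltr_wpDr// rplus_gt0.
rewrite /coefA /coefB /theta_radius; move: N0; rewrite /numer => N0; field.
by rewrite p0 N0 pq.
Qed.

Lemma coefD_gt0 q : 0 <= q -> 0 < coefA q + coefB q * q.
Proof.
move=> q0; rewrite coefD//; apply: divr_gt0; last exact: numer_gt0.
by apply: mulr_gt0 => //; rewrite ltr_wpDr// rplus_gt0.
Qed.

Lemma disc_norm2_ge0 (x : 'rV[R]_4) : 0 <= disc_norm2 x.
Proof. by rewrite /disc_norm2 addr_ge0// sqr_ge0. Qed.

Lemma smooth_coefs : [/\ smooth_on setT (fun x : 'rV[R]_4 => coefA (disc_norm2 x)),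
  smooth_on setT (fun x : 'rV[R]_4 => coefB (disc_norm2 x)) &
  smooth_on setT (fun x : 'rV[R]_4 => coefC (disc_norm2 x))].
Proof.
have sq : smooth_on setT (fun x : 'rV[R]_4 => disc_norm2 x).
  by apply: smooth_disc_norm2; exact: openT.
have h1 (x : 'rV[R]_4) : setT x -> p + disc_norm2 x != 0.
  by rewrite gt_eqF// ltr_wpDr ?disc_norm2_ge0// rplus_gt0.
have h2 (x : 'rV[R]_4) : setT x -> (p + disc_norm2 x) * numer (disc_norm2 x) != 0.
  by move=> Tx; rewrite mulf_neq0 ?h1// gt_eqF ?numer_gt0// disc_norm2_ge0.
split; rewrite /coefA /coefB /coefC /numer; smooth_rules; [exact: h1|].
by move=> x Tx; have := h2 x Tx; rewrite /numer.
Qed.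

Definition core_metric : 'rV[R]_4 -> 'M[R]_4 := twisted_metric coefA coefB coefC 0 1 1.

Lemma core_metric_smooth : smooth_on setT core_metric.
Proof.
have [sA sB sC] := smooth_coefs.
by apply: smooth_twisted_metric => //; exact: openT.
Qed.

Lemma core_metric_posdef (x : 'rV[R]_4) : posdef (core_metric x).
Proof.
apply: twisted_metric_posdef; rewrite ?oner_eq0//.
- exact/coefA_gt0/disc_norm2_ge0.
- exact/coefD_gt0/disc_norm2_ge0.
- exact/coefC_gt0/disc_norm2_ge0.
Qed.

Lemma open_coord_gt (n : nat) (j : 'I_n) (c : R) : open [set x : 'rV[R]_n | c < x 0 j].
Proof.
rewrite (_ : [set x | _] = (fun x : 'rV[R]_n => x 0 j) @^-1` [set t | c < t])//.
apply: open_comp; last exact: open_gt.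
by move=> x _; exact: (@coord_continuous R 1 n 0 j x).
Qed.

Lemma smooth_polar : smooth_on [set x : 'rV[R]_4 | p < x 0 0] (@polar R).
Proof.
set U := [set x | _]; have oU : open U by exact: open_coord_gt.
have srad : smooth_on U (fun x : 'rV[R]_4 => Num.sqrt (x 0 0 - p)).
  have s1 : smooth_on U (fun x : 'rV[R]_4 => x 0 0 - p) by smooth_rules.
  have pos x : U x -> 0 < x 0 0 - p by rewrite /U /= subr_gt0.
  apply: (smooth_congr oU _ (smoothM oU s1 (smooth_rsqrt oU pos s1))) => x /pos x0.
  by rewrite -{1}(sqr_sqrtr (ltW x0)) expr2 mulfK// gt_eqF// sqrtr_gt0.
rewrite (_ : @polar R = (fun x => row4
  (Num.sqrt (x 0 0 - p) * cos (2 * pi * x 0 1 / beta R))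
  (Num.sqrt (x 0 0 - p) * sin (2 * pi * x 0 1 / beta R)) (x 0 2) (x 0 3)))//.
by apply: (smooth_row4 oU); smooth_rules.
Qed.

Lemma diag4_form (a b c d : R) (v : 'rV[R]_4) :
  (v *m diag_mx (row4 a b c d) *m v^T) 0 0 =
  a * v 0 0 ^+ 2 + b * v 0 1 ^+ 2 + c * v 0 2 ^+ 2 + d * v 0 3 ^+ 2.
Proof.
rewrite mxE sum4 !mul_mx_diag !mxE /=.
by ring.
Qed.

Lemma pullback_polar_core (r theta s1 s2 : R) : p < r ->
  pullback (@polar R) core_metric (row4 r theta s1 s2)
  = diag_mx (row4 (Vfun r)^-1 (Vfun r) (r ^+ 2) (r ^+ 2)).
Proof.
move=> pr; set x := row4 r theta s1 s2.
have oU := @open_coord_gt 4 0 p.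
have Ux : [set x : 'rV[R]_4 | p < x 0 0] x by rewrite /= /x row4s.
have dpol := smooth_row_differentiable oU smooth_polar Ux.
apply: symmetric_form_eq.
- by apply: pullback_sym; exact: twisted_metric_sym.
- exact: tr_diag_mx.
move=> v; rewrite pullback_form// twisted_metricE diag4_form.
pose s := Num.sqrt (r - p).
have s0 : s != 0 by rewrite gt_eqF// sqrtr_gt0 subr_gt0.
have rE : r = p + s ^+ 2 by rewrite sqr_sqrtr ?subr_ge0 1?ltW//; ring.
have drad : is_derive x v (fun y : 'rV[R]_4 => Num.sqrt (y 0 0 - p)) (v 0 0 / (2 * s)).
  have d1 : is_derive x v (fun y : 'rV[R]_4 => y 0 0 - p) (v 0 0).
    by derive_with ltac:(ring).
  have d2 : 0 < x 0 0 - p by rewrite /x row4s subr_gt0.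
  have d3 := @is_derive_comp1 R _ (fun y : 'rV[R]_4 => y 0 0 - p) Num.sqrt x v _ _
    (is_derive1_sqrt d2) d1.
  apply: is_derive_eq d3 _.
  by rewrite /x row4s -/s; field.
pose c := cos (theta / k); pose sn := sin (theta / k).
have cs1 : c ^+ 2 + sn ^+ 2 = 1 by exact: cos2Dsin2.
have dphi : is_derive x v (fun y : 'rV[R]_4 => 2 * pi * y 0 1 / beta R) (v 0 1 / k).
  by derive_with ltac:(rewrite mulr0 addr0 mul0r add0r angleE).
have := is_derive_row4 (is_derive_mul drad (is_derive_cos_comp dphi))
   (is_derive_mul drad (is_derive_sin_comp dphi))
   (is_derive_coord x v 2) (is_derive_coord x v 3).
move=> [_]; rewrite -[X in 'D_v X x]/(@polar R) => ->.
have xs : Num.sqrt (x 0 0 - p) = s by rewrite /x row4s.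
have xc : 2 * pi * x 0 1 / beta R = theta / k by rewrite angleE /x row4s.
have polE : polar x = row4 (s * c) (s * sn) s1 s2.
  by rewrite /polar xs xc /x !row4s.
have q2 : disc_norm2 (polar x) = s ^+ 2.
  by rewrite polE /disc_norm2 !row4s -[RHS]mulr1 -cs1; ring.
rewrite q2 /twisted_form polE !row4s -/s !angleE -/c -/sn.
(* In the frame rotated by the polar angle, the image of [v] in the disc has radial component [a]
   and angular component [s * b]. *)
set a := v 0 0 / (2 * s); set b := v 0 1 / k.
have E1 : (a * c + s * (- sn * b)) ^+ 2 + (a * sn + s * (c * b)) ^+ 2 = a ^+ 2 + s ^+ 2 * b ^+ 2.
  by rewrite -[RHS]mulr1 -cs1; ring.
have E2 : s * c * (a * c + s * (- sn * b)) + s * sn * (a * sn + s * (c * b)) = s * a.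
  by rewrite -[RHS]mulr1 -cs1; ring.
rewrite !mul0r !subr0 !addr0 -!expr2 E1 E2 !expr1n !mul1r.
have -> : coefA (s ^+ 2) * (a ^+ 2 + s ^+ 2 * b ^+ 2) + coefB (s ^+ 2) * (s * a) ^+ 2 =
  (coefA (s ^+ 2) + coefB (s ^+ 2) * s ^+ 2) * a ^+ 2 + coefA (s ^+ 2) * s ^+ 2 * b ^+ 2.
  by ring.
have N0 : numer (s ^+ 2) != 0 by rewrite gt_eqF// numer_gt0// sqr_ge0.
have r0 : p + s ^+ 2 != 0 by rewrite -rE gt_eqF// (lt_trans _ pr)// rplus_gt0.
(* As [p^3 = 2], the numerator [r^3 - 2] factors as [(r - p) (r^2 + r p + p^2)]. *)
have VE : Vfun r = s ^+ 2 * numer (s ^+ 2) / (p + s ^+ 2).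
  rewrite /Vfun rE -rplus_cube /numer; field; exact: r0.
rewrite coefD ?sqr_ge0// VE /coefA /coefC -rE /a /b.
have k0 := theta_radius_neq0; rewrite rE.
field.
by rewrite s0 N0 r0 k0.
Qed.

Lemma core_metric_is_g1 : is_g1 core_metric.
Proof.
split; [exact: core_metric_smooth|exact: core_metric_posdef|].
by move=> r theta s1 s2; exact: pullback_polar_core.
Qed.

(** Off the core, polar coordinates have an invertible Jacobian, so the pullback determines the
    metric; on the core both metrics are limits of values off the core. *)
Lemma is_g1_unique (G : 'rV[R]_4 -> 'M[R]_4) : is_g1 G -> G = core_metric.
Proof.
move=> [sG _ pG].
have off x : 0 < disc_norm2 x -> G x = core_metric x.
  move=> q0; pose s := Num.sqrt (disc_norm2 x).
  have s0 : 0 < s by rewrite sqrtr_gt0.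
  have s2 : s ^+ 2 = disc_norm2 x by rewrite sqr_sqrtr// ltW.
  have [|t [tc ts]] := @unit_circle_angle R (x 0 0 / s) (x 0 1 / s).
    by rewrite !expr_div_n -mulrDl s2 divff// gt_eqF.
  pose r := p + s ^+ 2.
  have pr : p < r by rewrite ltrDl exprn_gt0.
  pose y := row4 r (t * k) (x 0 2) (x 0 3).
  have yx : polar y = x.
    have sE : Num.sqrt (y 0 0 - p) = s.
      by rewrite /y row4s /r addrC addKr sqrtr_sqr gtr0_norm.
    rewrite /polar sE angleE /y !row4s mulfK ?theta_radius_neq0// -tc -ts.
    by rewrite [RHS]row4_eta mulrC divfK ?gt_eqF// mulrC divfK ?gt_eqF.
  have := pG r (t * k) (x 0 2) (x 0 3) pr.
  have := pullback_polar_core (t * k) (x 0 2) (x 0 3) pr.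
  rewrite -/y /pullback yx => H0 H1.
  set J := 'J (@polar R) y in H0 H1.
  have V0 : 0 < Vfun r.
    have r0 : 0 < r by rewrite (lt_trans rplus_gt0).
    rewrite /Vfun -rplus_cube subr_gt0 ltr_pdivrMr// -exprSr ltr_pXn2r// ?nnegrE ?ltW//.
    exact: rplus_gt0.
  (* The Jacobian determinant need not be computed: the pulled-back metric is an invertible diagonal
     matrix that has [J] as a factor. *)
  have Ju : J \in unitmx.
    have : J *m core_metric x *m J^T \in unitmx.
      rewrite H0 unitmxE det_diag unitfE.
      apply/prodf_neq0 => i _; move: i; apply: ord4P; rewrite row4s.
      - by rewrite invr_neq0// gt_eqF.
      - by rewrite gt_eqF.
      - by rewrite expf_neq0// gt_eqF// (lt_trans rplus_gt0).
      - by rewrite expf_neq0// gt_eqF// (lt_trans rplus_gt0).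
    by rewrite unitmx_mul => /andP[_]; rewrite unitmx_tr.
  have JTu : J^T \in unitmx by rewrite unitmx_tr.
  have E : J *m G x *m J^T = J *m core_metric x *m J^T by rewrite H0 H1.
  by move/(can_inj (mulmxK JTu))/(can_inj (mulKmx Ju)): E.
apply/funext => x; have [|q0] := ltP 0 (disc_norm2 x); first exact: off.
have {}q0 : disc_norm2 x = 0 by apply/eqP; rewrite eq_le q0 disc_norm2_ge0.
have [x0 x1] : x 0 0 = 0 /\ x 0 1 = 0.
  move/eqP: q0; rewrite paddr_eq0 ?sqr_ge0// !sqrf_eq0 => /andP[/eqP-> /eqP->].
  by [].
apply/matrixP => i j; apply: eq_close => e e0.
have cont (M : 'rV[R]_4 -> 'M[R]_4) : smooth_on setT M ->
    {for x, continuous (fun y => M y i j : R)}.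
  move=> /(smooth_mx _ openT).1/(_ i j)/smooth_continuous; exact.
have e2 : 0 < e / 2 by rewrite divr_gt0.
have [d1 d10 H1] := continuous_at_ball (cont _ sG) e2.
have [d2 d20 H2] := continuous_at_ball (cont _ core_metric_smooth) e2.
(* The core point is approached along the first axis; halving keeps the approximating point strictly
   inside both balls. *)
pose d := Num.min d1 d2 / 2.
have d0 : 0 < d by rewrite divr_gt0// lt_min d10.
pose y := row4 d 0 (x 0 2) (x 0 3).
have yb d' : d < d' -> ball x d' y.
  move=> dd'; apply: row_ball; first exact: lt_trans dd'.
  apply: ord4P; rewrite row4s ?x0 ?x1 ?subrr ?normr0 ?(lt_trans d0)//.
  by rewrite sub0r normrN gtr0_norm.
have dd : d < Num.min d1 d2 by rewrite /d ltr_pdivrMr// ltr_pMr ?ltr1n// lt_min d10.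
exists (G y i j); first by apply/H1/yb; rewrite (lt_le_trans dd)// ge_min lexx.
rewrite off; first by apply/H2/yb; rewrite (lt_le_trans dd)// ge_min lexx orbT.
by rewrite /disc_norm2 !row4s expr0n addr0 exprn_gt0.
Qed.

End CoreMetric.

(** * Screw motions and the metrics on R^2 x T^2 *)

Section Screw.
Variable R : realType.
Local Notation k := (@theta_radius R).

Lemma shiftE (a b c : R) (x : 'rV[R]_4) : @Defs.shift R a b c x =
  row4 (cos (a / k) * x 0 0 - sin (a / k) * x 0 1)
       (sin (a / k) * x 0 0 + cos (a / k) * x 0 1) (x 0 2 + b) (x 0 3 + c).
Proof. by rewrite /Defs.shift angleE. Qed.

(** With [kap = alpha / k], adding 1 to the third coordinate turns the disc by the angle of the
    generating isometry and moves s1 by [l]. Integer translations thus become the group action. The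
    inverse is again a screw motion. *)
Definition screw (kap l L : R) (x : 'rV[R]_4) : 'rV[R]_4 :=
  row4 (cos (kap * x 0 2) * x 0 0 - sin (kap * x 0 2) * x 0 1)
       (sin (kap * x 0 2) * x 0 0 + cos (kap * x 0 2) * x 0 1)
       (l * x 0 2) (L * x 0 3).

Lemma smooth_screw kap l L : smooth_on setT (screw kap l L).
Proof.
have oT := @openT 'rV[R]_4.
by rewrite /screw; apply: (smooth_row4 oT); smooth_rules.
Qed.

Lemma screwK kap l L : l != 0 -> L != 0 ->
  cancel (screw kap l L) (screw (- (kap / l)) l^-1 L^-1).
Proof.
move=> l0 L0 x; rewrite [RHS]row4_eta /screw !row4s.
have -> : - (kap / l) * (l * x 0 2) = - (kap * x 0 2) by field.
rewrite cosN sinN; have := cos2Dsin2 (kap * x 0 2).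
move: (cos _) (sin _) => c s cs1; congr row4.
- by rewrite -[RHS]mul1r -cs1; ring.
- by rewrite -[RHS]mul1r -cs1; ring.
- by field.
- by field.
Qed.

Lemma screwVK kap l L : l != 0 -> L != 0 ->
  cancel (screw (- (kap / l)) l^-1 L^-1) (screw kap l L).
Proof.
move=> l0 L0 x; have := @screwK (- (kap / l)) l^-1 L^-1.
rewrite !invrK !invr_eq0 => /(_ l0 L0 x).
by rewrite mulNr opprK divfK.
Qed.

Lemma screw_torus_action alpha l L (x y : 'rV[R]_4) : torus_rel x y ->
  action_rel alpha l L (screw (alpha / k) l L x) (screw (alpha / k) l L y).
Proof.
move=> [m [n ->]]; exists m, n.
have k0 := theta_radius_neq0 R.
rewrite shiftE /screw !row4s.
have -> : (x + row4 0 0 m%:~R n%:~R) 0 0 = x 0 0 by rewrite !mxE /= addr0.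
have -> : (x + row4 0 0 m%:~R n%:~R) 0 1 = x 0 1 by rewrite !mxE /= addr0.
have -> : (x + row4 0 0 m%:~R n%:~R) 0 2 = x 0 2 + m%:~R by rewrite !mxE.
have -> : (x + row4 0 0 m%:~R n%:~R) 0 3 = x 0 3 + n%:~R by rewrite !mxE.
have -> : alpha / k * (x 0 2 + m%:~R) = m%:~R * alpha / k + alpha / k * x 0 2 by field.
by rewrite cosD sinD; congr row4; ring.
Qed.

Lemma screw_action_torus alpha l L (x y : 'rV[R]_4) : l != 0 -> L != 0 ->
  action_rel alpha l L x y ->
  torus_rel (screw (- (alpha / k / l)) l^-1 L^-1 x) (screw (- (alpha / k / l)) l^-1 L^-1 y).
Proof.
move=> l0 L0 [m [n ->]]; exists m, n.
have k0 := theta_radius_neq0 R.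
rewrite shiftE /screw !row4s.
set t := - (alpha / k / l) * x 0 2.
have -> : - (alpha / k / l) * (x 0 2 + m%:~R * l) = t - m%:~R * alpha / k.
  by rewrite /t; field; rewrite k0 l0.
rewrite cosB sinB; have := cos2Dsin2 (m%:~R * alpha / k).
move: (cos (_ * _ / _)) (sin (_ * _ / _)) (cos t) (sin t) => c s ct st cs1.
apply: row4_eq; rewrite !mxE /=.
- by rewrite addr0 -[RHS]mul1r -cs1; ring.
- by rewrite addr0 -[RHS]mul1r -cs1; ring.
- by field.
- by field.
Qed.

Lemma screw_quotient_diffeo alpha l L : l != 0 -> L != 0 ->
  quotient_diffeo setT (@torus_rel R) setT (action_rel alpha l L) (screw (alpha / k) l L).
Proof.
move=> l0 L0; split; first exact: smooth_screw.
split=> //; split; first by move=> x y _ _; exact: screw_torus_action.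
exists (screw (- (alpha / k / l)) l^-1 L^-1); split; first exact: smooth_screw.
split=> //; split; first by move=> x y _ _; exact: screw_action_torus.
split=> x _.
  rewrite screwK//; exists 0, 0; apply: row4_eq; by rewrite !mxE /= addr0.
rewrite screwVK//; exists 0, 0.
by rewrite shiftE !mul0r cos0 sin0; apply: row4_eq; rewrite row4s; ring.
Qed.

Lemma derive_screw kap l L (x v : 'rV[R]_4) :
  let c := cos (kap * x 0 2) in let s := sin (kap * x 0 2) in
  let w0 := v 0 0 - kap * x 0 1 * v 0 2 in let w1 := v 0 1 + kap * x 0 0 * v 0 2 in
  'D_v (screw kap l L) x = row4 (c * w0 - s * w1) (s * w0 + c * w1) (l * v 0 2) (L * v 0 3).
Proof.
move=> c s w0 w1.
have d2 : is_derive x v (fun y : 'rV[R]_4 => kap * y 0 2) (kap * v 0 2).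
  by derive_with ltac:(ring).
have dl : is_derive x v (fun y : 'rV[R]_4 => l * y 0 2) (l * v 0 2).
  by derive_with ltac:(ring).
have dL : is_derive x v (fun y : 'rV[R]_4 => L * y 0 3) (L * v 0 3).
  by derive_with ltac:(ring).
have dc := is_derive_cos_comp d2; have ds := is_derive_sin_comp d2.
have d0 : is_derive x v (fun y : 'rV[R]_4 => cos (kap * y 0 2) * y 0 0 - sin (kap * y 0 2) * y 0 1)
    (c * w0 - s * w1).
  by derive_with ltac:(rewrite /w0 /w1 /c /s; ring).
have d1 : is_derive x v (fun y : 'rV[R]_4 => sin (kap * y 0 2) * y 0 0 + cos (kap * y 0 2) * y 0 1)
    (s * w0 + c * w1).
  by derive_with ltac:(rewrite /w0 /w1 /c /s; ring).
by have [_ <-] := is_derive_row4 d0 d1 dl dL.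
Qed.

Lemma pullback_screw A B C kap l L (x : 'rV[R]_4) :
  pullback (screw kap l L) (twisted_metric A B C 0 1 1) x = twisted_metric A B C kap l L x.
Proof.
apply: symmetric_form_eq.
- by apply: pullback_sym; exact: twisted_metric_sym.
- exact: twisted_metric_sym.
move=> v; rewrite pullback_form; last first.
  by apply: (smooth_row_differentiable openT (smooth_screw _ _ _)).
rewrite !twisted_metricE derive_screw.
have cs1 := cos2Dsin2 (kap * x 0 2).
have -> : disc_norm2 (screw kap l L x) = disc_norm2 x.
  rewrite /disc_norm2 /screw !row4s -[RHS]mul1r -cs1; ring.
rewrite /twisted_form /screw !row4s.
move: (cos _) (sin _) cs1 => c s cs1.
set w0 := v 0 0 - _; set w1 := v 0 1 + _.
rewrite !mul0r !subr0 !addr0 !expr1n !mul1r.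
have -> : (c * w0 - s * w1) * (c * w0 - s * w1) + (s * w0 + c * w1) * (s * w0 + c * w1)
  = w0 * w0 + w1 * w1 by rewrite -[RHS]mul1r -cs1; ring.
have -> : (c * x 0 0 - s * x 0 1) * (c * w0 - s * w1) +
   (s * x 0 0 + c * x 0 1) * (s * w0 + c * w1) = x 0 0 * v 0 0 + x 0 1 * v 0 1.
  by rewrite -[RHS]mul1r -cs1 /w0 /w1; ring.
by ring.
Qed.

Lemma twisted_metric_periodic A B C kap l L (x y : 'rV[R]_4) : torus_rel x y ->
  twisted_metric A B C kap l L x = twisted_metric A B C kap l L y.
Proof.
move=> [m [n ->]].
have E0 : (x + row4 0 0 m%:~R n%:~R) 0 0 = x 0 0 by rewrite !mxE /= addr0.
have E1 : (x + row4 0 0 m%:~R n%:~R) 0 1 = x 0 1 by rewrite !mxE /= addr0.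
by apply/matrixP => i j; rewrite [LHS]mxE [RHS]mxE /disc_norm2 E0 E1.
Qed.

Definition filling_metric (alpha l L : R) : 'rV[R]_4 -> 'M[R]_4 :=
  twisted_metric (@coefA R) (@coefB R) (@coefC R) (alpha / k) l L.

Lemma filling_metric_R2T2 alpha l L : l != 0 -> L != 0 -> metric_R2T2 (filling_metric alpha l L).
Proof.
move=> l0 L0; have [sA sB sC] := smooth_coefs R; split.
- by apply: smooth_twisted_metric => //; exact: openT.
- move=> x; apply: twisted_metric_posdef => //.
  + exact/coefA_gt0/disc_norm2_ge0.
  + exact/coefD_gt0/disc_norm2_ge0.
  + exact/coefC_gt0/disc_norm2_ge0.
- by move=> x y; exact: twisted_metric_periodic.
Qed.

End Screw.

(** * Ricci curvature *)

Section TwistedChristoffel.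
Variable R : realType.
Variables (kap l L : R).
Implicit Types (x v w z : 'rV[R]_4).

Definition tw0 x v : R := v 0 0 - kap * x 0 1 * v 0 2.
Definition tw1 x v : R := v 0 1 + kap * x 0 0 * v 0 2.
Definition dotu x v : R := x 0 0 * v 0 0 + x 0 1 * v 0 1.

(* The Levi-Civita connection [nabla_v w] of [twisted_metric A B C kap l L] for
   constant vector fields, where [a = A'/A], [b = (B - A')/D],
   [c = (B' - 2 a B)/D], [e = C'/C], [m = C'/D] and [D = A + B q]. *)
Definition gamma_radial (b c m : R) x v w : R :=
  b * (tw0 x v * tw0 x w + tw1 x v * tw1 x w) + c * (dotu x v * dotu x w)
  - m * (l ^+ 2 * (v 0 2 * w 0 2) + L ^+ 2 * (v 0 3 * w 0 3)) - kap ^+ 2 * (v 0 2 * w 0 2).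

Definition gamma (a b c e m : R) x v w : 'rV[R]_4 :=
  let y := gamma_radial b c m x v w in
  let s1 := e * (dotu x v * w 0 2 + dotu x w * v 0 2) in
  row4 (a * (dotu x v * tw0 x w + dotu x w * tw0 x v) + x 0 0 * y
          - kap * (v 0 2 * w 0 1 + w 0 2 * v 0 1) + kap * (s1 * x 0 1))
       (a * (dotu x v * tw1 x w + dotu x w * tw1 x v) + x 0 1 * y
          + kap * (v 0 2 * w 0 0 + w 0 2 * v 0 0) - kap * (s1 * x 0 0))
       s1 (e * (dotu x v * w 0 3 + dotu x w * v 0 3)).

(* Derivative of [gamma] in the direction z; a', b', ... are the derivatives of
   a, b, ... in that direction. *)
Definition dgamma (a b c e a' b' c' e' m m' : R) x z v w : 'rV[R]_4 :=
  let dv0 := - (kap * z 0 1 * v 0 2) in let dv1 := kap * z 0 0 * v 0 2 in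
  let dw0 := - (kap * z 0 1 * w 0 2) in let dw1 := kap * z 0 0 * w 0 2 in
  let y := gamma_radial b c m x v w in
  let dy := b' * (tw0 x v * tw0 x w + tw1 x v * tw1 x w)
    + b * (dv0 * tw0 x w + tw0 x v * dw0 + dv1 * tw1 x w + tw1 x v * dw1)
    + c' * (dotu x v * dotu x w) + c * (dotu z v * dotu x w + dotu x v * dotu z w)
    - m' * (l ^+ 2 * (v 0 2 * w 0 2) + L ^+ 2 * (v 0 3 * w 0 3)) in
  let s1 := e * (dotu x v * w 0 2 + dotu x w * v 0 2) in
  let ds1 := e' * (dotu x v * w 0 2 + dotu x w * v 0 2)
    + e * (dotu z v * w 0 2 + dotu z w * v 0 2) in
  row4 (a' * (dotu x v * tw0 x w + dotu x w * tw0 x v)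
          + a * (dotu z v * tw0 x w + dotu x v * dw0 + dotu z w * tw0 x v + dotu x w * dv0)
          + z 0 0 * y + x 0 0 * dy + kap * (ds1 * x 0 1 + s1 * z 0 1))
       (a' * (dotu x v * tw1 x w + dotu x w * tw1 x v)
          + a * (dotu z v * tw1 x w + dotu x v * dw1 + dotu z w * tw1 x v + dotu x w * dv1)
          + z 0 1 * y + x 0 1 * dy - kap * (ds1 * x 0 0 + s1 * z 0 0))
       ds1 (e' * (dotu x v * w 0 3 + dotu x w * v 0 3)
            + e * (dotu z v * w 0 3 + dotu z w * v 0 3)).

(** The Ricci tensor of a twisted metric is again of twisted form; [ricciS], [ricciT] and [ricciF]
    take the places of A, B and C. The arguments ending in 1 stand for derivatives with respect to
    [q]. *)
Definition ricciS (a b c e b1 q : R) : R :=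
  2 * a + 2 * b + 2 * q * b1 - (3 * a + b + c * q + 2 * e)
  + (3 * a + b + c * q + 2 * e) * q * b - 2 * a * b * q.
Definition ricciT (a b c e a1 b1 c1 e1 q : R) : R :=
  4 * a1 + 4 * c + 2 * q * c1 - 2 * (3 * a1 + b1 + c1 * q + c + 2 * e1)
  + (3 * a + b + c * q + 2 * e) * (2 * a + q * c)
  - (5 * a ^+ 2 + 2 * a * b + 4 * a * c * q + (b + c * q) ^+ 2) - 2 * e ^+ 2.
Definition ricciF (a b c e m m1 q : R) : R :=
  - 2 * m - 2 * q * m1 - (3 * a + b + c * q + 2 * e) * m * q + 2 * m * e * q.

Definition basis4 (i : 'I_4) : 'rV[R]_4 := delta_mx 0 i.

Lemma basis4E : [/\ basis4 0 = row4 1 0 0 0, basis4 1 = row4 0 1 0 0,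
  basis4 2 = row4 0 0 1 0 & basis4 3 = row4 0 0 0 1].
Proof. by split; apply: row4_eq; rewrite /basis4 !mxE. Qed.

(** The contracted Christoffel symbol in the direction [v], divided by [x.v]; the contraction is the
    logarithmic derivative of the volume density. *)
Definition gamma_trace (a b c e q : R) : R := 3 * a + b + c * q + 2 * e.

Section Entries.
Variables (a b c e m : R) (x : 'rV[R]_4).
Local Notation G := (gamma a b c e m x).

(** A table of the endomorphism [gamma v], made once so that the polynomial identities for its
    traces stay manageable. *)
Lemma gamma_basis v :
  let t0 := tw0 x v in let t1 := tw1 x v in let d := dotu x v in
  let x0 := x 0 0 in let x1 := x 0 1 in let v2 := v 0 2 in
  let y0 := b * t0 + c * (d * x0) in let y1 := b * t1 + c * (d * x1) in
  let y2 := b * kap * (x0 * t1 - x1 * t0) - (m * l ^+ 2 + kap ^+ 2) * v2 in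
  let y3 := - (m * L ^+ 2) * v 0 3 in
  [/\ G v (basis4 0) = row4 (a * (d + x0 * t0) + x0 * y0 + kap * e * x0 * x1 * v2)
        (a * (x0 * t1) + x1 * y0 + kap * v2 - kap * e * x0 ^+ 2 * v2)
        (e * x0 * v2) (e * x0 * v 0 3),
      G v (basis4 1) = row4 (a * (x1 * t0) + x0 * y1 - kap * v2 + kap * e * x1 ^+ 2 * v2)
        (a * (d + x1 * t1) + x1 * y1 - kap * e * x0 * x1 * v2)
        (e * x1 * v2) (e * x1 * v 0 3),
      G v (basis4 2) = row4
        (kap * (e - a) * d * x1 + x0 * y2 - kap * (t1 - kap * x0 * v2))
        (kap * (a - e) * d * x0 + x1 * y2 + kap * (t0 + kap * x1 * v2)) (e * d) 0 &
      G v (basis4 3) = row4 (x0 * y3) (x1 * y3) 0 (e * d)].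
Proof.
have [-> -> -> ->] := basis4E.
cbv zeta; rewrite /gamma /gamma_radial /tw0 /tw1 /dotu !row4s.
by split; apply: row4_eq; rewrite !row4s; ring.
Qed.

Lemma gamma_sym v w : G v w = G w v.
Proof. by rewrite /gamma /gamma_radial /tw0 /tw1 /dotu; apply: row4_eq; rewrite !row4s; ring. Qed.

Lemma gamma_trace_basis v :
  G v (basis4 0) 0 0 + G v (basis4 1) 0 1 + G v (basis4 2) 0 2 + G v (basis4 3) 0 3
  = gamma_trace a b c e (disc_norm2 x) * dotu x v.
Proof.
have [-> -> -> ->] := gamma_basis v; rewrite !row4s.
rewrite /gamma_trace /disc_norm2 /tw0 /tw1 /dotu; ring.
Qed.

Lemma gamma_dotu v w : dotu x (G v w) =
  2 * a * (dotu x v * dotu x w) + disc_norm2 x * gamma_radial b c m x v w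
  + kap * (v 0 2 * (x 0 1 * w 0 0 - x 0 0 * w 0 1) + w 0 2 * (x 0 1 * v 0 0 - x 0 0 * v 0 1)).
Proof.
rewrite {1}/dotu /gamma !row4s /disc_norm2.
move: (gamma_radial _ _ _ _ _ _) => y.
rewrite /tw0 /tw1 /dotu; ring.
Qed.

Lemma gamma_square_trace v w :
  let q := disc_norm2 x in let X u := x 0 1 * tw0 x u - x 0 0 * tw1 x u in
  \sum_(i < 4) \sum_(j < 4) G w (basis4 j) 0 i * G v (basis4 i) 0 j =
  (5 * a ^+ 2 + 2 * a * b + 4 * a * c * q + (b + c * q) ^+ 2 + 2 * e ^+ 2)
     * (dotu x v * dotu x w)
  + 2 * a * b * q * (tw0 x v * tw0 x w + tw1 x v * tw1 x w)
  - 2 * m * e * q * (l ^+ 2 * (v 0 2 * w 0 2) + L ^+ 2 * (v 0 3 * w 0 3))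
  + kap * (a - b + e) * (v 0 2 * X w + w 0 2 * X v)
  + 2 * kap ^+ 2 * (e * q - 1) * (v 0 2 * w 0 2).
Proof.
cbv zeta; rewrite !sum4.
have [-> -> -> ->] := gamma_basis v; have [-> -> -> ->] := gamma_basis w; rewrite !row4s.
rewrite /disc_norm2.
have -> : dotu x v = x 0 0 * tw0 x v + x 0 1 * tw1 x v by rewrite /dotu /tw0 /tw1; ring.
have -> : dotu x w = x 0 0 * tw0 x w + x 0 1 * tw1 x w by rewrite /dotu /tw0 /tw1; ring.
move: (tw0 x v) (tw1 x v) (tw0 x w) (tw1 x w) (x 0 0) (x 0 1) (v 0 2) (v 0 3) (w 0 2) (w 0 3).
move=> t0 t1 u0 u1 x0 x1 v2 v3 w2 w3.
ring.
Qed.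

Lemma gamma_divergence (a1 b1 c1 e1 m1 : R) v w :
  let q := disc_norm2 x in let X u := x 0 1 * tw0 x u - x 0 0 * tw1 x u in
  let dG z := let t := 2 * dotu x z in
     dgamma a b c e (a1 * t) (b1 * t) (c1 * t) (e1 * t) m (m1 * t) x z v w in
  dG (basis4 0) 0 0 + dG (basis4 1) 0 1 + dG (basis4 2) 0 2 + dG (basis4 3) 0 3 =
  4 * a1 * (dotu x v * dotu x w)
  + a * (v 0 0 * tw0 x w + v 0 1 * tw1 x w + w 0 0 * tw0 x v + w 0 1 * tw1 x v)
  + 2 * gamma_radial b c m x v w
  + 2 * q * b1 * (tw0 x v * tw0 x w + tw1 x v * tw1 x w)
  - b * kap * (v 0 2 * X w + w 0 2 * X v)
  + (2 * q * c1 + 2 * c) * (dotu x v * dotu x w)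
  - 2 * q * m1 * (l ^+ 2 * (v 0 2 * w 0 2) + L ^+ 2 * (v 0 3 * w 0 3))
  + kap * e * ((x 0 1 * v 0 0 - x 0 0 * v 0 1) * w 0 2
               + (x 0 1 * w 0 0 - x 0 0 * w 0 1) * v 0 2).
Proof.
have [-> -> -> ->] := basis4E; cbv zeta beta; rewrite /dgamma !row4s.
move: (gamma_radial _ _ _ _ _ _) => y; rewrite /tw0 /tw1 /dotu /disc_norm2 !row4s.
ring.
Qed.

(** Pure algebra in independent numbers. The four terms are the divergence of the connection, the
    derivative of its trace, the trace applied to the connection, and the quadratic term. *)
Lemma gamma_ricci (a1 b1 c1 e1 m1 : R) v w :
  let q := disc_norm2 x in
  let dG z v := let t := 2 * dotu x z in
     dgamma a b c e (a1 * t) (b1 * t) (c1 * t) (e1 * t) m (m1 * t) x z v in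
  let tau := gamma_trace a b c e q in
  let tau1 := 3 * a1 + b1 + c1 * q + c + 2 * e1 in
  \sum_(i < 4) dG (basis4 i) v w 0 i
  - (2 * tau1 * (dotu x v * dotu x w) + tau * (v 0 0 * w 0 0 + v 0 1 * w 0 1))
  + tau * dotu x (G v w)
  - \sum_(i < 4) \sum_(j < 4) G w (basis4 j) 0 i * G v (basis4 i) 0 j =
  twisted_form (ricciS a b c e b1 q) (ricciT a b c e a1 b1 c1 e1 q)
    (ricciF a b c e m m1 q) kap l L x v w.
Proof.
cbv zeta; rewrite sum4 gamma_divergence gamma_square_trace gamma_dotu.
rewrite /gamma_trace /gamma_radial /twisted_form /ricciS /ricciT /ricciF.
(* In the untwisted components the contributions of [kap] cancel. *)
have Ev (u : 'rV[R]_4) : u 0 0 = tw0 x u + kap * x 0 1 * u 0 2 by rewrite /tw0; ring.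
have Ev' (u : 'rV[R]_4) : u 0 1 = tw1 x u - kap * x 0 0 * u 0 2 by rewrite /tw1; ring.
have -> : dotu x v = x 0 0 * tw0 x v + x 0 1 * tw1 x v by rewrite /dotu /tw0 /tw1; ring.
have -> : dotu x w = x 0 0 * tw0 x w + x 0 1 * tw1 x w by rewrite /dotu /tw0 /tw1; ring.
rewrite (Ev v) (Ev w) (Ev' v) (Ev' w).
rewrite /disc_norm2.
move: (tw0 x v) (tw1 x v) (tw0 x w) (tw1 x w) (x 0 0) (x 0 1) (v 0 2) (v 0 3) (w 0 2) (w 0 3).
move=> t0 t1 u0 u1 x0 x1 v2 v3 w2 w3.
ring.
Qed.

End Entries.
End TwistedChristoffel.

(** * Ricci tensor of a twisted metric with radial coefficients *)

Section Ricci.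
Variable R : realType.
Variables (kap l L : R).

Lemma is_derive_disc_norm2 (x z : 'rV[R]_4) : is_derive x z (@disc_norm2 R) (2 * dotu x z).
Proof.
rewrite (_ : @disc_norm2 R = (fun x => x 0 0 ^+ 2 + x 0 1 ^+ 2))//.
by derive_with ltac:(rewrite /dotu; ring).
Qed.

Lemma is_derive_radial (f : R -> R) (f1 : R) (x z : 'rV[R]_4) :
  is_derive (disc_norm2 x) 1 f f1 ->
  is_derive x z (fun y => f (disc_norm2 y)) (f1 * (2 * dotu x z)).
Proof. by move=> df; apply: is_derive_comp1; exact: is_derive_disc_norm2. Qed.

Variables A B C A1 B1 C1 : R -> R.
Hypothesis dA : forall t : R, 0 <= t -> is_derive t 1 A (A1 t).
Hypothesis dB : forall t : R, 0 <= t -> is_derive t 1 B (B1 t).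
Hypothesis dC : forall t : R, 0 <= t -> is_derive t 1 C (C1 t).
Local Notation g := (twisted_metric A B C kap l L).
Local Notation q := (@disc_norm2 R).
Local Notation e_ := (@basis4 R).

Lemma twisted_metric_entry (x : 'rV[R]_4) i j :
  g x i j = twisted_form (A (q x)) (B (q x)) (C (q x)) kap l L x (e_ i) (e_ j).
Proof. by rewrite -twisted_metricE /basis4 -rowE trmx_delta -colE !mxE. Qed.

Definition dtwisted_form (A B C A' B' C' : R) (x z v w : 'rV[R]_4) : R :=
  twisted_form A' B' C' kap l L x v w
  + A * (- (kap * z 0 1 * v 0 2) * tw0 kap x w - tw0 kap x v * (kap * z 0 1 * w 0 2)
         + kap * z 0 0 * v 0 2 * tw1 kap x w + tw1 kap x v * (kap * z 0 0 * w 0 2))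
  + B * (dotu z v * dotu x w + dotu x v * dotu z w).

Lemma is_derive_twisted_form (x z v w : 'rV[R]_4) :
  let t := 2 * dotu x z in
  is_derive x z (fun y => twisted_form (A (q y)) (B (q y)) (C (q y)) kap l L y v w)
    (dtwisted_form (A (q x)) (B (q x)) (C (q x)) (A1 (q x) * t) (B1 (q x) * t) (C1 (q x) * t) x z v w).
Proof.
move=> t; have q0 := disc_norm2_ge0 x.
have hA := is_derive_radial z (dA q0).
have hB := is_derive_radial z (dB q0).
have hC := is_derive_radial z (dC q0).
rewrite /twisted_form.
by derive_with ltac:(rewrite /dtwisted_form /twisted_form /tw0 /tw1 /dotu /t /dotu; ring).
Qed.

Lemma partial_metric (x : 'rV[R]_4) i j k :
  let t := 2 * dotu x (e_ i) in
  partial i (fun y => g y j k : R) x =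
  dtwisted_form (A (q x)) (B (q x)) (C (q x)) (A1 (q x) * t) (B1 (q x) * t) (C1 (q x) * t) x (e_ i) (e_ j) (e_ k).
Proof.
move=> t; rewrite /partial.
have -> : (fun y => g y j k : R) =
   (fun y => twisted_form (A (q y)) (B (q y)) (C (q y)) kap l L y (e_ j) (e_ k)).
  by apply/funext => y; rewrite twisted_metric_entry.
by have [_ <-] := is_derive_twisted_form x (e_ i) (e_ j) (e_ k).
Qed.

(** Koszul's formula on constant fields identifies [gamma] as the Levi-Civita connection; [a'],
    [b'], [c'] are the derivatives of A, B, C with respect to [q]. *)
Lemma koszul (a b c e m A0 B0 C0 a' b' c' : R) (x v w z : 'rV[R]_4) :
  let D := A0 + B0 * q x in
  a' = a * A0 -> b * D = B0 - a' -> c * D = b' - 2 * a * B0 -> c' = e * C0 -> c' = m * D ->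
  let d u := dtwisted_form A0 B0 C0 (a' * (2 * dotu x u)) (b' * (2 * dotu x u)) (c' * (2 * dotu x u)) x u in
  2^-1 * (d v w z + d w v z - d z v w) =
  twisted_form A0 B0 C0 kap l L x z (gamma kap l L a b c e m x v w).
Proof.
move=> D ha hb hc he hm d.
have h2 : (2 : R) != 0 by rewrite pnatr_eq0.
apply: (mulfI h2); rewrite mulrA divff// mul1r; apply/eqP; rewrite -subr_eq0; apply/eqP.
(* The defect is a combination of five brackets, one for each relation that defines a, b, c, e and
   m. *)
have -> : d v w z + d w v z - d z v w
    - 2 * twisted_form A0 B0 C0 kap l L x z (gamma kap l L a b c e m x v w)
  = - (2 * (dotu x z * (tw0 kap x v * tw0 kap x w + tw1 kap x v * tw1 kap x w))) * (b * D - (B0 - a'))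
    - 2 * (dotu x z * (dotu x v * dotu x w)) * (c * D - (b' - 2 * a * B0))
    + 2 * (dotu x z * (l ^+ 2 * (v 0 2 * w 0 2) + L ^+ 2 * (v 0 3 * w 0 3))) * (m * D - c')
    + 2 * (a' - a * A0) * (dotu x v * (tw0 kap x w * tw0 kap x z + tw1 kap x w * tw1 kap x z)
          + dotu x w * (tw0 kap x v * tw0 kap x z + tw1 kap x v * tw1 kap x z))
    + 2 * (c' - e * C0) * (dotu x v * (l ^+ 2 * (w 0 2 * z 0 2) + L ^+ 2 * (w 0 3 * z 0 3))
          + dotu x w * (l ^+ 2 * (v 0 2 * z 0 2) + L ^+ 2 * (v 0 3 * z 0 3))).
  rewrite /d /D /dtwisted_form /twisted_form /gamma /gamma_radial /tw0 /tw1 /dotu /disc_norm2 !row4s.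
  move: (v 0 0) (v 0 1) (v 0 2) (v 0 3) (w 0 0) (w 0 1) (w 0 2) (w 0 3) (z 0 0) (z 0 1) (z 0 2) (z 0 3) (x 0 0) (x 0 1).
  move=> v0 v1 v2 v3 w0 w1 w2 w3 z0 z1 z2 z3 x0 x1.
  ring.
rewrite hb hc -hm -he -ha; ring.
Qed.

(** Replaces the computation of the inverse matrix: a vector whose lowered components satisfy
    Koszul's formula is the Christoffel vector, by invertibility of the metric. *)
Lemma christoffel_eq n (h : 'rV[R]_n -> 'M[R]_n) (x : 'rV[R]_n) (i j : 'I_n) (G : 'rV[R]_n) :
  h x \in unitmx -> (h x)^T = h x ->
  (forall z, 2^-1 * (partial i (fun y => h y j z : R) x + partial j (fun y => h y i z : R) x
     - partial z (fun y => h y i j : R) x) = \sum_k h x z k * G 0 k) ->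
  forall k, christoffel h k i j x = G 0 k.
Proof.
move=> hu sh H k; rewrite /christoffel mulr_sumr.
rewrite (eq_bigr (fun z => invmx (h x) k z * (h x *m G^T) z 0)); last first.
  move=> z _; rewrite mulrCA H mxE.
  by congr (_ * _); apply: eq_bigr => s _; rewrite !mxE.
have -> : \sum_z invmx (h x) k z * (h x *m G^T) z 0 = (invmx (h x) *m (h x *m G^T)) k 0.
  by rewrite mxE.
by rewrite mulKmx// mxE.
Qed.

Variables a b c e m a1 b1 c1 e1 m1 : R -> R.
Hypothesis relations : forall t, 0 <= t -> let D := A t + B t * t in
  [/\ A1 t = a t * A t, b t * D = B t - A1 t, c t * D = B1 t - 2 * a t * B t,
      C1 t = e t * C t & C1 t = m t * D].
Hypothesis da : forall t : R, 0 <= t -> is_derive t 1 a (a1 t).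
Hypothesis db : forall t : R, 0 <= t -> is_derive t 1 b (b1 t).
Hypothesis dc : forall t : R, 0 <= t -> is_derive t 1 c (c1 t).
Hypothesis de : forall t : R, 0 <= t -> is_derive t 1 e (e1 t).
Hypothesis dm : forall t : R, 0 <= t -> is_derive t 1 m (m1 t).
Hypothesis gunit : forall x, g x \in unitmx.
Local Notation G y := (gamma kap l L (a (q y)) (b (q y)) (c (q y)) (e (q y)) (m (q y)) y).

Lemma christoffel_twisted k i j (x : 'rV[R]_4) : christoffel g k i j x = G x (e_ i) (e_ j) 0 k.
Proof.
apply: christoffel_eq => //; first exact: twisted_metric_sym.
move=> z; rewrite !partial_metric.
have [ha hb hc he hm] := relations (disc_norm2_ge0 x).
rewrite (koszul (e_ i) (e_ j) (e_ z) ha hb hc he hm).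
rewrite -twisted_metricE /basis4 -rowE mxE; apply: eq_bigr => s _.
by rewrite !mxE.
Qed.

Lemma is_derive_gamma k (x z v w : 'rV[R]_4) :
  let t := 2 * dotu x z in
  is_derive x z (fun y => G y v w 0 k)
    (dgamma kap l L (a (q x)) (b (q x)) (c (q x)) (e (q x)) (a1 (q x) * t) (b1 (q x) * t)
       (c1 (q x) * t) (e1 (q x) * t) (m (q x)) (m1 (q x) * t) x z v w 0 k).
Proof.
move=> t; have q0 := disc_norm2_ge0 x.
have ha := is_derive_radial z (da q0).
have hb := is_derive_radial z (db q0).
have hc := is_derive_radial z (dc q0).
have he := is_derive_radial z (de q0).
have hm := is_derive_radial z (dm q0).
rewrite /gamma /dgamma /gamma_radial /tw0 /tw1 /t /dotu; rewrite /dotu in ha hb hc he hm.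
move: k; apply: ord4P; rewrite row4s; under eq_fun do rewrite row4s.
- by derive_with ltac:(ring).
- by derive_with ltac:(ring).
- by derive_with ltac:(ring).
- by derive_with ltac:(ring).
Qed.

Lemma is_derive_trace (x z v : 'rV[R]_4) :
  let s := q x in let t := 2 * dotu x z in
  is_derive x z (fun y => gamma_trace (a (q y)) (b (q y)) (c (q y)) (e (q y)) (q y) * dotu y v)
    ((3 * a1 s + b1 s + c1 s * s + c s + 2 * e1 s) * t * dotu x v
      + gamma_trace (a s) (b s) (c s) (e s) s * dotu z v).
Proof.
move=> s t; have q0 := disc_norm2_ge0 x.
have ha := is_derive_radial z (da q0).
have hb := is_derive_radial z (db q0).
have hc := is_derive_radial z (dc q0).
have he := is_derive_radial z (de q0).
have hq := is_derive_disc_norm2 x z.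
have hq' : is_derive x z (fun y => q y) (2 * dotu x z) := hq.
have hd : is_derive x z (fun y : 'rV[R]_4 => dotu y v) (dotu z v).
  by rewrite /dotu; derive_with ltac:(ring).
by rewrite /gamma_trace; derive_with ltac:(rewrite /s /t; ring).
Qed.

Lemma ricci_twisted (x : 'rV[R]_4) : let s := q x in
  ricci g x = \matrix_(i, j) twisted_form (ricciS (a s) (b s) (c s) (e s) (b1 s) s)
    (ricciT (a s) (b s) (c s) (e s) (a1 s) (b1 s) (c1 s) (e1 s) s)
    (ricciF (a s) (b s) (c s) (e s) (m s) (m1 s) s) kap l L x (e_ i) (e_ j).
Proof.
move=> s; apply/matrixP => i j; rewrite [LHS]mxE [RHS]mxE.
rewrite -(gamma_ricci kap l L (a s) (b s) (c s) (e s) (m s) x (a1 s) (b1 s) (c1 s) (e1 s) (m1 s)).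
cbv zeta.
have chE k i' j' : christoffel g k i' j' = (fun y => G y (e_ i') (e_ j') 0 k).
  by apply/funext => y; exact: christoffel_twisted.
have div : \sum_(k < 4) partial k (christoffel g k i j) x =
   \sum_(k < 4) dgamma kap l L (a s) (b s) (c s) (e s) (a1 s * (2 * dotu x (e_ k)))
     (b1 s * (2 * dotu x (e_ k))) (c1 s * (2 * dotu x (e_ k))) (e1 s * (2 * dotu x (e_ k)))
     (m s) (m1 s * (2 * dotu x (e_ k))) x (e_ k) (e_ i) (e_ j) 0 k.
  apply: eq_bigr => k _; rewrite chE /partial.
  by have [_ <-] := is_derive_gamma k x (e_ k) (e_ i) (e_ j).
(* The sum of the derivatives is the derivative of the sum, and that sum is the trace of the
   connection, which has a short closed form. *)
have dtr : \sum_(k < 4) partial j (christoffel g k i k) x =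
    2 * (3 * a1 s + b1 s + c1 s * s + c s + 2 * e1 s) * (dotu x (e_ i) * dotu x (e_ j))
    + gamma_trace (a s) (b s) (c s) (e s) s * (e_ i 0 0 * e_ j 0 0 + e_ i 0 1 * e_ j 0 1).
  have dG k := is_derive_gamma k x (e_ j) (e_ i) (e_ k).
  have pE k := @derive_val _ _ _ _ _ _ _ (dG k).
  rewrite sum4 !chE /partial -/(e_ j) !pE.
  have [_ <-] := is_derive_add (is_derive_add (is_derive_add (dG 0) (dG 1)) (dG 2)) (dG 3).
  under eq_fun do rewrite gamma_trace_basis.
  have [_ ->] := is_derive_trace x (e_ j) (e_ i).
  by rewrite -/s /dotu; ring.
have tr : \sum_(k < 4) \sum_(z < 4) christoffel g k k z x * christoffel g z i j x =
    gamma_trace (a s) (b s) (c s) (e s) s * dotu x (G x (e_ i) (e_ j)).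
  rewrite exchange_big /=.
  rewrite (eq_bigr (fun z => gamma_trace (a s) (b s) (c s) (e s) s * dotu x (e_ z) * G x (e_ i) (e_ j) 0 z)).
    rewrite sum4; have [-> -> -> ->] := basis4E R; rewrite /dotu !row4s; ring.
  move=> z _; rewrite -mulr_suml sum4 !christoffel_twisted.
  do 4 rewrite (gamma_sym _ _ _ _ _ _ _ _ _ _ (e_ z)).
  by rewrite gamma_trace_basis.
have sq : \sum_(k < 4) \sum_(z < 4) christoffel g k j z x * christoffel g z i k x =
   \sum_(k < 4) \sum_(z < 4) G x (e_ j) (e_ z) 0 k * G x (e_ i) (e_ k) 0 z.
  by apply: eq_bigr => k _; apply: eq_bigr => z _; rewrite !christoffel_twisted.
have sumE (F1 F2 : 'I_4 -> R) (F3 F4 : 'I_4 -> 'I_4 -> R) S1 S2 S3 S4 :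
    \sum_k F1 k = S1 -> \sum_k F2 k = S2 -> \sum_k \sum_z F3 k z = S3 ->
    \sum_k \sum_z F4 k z = S4 ->
    \sum_k (F1 k - F2 k + \sum_z (F3 k z - F4 k z)) = S1 - S2 + S3 - S4.
  move=> <- <- <- <-.
  have E4 : \sum_k \sum_z (F3 k z - F4 k z) = \sum_k \sum_z F3 k z - \sum_k \sum_z F4 k z.
    by rewrite -sumrB; apply: eq_bigr => z _; exact: sumrB.
  by rewrite big_split sumrB /= E4 addrA.
exact: (sumE _ _ _ _ _ _ _ _ div dtr tr sq).
Qed.

Lemma einstein_twisted :
  (forall t, 0 <= t -> [/\ ricciS (a t) (b t) (c t) (e t) (b1 t) t = - 3 * A t,
     ricciT (a t) (b t) (c t) (e t) (a1 t) (b1 t) (c1 t) (e1 t) t = - 3 * B t &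
     ricciF (a t) (b t) (c t) (e t) (m t) (m1 t) t = - 3 * C t]) ->
  einstein g.
Proof.
move=> H x; rewrite ricci_twisted; have [-> -> ->] := H _ (disc_norm2_ge0 x).
apply/matrixP => i j; rewrite mxE [RHS]mxE twisted_metric_entry /twisted_form.
by ring.
Qed.

End Ricci.

(** * The Einstein equation for the filling metrics *)

Section FillingEinstein.
Variable R : realType.
Local Notation p := (@rplus R).
Local Notation k := (@theta_radius R).

(* The functions a, b, c, e, m of [gamma], and then their derivatives, in terms
   of r = p + q, with N = r^2 + r p + p^2. *)
Let N (r : R) : R := r ^+ 2 + r * p + p ^+ 2.
Let fa (r : R) : R := (r ^+ 2 - p ^+ 2) / (r * N r).
Let fb (r : R) : R := - (2 * r ^+ 4 + 4 * p * r ^+ 3 - 3 * p ^+ 2 * r ^+ 2 - 2 * p ^+ 3 * r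
   - p ^+ 4) / (9 * p ^+ 2 * r ^+ 3).
Let P5 (r : R) : R := 2 * r ^+ 5 + 8 * p * r ^+ 4 - 16 * p ^+ 2 * r ^+ 3 - 17 * p ^+ 3 * r ^+ 2
   + 4 * p ^+ 4 * r + p ^+ 5.
Let fc (r : R) : R := P5 r / (9 * p ^+ 2 * (r ^+ 3 * N r)).
Let fe (r : R) : R := 2 / r.
Let fm (r : R) : R := N r / 2.
Let fa1 (r : R) : R := (2 * r * (r * N r) - (r ^+ 2 - p ^+ 2) * (3 * r ^+ 2 + 2 * p * r + p ^+ 2))
  / (r * N r) ^+ 2.
Let fb1 (r : R) : R := - (2 * r ^+ 4 + 3 * p ^+ 2 * r ^+ 2 + 4 * p ^+ 3 * r + 3 * p ^+ 4)
  / (9 * p ^+ 2 * r ^+ 4).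
Let fc1 (r : R) : R := ((10 * r ^+ 4 + 32 * p * r ^+ 3 - 48 * p ^+ 2 * r ^+ 2 - 34 * p ^+ 3 * r
    + 4 * p ^+ 4) * (r ^+ 3 * N r)
  - P5 r * (5 * r ^+ 4 + 4 * p * r ^+ 3 + 3 * p ^+ 2 * r ^+ 2)) / (9 * p ^+ 2 * (r ^+ 3 * N r) ^+ 2).
Let fe1 (r : R) : R := - 2 / r ^+ 2.
Let fm1 (r : R) : R := (2 * r + p) / 2.
Let A1 (r : R) : R := k ^+ 2 * (r ^+ 2 - p ^+ 2) / r ^+ 2.
Let B1 (r : R) : R := - (4 / (9 * p ^+ 2)) * (- 2 * p * r ^+ 4 + 8 * p ^+ 2 * r ^+ 3
   + 9 * p ^+ 3 * r ^+ 2 + 2 * p ^+ 4 * r + p ^+ 5) / (r * N r) ^+ 2.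

Let is_derive_shift_rplus (f : R -> R) (t d : R) :
  is_derive (p + t) 1 f d -> is_derive t 1 (fun t => f (p + t)) d.
Proof.
move=> df; have dp : is_derive t 1 (fun t : R => p + t) 1 by derive_with ltac:(ring).
by have := is_derive_comp1 df dp; rewrite mulr1.
Qed.

Let r_neq0 t : 0 <= t -> p + t != 0.
Proof. by move=> t0; rewrite gt_eqF// ltr_wpDr// rplus_gt0. Qed.

Let N_neq0 t : 0 <= t -> N (p + t) != 0.
Proof. by move=> t0; rewrite gt_eqF//; exact: numer_gt0. Qed.

Let p0 := rplus_neq0 R.

Let dA (t : R) : 0 <= t -> is_derive t 1 (@coefA R) (A1 (p + t)).
Proof.
move=> t0; have h := r_neq0 t0; rewrite /coefA /numer.
derive_with ltac:(rewrite /A1; field); first exact: h.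
exact: h.
Qed.

Let dB (t : R) : 0 <= t -> is_derive t 1 (@coefB R) (B1 (p + t)).
Proof.
move=> t0; have h := r_neq0 t0; have h' := N_neq0 t0; rewrite /coefB /numer; rewrite /N in h'.
derive_with ltac:(rewrite /B1 /N /theta_radius; field); first by rewrite mulf_neq0.
by rewrite p0 h h'.
Qed.

Let dC (t : R) : 0 <= t -> is_derive t 1 (@coefC R) (2 * (p + t)).
Proof. by move=> t0; rewrite /coefC; derive_with ltac:(ring). Qed.

Let da (t : R) : 0 <= t -> is_derive t 1 (fun t => fa (p + t)) (fa1 (p + t)).
Proof.
move=> t0; have h := r_neq0 t0; have h' := N_neq0 t0; apply: is_derive_shift_rplus.
move: (p + t) h h' => r h h'; rewrite /fa /N; rewrite /N in h'.
derive_with ltac:(rewrite /fa1 /N; field); first by rewrite mulf_neq0.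
by rewrite h h'.
Qed.

Let db (t : R) : 0 <= t -> is_derive t 1 (fun t => fb (p + t)) (fb1 (p + t)).
Proof.
move=> t0; have h := r_neq0 t0; apply: is_derive_shift_rplus.
move: (p + t) h => r h; rewrite /fb.
derive_with ltac:(rewrite /fb1; field); last by rewrite h p0.
by rewrite !mulf_neq0 ?expf_neq0 ?p0 ?pnatr_eq0.
Qed.

Let dc (t : R) : 0 <= t -> is_derive t 1 (fun t => fc (p + t)) (fc1 (p + t)).
Proof.
move=> t0; have h := r_neq0 t0; have h' := N_neq0 t0; apply: is_derive_shift_rplus.
move: (p + t) h h' => r h h'; rewrite /fc /P5 /N; rewrite /N in h'.
derive_with ltac:(rewrite /fc1 /P5 /N; field); last by rewrite h h' p0.
by rewrite !mulf_neq0 ?expf_neq0 ?p0 ?pnatr_eq0.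
Qed.

Let de (t : R) : 0 <= t -> is_derive t 1 (fun t => fe (p + t)) (fe1 (p + t)).
Proof.
move=> t0; have h := r_neq0 t0; apply: is_derive_shift_rplus.
move: (p + t) h => r h; rewrite /fe.
by derive_with ltac:(rewrite /fe1; field); exact: h.
Qed.

Let dm (t : R) : 0 <= t -> is_derive t 1 (fun t => fm (p + t)) (fm1 (p + t)).
Proof.
move=> t0; apply: is_derive_shift_rplus; rewrite /fm /N.
by derive_with ltac:(rewrite /fm1; field).
Qed.

Let relations t : 0 <= t -> let D := @coefA R t + coefB t * t in
  [/\ A1 (p + t) = fa (p + t) * coefA t, fb (p + t) * D = coefB t - A1 (p + t),
      fc (p + t) * D = B1 (p + t) - 2 * fa (p + t) * coefB t,
      2 * (p + t) = fe (p + t) * coefC t & 2 * (p + t) = fm (p + t) * D].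
Proof.
move=> t0; have h := r_neq0 t0; have h' := N_neq0 t0; cbv zeta; rewrite coefD//.
rewrite /A1 /B1 /fa /fb /fc /fe /fm /P5 /coefA /coefB /coefC /numer -/(N (p + t)) /theta_radius.
set r := p + t in h h' *; have tE : t = r - p by rewrite /r; ring.
clearbody r; rewrite tE; rewrite /N in h' *.
split.
- by field; rewrite h h' p0.
- by field; rewrite h h' p0.
- by field; rewrite h h' p0.
- by field; rewrite h.
- by field; rewrite h'.
Qed.

Lemma filling_einstein alpha (l L : R) : l != 0 -> L != 0 -> einstein (filling_metric alpha l L).
Proof.
move=> l0 L0.
have gunit x : filling_metric alpha l L x \in unitmx.
  have [_ /(_ x) [_ pos] _] := filling_metric_R2T2 alpha l0 L0.
  rewrite -row_free_unit -kermx_eq0; apply/eqP/row_matrixP => i; rewrite row0.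
  set v := row i _; have vg : v *m filling_metric alpha l L x = 0.
    by rewrite /v -row_mul mulmx_ker row0.
  by apply/eqP; apply: contraT => /pos; rewrite vg mul0mx mxE ltxx.
apply: (einstein_twisted dA dB dC relations da db dc de dm gunit).
move=> t t0; have h := r_neq0 t0; have h' := N_neq0 t0.
rewrite /ricciS /ricciT /ricciF /A1 /B1 /fa /fb /fc /fe /fm /fa1 /fb1 /fc1 /fe1 /fm1 /P5.
rewrite /coefA /coefB /coefC /numer -/(N (p + t)) /theta_radius.
(* In the variable [r = p + t] three rational identities in [r] and [p] remain, with denominators
   built from [r], [p] and [N]. *)
have -> : t = (p + t) - p by ring.
have -> : p + (p + t - p) = p + t by ring.
move: (p + t) h h' => r h h'; rewrite /N in h' *.
by split; field; rewrite ?h ?h' ?p0.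
Qed.

End FillingEinstein.

(** * Compactification *)

Section Compactification.
Variable R : realType.
Local Notation p := (@rplus R).
Local Notation k := (@theta_radius R).
Local Notation q := (@disc_norm2 R).

(* With t = |w|^2 = q/(1+q), the radius is r = p + q = bdry_radius t / (1 - t). *)
Definition bdry_radius (t : R) : R := p + (1 - p) * t.
(** This is [(1 - t)^2] times [numer], rewritten by [p (1 - t) = bdry_radius t - t]. *)
Definition bdry_numer (t : R) : R := 3 * bdry_radius t ^+ 2 - 3 * bdry_radius t * t + t ^+ 2.
Definition bdryA (t : R) : R := k ^+ 2 * bdry_numer t / bdry_radius t.
(** With [r] and [N] the boundary versions of radius and numerator, this is
    [(4 r / N - k^2 N / r) / t]. The pole at [t = 0] cancels because
    [2 r - k N = 2 t (3 p r - t) / (3 p)]. *)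
Definition bdryB (t : R) : R := 2 / (3 * p) * (3 * p * bdry_radius t - t)
  * (2 * bdry_radius t + k * bdry_numer t) / (bdry_radius t * bdry_numer t).
Definition bdryC (t : R) : R := bdry_radius t ^+ 2.

Lemma bdry_radius_gt0 t : 0 <= t <= 1 -> 0 < bdry_radius t.
Proof.
move=> /andP[t0 t1]; have pg := rplus_gt0 R.
have -> : bdry_radius t = p * (1 - t) + t by rewrite /bdry_radius; ring.
have [->|tn] := eqVneq t 0; first by rewrite subr0 mulr1 addr0.
have tg : 0 < t by rewrite lt_neqAle eq_sym tn.
by apply: ltr_wpDl => //; apply: mulr_ge0; [exact: ltW|rewrite subr_ge0].
Qed.

Lemma bdry_numer_gt0 t : 0 < bdry_radius t -> 0 < bdry_numer t.
Proof.
rewrite /bdry_numer; move: (bdry_radius t) => r r0.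
have -> : 3 * r ^+ 2 - 3 * r * t + t ^+ 2 = (t - 3 / 2 * r) ^+ 2 + 3 / 4 * r ^+ 2 by field.
by rewrite ltr_wpDl ?sqr_ge0// mulr_gt0 ?divr_gt0// exprn_gt0.
Qed.

Lemma bdryD t : 0 < bdry_radius t -> bdryA t + bdryB t * t = 4 * bdry_radius t / bdry_numer t.
Proof.
move=> r0; have n0 := bdry_numer_gt0 r0; have p0 := rplus_neq0 R.
have tE : bdry_radius t = p + (1 - p) * t by [].
have {}r0 : bdry_radius t != 0 by rewrite gt_eqF.
have {}n0 : bdry_numer t != 0 by rewrite gt_eqF.
rewrite /bdryA /bdryB /theta_radius; rewrite /bdry_numer in n0 *; rewrite tE in r0 n0 *.
by field; rewrite ?p0 ?r0 ?n0.
Qed.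

Lemma smooth_bdry (W : set 'rV[R]_4) : open W -> (forall x, W x -> 0 < bdry_radius (q x)) ->
  [/\ smooth_on W (fun x => bdryA (q x)), smooth_on W (fun x => bdryB (q x)) &
      smooth_on W (fun x => bdryC (q x))].
Proof.
move=> oW pos; have sq : smooth_on W (fun x : 'rV[R]_4 => q x) by exact: smooth_disc_norm2.
have h1 x : W x -> bdry_radius (q x) != 0 by move=> /pos h; rewrite gt_eqF.
have h2 x : W x -> bdry_radius (q x) * bdry_numer (q x) != 0.
  by move=> /pos h; rewrite mulf_neq0 ?gt_eqF// bdry_numer_gt0.
by split; rewrite /bdryA /bdryB /bdryC /bdry_numer /bdry_radius; smooth_rules; [exact: h1|exact: h2].
Qed.

Definition to_disc (x : 'rV[R]_4) : 'rV[R]_4 :=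
  row4 (x 0 0 * (Num.sqrt (1 + q x))^-1) (x 0 1 * (Num.sqrt (1 + q x))^-1) (x 0 2) (x 0 3).
Definition of_disc (x : 'rV[R]_4) : 'rV[R]_4 :=
  row4 (x 0 0 * (Num.sqrt (1 - q x))^-1) (x 0 1 * (Num.sqrt (1 - q x))^-1) (x 0 2) (x 0 3).

Lemma onep_gt0 (x : 'rV[R]_4) : 0 < 1 + q x.
Proof. by rewrite ltr_wpDr// disc_norm2_ge0. Qed.

Lemma sqr_rsqrt (c : R) : 0 < c -> (Num.sqrt c)^-1 ^+ 2 = c^-1.
Proof. by move=> c0; rewrite exprVn sqr_sqrtr// ltW. Qed.

Lemma q_to_disc x : q (to_disc x) = q x / (1 + q x).
Proof.
by rewrite {1}/disc_norm2 /to_disc !row4s !exprMn -mulrDl sqr_rsqrt// onep_gt0.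
Qed.

Lemma q_of_disc x : @disc_interior R x -> q (of_disc x) = q x / (1 - q x).
Proof.
move=> dx; rewrite {1}/disc_norm2 /of_disc !row4s !exprMn -mulrDl sqr_rsqrt//.
by rewrite subr_gt0.
Qed.

Lemma to_disc_interior x : @disc_interior R (to_disc x).
Proof. by rewrite /disc_interior /= q_to_disc ltr_pdivrMr ?onep_gt0// mul1r ltrDr. Qed.

Lemma to_discK : cancel to_disc of_disc.
Proof.
move=> x; rewrite /of_disc q_to_disc.
have c0 := onep_gt0 x.
have -> : 1 - q x / (1 + q x) = (1 + q x)^-1 by field; rewrite gt_eqF.
rewrite /to_disc !row4s sqrtrV ?ltW// invrK.
rewrite !mulfVK ?gt_eqF ?sqrtr_gt0//.
by rewrite -row4_eta.
Qed.

Lemma of_discK x : @disc_interior R x -> to_disc (of_disc x) = x.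
Proof.
move=> dx; rewrite /to_disc q_of_disc//.
have c0 : 0 < 1 - q x by rewrite subr_gt0.
have -> : 1 + q x / (1 - q x) = (1 - q x)^-1 by field; rewrite gt_eqF.
rewrite /of_disc !row4s sqrtrV ?ltW// invrK.
rewrite !mulfVK ?gt_eqF ?sqrtr_gt0//.
by rewrite -row4_eta.
Qed.

Lemma open_disc_interior : open (@disc_interior R).
Proof.
rewrite (_ : @disc_interior R = q @^-1` [set t | t < 1])//.
apply: open_comp; last exact: open_lt.
move=> x _; have := smooth_continuous (smooth_disc_norm2 (@openT 'rV[R]_4)).
by apply.
Qed.

Lemma smooth_to_disc : smooth_on setT to_disc.
Proof.
have oT := @openT 'rV[R]_4.
have sq : smooth_on setT (fun x : 'rV[R]_4 => q x) by exact: smooth_disc_norm2.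
have s1 : smooth_on setT (fun x : 'rV[R]_4 => 1 + q x) by smooth_rules.
have s2 : smooth_on setT (fun x : 'rV[R]_4 => (Num.sqrt (1 + q x))^-1).
  by apply: smooth_rsqrt s1 => // x _; exact: onep_gt0.
by rewrite /to_disc; apply: (smooth_row4 oT); smooth_rules.
Qed.

Lemma smooth_of_disc : smooth_on (@disc_interior R) of_disc.
Proof.
have oD := open_disc_interior.
have sq : smooth_on (@disc_interior R) (fun x : 'rV[R]_4 => q x) by exact: smooth_disc_norm2.
have s1 : smooth_on (@disc_interior R) (fun x : 'rV[R]_4 => 1 - q x) by smooth_rules.
have s2 : smooth_on (@disc_interior R) (fun x : 'rV[R]_4 => (Num.sqrt (1 - q x))^-1).
  by apply: smooth_rsqrt s1 => // x dx; rewrite subr_gt0.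
by rewrite /of_disc; apply: (smooth_row4 oD); smooth_rules.
Qed.

Lemma torus_relE (x y : 'rV[R]_4) : torus_rel x y <->
  [/\ y 0 0 = x 0 0, y 0 1 = x 0 1, exists m : int, y 0 2 = x 0 2 + m%:~R &
      exists n : int, y 0 3 = x 0 3 + n%:~R].
Proof.
split=> [[m [n ->]]|[e0 e1 [m e2] [n e3]]].
  by split; rewrite ?mxE /= ?addr0//; [exists m|exists n].
by exists m, n; apply: row4_eq; rewrite ?e0 ?e1 ?e2 ?e3 !mxE /= ?addr0.
Qed.

Lemma disc_norm2_torus (x y : 'rV[R]_4) : torus_rel x y -> q x = q y.
Proof. by move=> /torus_relE[e0 e1 _ _]; rewrite /disc_norm2 e0 e1. Qed.

Lemma to_disc_quotient_diffeo :
  quotient_diffeo setT (@torus_rel R) (@disc_interior R) (@torus_rel R) to_disc.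
Proof.
split; first exact: smooth_to_disc.
split; first by move=> x _; exact: to_disc_interior.
split.
  move=> x y _ _ xy; have qE := disc_norm2_torus xy.
  by apply/torus_relE; rewrite /to_disc !row4s qE; case/torus_relE: xy => -> ->.
exists of_disc; split; first exact: smooth_of_disc.
split=> //; split.
  move=> x y _ _ xy; have qE := disc_norm2_torus xy.
  by apply/torus_relE; rewrite /of_disc !row4s qE; case/torus_relE: xy => -> ->.
have refl (x : 'rV[R]_4) : torus_rel x x.
    by apply/torus_relE; split=> //; exists 0; rewrite addr0.
by split=> x dx; rewrite ?to_discK ?of_discK.
Qed.

Lemma derive_to_disc (x v : 'rV[R]_4) :
  let y := (Num.sqrt (1 + q x))^-1 in let d := dotu x v in
  'D_v to_disc x = row4 (v 0 0 * y - x 0 0 * (y ^+ 3 * d)) (v 0 1 * y - x 0 1 * (y ^+ 3 * d))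
     (v 0 2) (v 0 3).
Proof.
move=> y d.
have s0 : Num.sqrt (1 + q x) != 0 by rewrite gt_eqF// sqrtr_gt0 onep_gt0.
have dq : is_derive x v (fun z : 'rV[R]_4 => q z) (2 * d) := is_derive_disc_norm2 x v.
have d1 : is_derive x v (fun z : 'rV[R]_4 => 1 + q z) (2 * d) by derive_with ltac:(ring).
have d2 := is_derive_sqrt_comp (f := fun z : 'rV[R]_4 => 1 + q z) (onep_gt0 x) d1.
have d3 : is_derive x v (fun z : 'rV[R]_4 => (Num.sqrt (1 + q z))^-1) (- (y ^+ 3 * d)).
  derive_with ltac:(rewrite /y; field); exact: s0.
have e0 : is_derive x v (fun z : 'rV[R]_4 => z 0 0 * (Num.sqrt (1 + q z))^-1)
    (v 0 0 * y - x 0 0 * (y ^+ 3 * d)).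
  apply: is_derive_val (is_derive_mul (is_derive_coord x v 0) d3) _.
  by rewrite mulrN.
have e1 : is_derive x v (fun z : 'rV[R]_4 => z 0 1 * (Num.sqrt (1 + q z))^-1)
    (v 0 1 * y - x 0 1 * (y ^+ 3 * d)).
  apply: is_derive_val (is_derive_mul (is_derive_coord x v 1) d3) _.
  by rewrite mulrN.
by have [_ <-] := is_derive_row4 e0 e1 (is_derive_coord x v 2) (is_derive_coord x v 3).
Qed.

Variables (kap l L : R).
Hypotheses (l0 : l != 0) (L0 : L != 0).
Local Notation gbar := (twisted_metric bdryA bdryB bdryC kap l L).

Lemma pullback_to_disc (x : 'rV[R]_4) :
  (1 - q (to_disc x)) ^+ 2 *: twisted_metric (@coefA R) (@coefB R) (@coefC R) kap l L x
  = pullback to_disc gbar x.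
Proof.
apply: symmetric_form_eq.
- by rewrite linearZ /= twisted_metric_sym.
- by apply: pullback_sym; exact: twisted_metric_sym.
move=> v; rewrite pullback_form; last first.
  exact: (smooth_row_differentiable openT smooth_to_disc).
rewrite -scalemxAr -scalemxAl mxE !twisted_metricE derive_to_disc.
(* The defining function [1 - |w|^2] at the image point is [y ^+ 2]; every coefficient is expressed
   through [y]. *)
pose y := (Num.sqrt (1 + q x))^-1; rewrite -/y.
have c0 := onep_gt0 x.
have y2 : y ^+ 2 = (1 + q x)^-1 by rewrite /y sqr_rsqrt.
have q1 : y ^+ 2 * (1 + q x) = 1 by rewrite y2 mulVf// gt_eqF.
have qd : q (to_disc x) = q x * y ^+ 2 by rewrite q_to_disc y2.
have od : 1 - q (to_disc x) = y ^+ 2 by rewrite qd -q1; ring.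
rewrite od /twisted_form /to_disc !row4s -/y -/(to_disc x).
pose d := dotu x v; rewrite -/d.
have dE : x 0 0 * v 0 0 + x 0 1 * v 0 1 = d by [].
pose t0 := tw0 kap x v; pose t1 := tw1 kap x v.
have E1 : x 0 0 * y * (v 0 0 * y - x 0 0 * (y ^+ 3 * d)) + x 0 1 * y * (v 0 1 * y - x 0 1 * (y ^+ 3 * d))
   = y ^+ 4 * d.
  have -> : y ^+ 4 * d = y ^+ 2 * (y ^+ 2 * (1 + q x) - y ^+ 2 * q x) * d by ring.
  by rewrite q1 -dE /disc_norm2; ring.
have E2 : (v 0 0 * y - x 0 0 * (y ^+ 3 * d) - kap * (x 0 1 * y) * v 0 2) *
      (v 0 0 * y - x 0 0 * (y ^+ 3 * d) - kap * (x 0 1 * y) * v 0 2) +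
      (v 0 1 * y - x 0 1 * (y ^+ 3 * d) + kap * (x 0 0 * y) * v 0 2) *
      (v 0 1 * y - x 0 1 * (y ^+ 3 * d) + kap * (x 0 0 * y) * v 0 2)
   = y ^+ 2 * (t0 * t0 + t1 * t1) + (y ^+ 6 * q x - 2 * y ^+ 4) * d ^+ 2.
  by rewrite /t0 /t1 /tw0 /tw1 /disc_norm2 -dE; ring.
rewrite E1 E2 dE -/(tw0 kap x v) -/(tw1 kap x v) -/t0 -/t1.
have p0 := rplus_neq0 R.
have rE : (p + q x) * y ^+ 2 = bdry_radius (q (to_disc x)).
  by rewrite /bdry_radius qd -[in RHS](mulr1 p) -{1}q1; ring.
have qi : q x = 1 / y ^+ 2 - 1 by rewrite y2 div1r invrK; ring.
have y0 : y != 0 by rewrite /y invr_neq0// gt_eqF// sqrtr_gt0.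
have rg : 0 < bdry_radius (q (to_disc x)).
  by rewrite -rE mulr_gt0 ?exprn_even_gt0// ltr_wpDr ?disc_norm2_ge0// rplus_gt0.
have n0 : bdry_numer (q (to_disc x)) != 0 by rewrite gt_eqF// bdry_numer_gt0.
have r0 : p + q x != 0 by rewrite gt_eqF// ltr_wpDr ?disc_norm2_ge0// rplus_gt0.
have nE : bdry_numer (q (to_disc x)) = numer (q x) * y ^+ 4.
  rewrite /bdry_numer -rE qd /numer.
  have -> : q x * y ^+ 2 = (p + q x) * y ^+ 2 - p * y ^+ 2 by ring.
  by ring.
have nn0 : numer (q x) != 0 by rewrite gt_eqF// numer_gt0// disc_norm2_ge0.
have AE : bdryA (q (to_disc x)) = y ^+ 2 * coefA (q x).
  by rewrite /bdryA nE -rE /coefA; field; rewrite r0 y0.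
have CE : bdryC (q (to_disc x)) = y ^+ 4 * coefC (q x).
  by rewrite /bdryC -rE /coefC; ring.
(* The relation that comparison of the coefficients of [d ^+ 2 = (x.v)^2] demands, once the
   coefficient A has been matched. *)
have BE : bdryB (q (to_disc x)) * y ^+ 4 = coefB (q x) + coefA (q x) * (2 * y ^+ 2 - y ^+ 4 * q x).
  rewrite /bdryB nE -rE qd /coefB /coefA /theta_radius; rewrite /numer in nn0 *.
  have -> : 2 * y ^+ 2 - y ^+ 4 * q x = y ^+ 2 + y ^+ 4.
    have -> : y ^+ 4 * q x = y ^+ 2 * (y ^+ 2 * (1 + q x)) - y ^+ 4 by ring.
    by rewrite q1; ring.
  move: nn0 r0; rewrite qi => nn0 r0.
  field.
  rewrite y0 p0 /=; apply/andP; split.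
    rewrite (_ : _ + _ = (p + (1 / y ^+ 2 - 1)) * y ^+ 2) ?mulf_neq0 ?expf_neq0//.
    by field.
  set N := _ + (p * (y * y)) ^+ 2.
  have -> : N = ((p + (1 / y ^+ 2 - 1)) ^+ 2 + (p + (1 / y ^+ 2 - 1)) * p + p ^+ 2) * y ^+ 4.
    by rewrite /N; field.
  by rewrite mulf_neq0 ?expf_neq0.
rewrite AE CE.
have -> : bdryB (q (to_disc x)) * (y ^+ 4 * d * (y ^+ 4 * d)) = y ^+ 4 * (bdryB (q (to_disc x)) * y ^+ 4) * d ^+ 2 by ring.
by rewrite BE; ring.
Qed.

Lemma filling_compactification :
  conformal_compactification (twisted_metric (@coefA R) (@coefB R) (@coefC R) kap l L)
    to_disc (fun x => 1 - q x) gbar.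
Proof.
split; first exact: to_disc_quotient_diffeo.
have q01 x : @disc_closed R x -> 0 < bdry_radius (q x).
  by move=> cx; apply: bdry_radius_gt0; rewrite disc_norm2_ge0.
have cq : continuous q := smooth_continuous (smooth_disc_norm2 (@openT 'rV[R]_4)).
(* On this neighbourhood of the closed disc both factors of the denominators, [bdry_radius] and
   [bdry_numer], are positive. *)
pose W : set 'rV[R]_4 := [set x | 0 < bdry_radius (q x)].
have oW : open W.
  rewrite (_ : W = (fun x => bdry_radius (q x)) @^-1` [set t | 0 < t])//.
  apply: open_comp; last exact: open_gt.
  move=> x _; suff : smooth_on setT (fun x : 'rV[R]_4 => bdry_radius (q x)).
    by move/smooth_continuous; apply.
  have sq : smooth_on setT (fun x : 'rV[R]_4 => q x) by apply: smooth_disc_norm2; exact: openT.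
  by rewrite /bdry_radius; smooth_rules.
split.
  exists W; split=> //.
    by have sq : smooth_on W (fun x : 'rV[R]_4 => q x); [exact: smooth_disc_norm2|smooth_rules].
  have [|sA sB sC] := @smooth_bdry W oW; first by [].
  exact: smooth_twisted_metric.
split.
  by move=> x y _ xy; rewrite (disc_norm2_torus xy) (twisted_metric_periodic _ _ _ _ _ _ xy).
split; first by move=> x; rewrite subr_gt0.
split.
  move=> x bx; split; first by rewrite bx subrr.
  have dr i : partial i (fun x => 1 - q x) x = - (2 * dotu x (basis4 R i)).
    rewrite /partial.
    have dq : is_derive x (basis4 R i) (fun z : 'rV[R]_4 => q z) (2 * dotu x (basis4 R i)) :=
      is_derive_disc_norm2 x _.
    by have [_ <-] : is_derive x (basis4 R i) (fun z => 1 - q z) (- (2 * dotu x (basis4 R i)));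
       first by derive_with ltac:(ring).
  have [x0|x0] := eqVneq (x 0 0) 0.
    exists 1; rewrite dr oppr_eq0; have [_ -> _ _] := basis4E R.
    rewrite /dotu !row4s mulr0 mulr1 add0r mulf_neq0 ?pnatr_eq0//.
    apply: contraPneq bx => x1; rewrite /disc_boundary /= /disc_norm2 x0 x1 expr0n addr0.
    by move/eqP; rewrite eq_sym oner_eq0.
  exists 0; rewrite dr oppr_eq0; have [-> _ _ _] := basis4E R.
  by rewrite /dotu !row4s mulr0 mulr1 addr0 mulf_neq0 ?pnatr_eq0.
split.
  move=> x cx; have r0 := q01 x cx; have n0 := bdry_numer_gt0 r0.
  apply: twisted_metric_posdef => //.
  - by rewrite /bdryA divr_gt0// mulr_gt0// exprn_gt0// theta_radius_gt0.
  - by rewrite bdryD// divr_gt0// mulr_gt0.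
  - by rewrite /bdryC exprn_gt0.
exact: pullback_to_disc.
Qed.

End Compactification.

(** * Completeness *)

Section PathLength.
Variable R : realType.
Implicit Types (g : 'rV[R]_4 -> 'M[R]_4) (c : R -> 'rV[R]_4).
Local Notation mu := (@lebesgue_measure R).

Definition speed g c (t : R) : R :=
  Num.sqrt ((derive1 c t *m g (c t) *m (derive1 c t)^T) 0 0).

Lemma C1_path_continuous c : C1_path c -> continuous c.
Proof.
move=> [dc _] t; apply: differentiable_continuous; apply/derivable1_diffP; exact: dc.
Qed.

Lemma continuous_entry (T : topologicalType) m n (M : T -> 'M[R]_(m, n)) i j :
  continuous M -> continuous (fun t => M t i j).
Proof. by move=> cM t; have /continuous_mxP := cM t; apply. Qed.

Lemma continuous_speed g c : smooth_on setT g -> C1_path c -> continuous (speed g c).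
Proof.
move=> sg c1 t; have cc := C1_path_continuous c1.
apply: (@continuous_comp _ _ _
  (fun t => (derive1 c t *m g (c t) *m (derive1 c t)^T) 0 0) Num.sqrt); last exact: sqrt_continuous.
have -> : (fun t => (derive1 c t *m g (c t) *m (derive1 c t)^T) 0 0) =
  (fun t => \sum_(i < 4) \sum_(j < 4) derive1 c t 0 i * g (c t) i j * derive1 c t 0 j).
  by apply/funext => s; rewrite form4E.
apply: continuous_sum_pt => i; apply: continuous_sum_pt => j.
have ci k : {for t, continuous (fun t => derive1 c t 0 k : R)} by exact: continuous_entry c1.2 t.
have cg : {for t, continuous (fun t => g (c t) i j : R)}.
  apply: (@continuous_comp _ _ _ c (fun x => g x i j : R)); first exact: cc.
  exact: continuous_entry (smooth_continuous sg) _.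
exact: (cvgM (cvgM (ci i) cg) (ci j)).
Qed.

Lemma continuous_integrable01 (f : R -> R) : continuous f ->
  mu.-integrable `[0, 1] (EFin \o f).
Proof.
move=> cf; apply: continuous_compact_integrable; first exact: segment_compact.
exact: continuous_subspaceT.
Qed.

Lemma integral_derivative01 (F f : R -> R) : continuous f ->
  (forall t : R, is_derive t 1 F (f t)) -> \int[mu]_(t in `[0, 1]) f t = F 1 - F 0.
Proof.
move=> cf dF.
have cF : continuous F.
  by move=> t; apply: differentiable_continuous; apply/derivable1_diffP; have [] := dF t.
rewrite /Rintegral (@continuous_FTC2 R f F 0 1)//.
- exact: continuous_subspaceT.
- split; first by move=> t _; have [] := dF t.
  + exact: cvg_at_right_filter (cF 0).
  + exact: cvg_at_left_filter (cF 1).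
- by move=> t _; rewrite derive1E; have [] := dF t.
Qed.

(** Integrates the derivative of [N] along the path: a function whose gradient has length at most
    [K] cannot vary faster than [K] times arc length. *)
Lemma length_lipschitz g c (N : 'rV[R]_4 -> R) (K : R) :
  smooth_on setT g -> C1_path c -> smooth_on setT N -> 0 <= K ->
  (forall x v, ('D_v N x) ^+ 2 <= K ^+ 2 * (v *m g x *m v^T) 0 0) ->
  `|N (c 1) - N (c 0)| <= K * path_length g c.
Proof.
move=> sg c1 sN K0 NK.
have cc := C1_path_continuous c1; have oT := @openT 'rV[R]_4.
have C1N : Ck 1 setT N by move: sN => /smooth_onP; apply.
have dN x := Ck1_differentiable oT C1N (I : setT x).
pose f : R -> R := fun t => 'D_(derive1 c t) N (c t).
have dF (t : R) : is_derive t 1 (fun t => N (c t)) (f t).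
  rewrite /f derive1E; apply: is_derive_comp; last by have [] := dN (c t).
  by apply/derivable1_diffP; exact: c1.1.
have cf : continuous f.
  move=> t; have -> : f = (fun t => \sum_j derive1 c t 0 j * partial j N (c t)).
    by apply/funext => s; rewrite /f (dN (c s)).2.
  apply: continuous_sum_pt => j.
  have ci : {for t, continuous (fun t => derive1 c t 0 j : R)} by exact: continuous_entry c1.2 t.
  have cp : {for t, continuous (fun t => partial j N (c t))}.
    apply: (@continuous_comp _ _ _ c (partial j N)); first exact: cc.
    by have [_ [_ pN]] := C1N; have [+ _] := pN j; apply.
  exact: (cvgM ci cp).
rewrite -(integral_derivative01 cf dF).
have m01 : measurable (`[0, 1]%classic : set R) by exact: measurable_itv.
have h1 : `|\int[mu]_(t in `[0, 1]) f t| <= \int[mu]_(t in `[0, 1]) `|f t|.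
  by apply: le_normr_Rintegral => //; exact: continuous_integrable01.
apply: (le_trans h1).
have cs := continuous_speed sg c1.
have cKs : continuous (fun t => K * speed g c t).
  by move=> t; exact: (cvgM (@cst_continuous R R K t) (cs t)).
have <- : \int[mu]_(t in `[0, 1]) (K * speed g c t) = K * path_length g c.
  by apply: RintegralZl => //; exact: continuous_integrable01.
apply: le_Rintegral => //.
- apply: continuous_integrable01 => t.
  exact: (@continuous_comp _ _ _ f Num.norm _ (cf t) (@norm_continuous R R _)).
- exact: continuous_integrable01.
move=> t _; rewrite /f /speed -(@ler_pXn2r _ 2)// ?nnegrE ?mulr_ge0 ?sqrtr_ge0//.
rewrite real_normK ?num_real// exprMn.
(* Positivity of [g] is not among the hypotheses; for a negative radicand the right-hand side is
   still nonnegative. *)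
have [Q0|Q0] := leP 0 ((derive1 c t *m g (c t) *m (derive1 c t)^T) 0 0).
  by rewrite sqr_sqrtr//; exact: NK.
apply: le_trans (NK _ _) _; rewrite ler_wpM2l ?sqr_ge0//.
by rewrite (le_trans (ltW Q0))// sqr_ge0.
Qed.

Lemma derive_line_path (y v : 'rV[R]_4) (t : R) : is_derive t 1 (fun t : R => y + t *: v) v.
Proof.
have := @is_derive_line R _ _ (id : 'rV[R]_4 -> 'rV[R]_4) y v t.
by rewrite derive_id; apply; exact: derivable_id.
Qed.

Lemma line_C1_path (y v : 'rV[R]_4) : C1_path (fun t => y + t *: v) /\
  (forall t, derive1 (fun t => y + t *: v) t = v).
Proof.
have E t : derive1 (fun t => y + t *: v) t = v.
  by rewrite derive1E; have [] := derive_line_path y v t.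
split=> //; split; first by move=> t; have [] := derive_line_path y v t.
rewrite (_ : derive1 _ = (fun=> v)); last exact/funext.
by move=> t; exact: cst_continuous.
Qed.

Lemma line_length_le g (y v : 'rV[R]_4) (M : R) : smooth_on setT g -> 0 <= M ->
  (forall t, 0 <= t <= 1 -> (v *m g (y + t *: v) *m v^T) 0 0 <= M ^+ 2) ->
  path_length g (fun t => y + t *: v) <= M.
Proof.
move=> sg M0 HM; have [c1 dE] := line_C1_path y v.
have cs := continuous_speed sg c1.
have m01 : measurable (`[0, 1]%classic : set R) by exact: measurable_itv.
have : path_length g (fun t => y + t *: v) <= \int[mu]_(t in `[0, 1]) (cst M t).
  apply: le_Rintegral => //.
  - exact: continuous_integrable01 cs.
  - by apply: continuous_integrable01 => t; exact: cst_continuous.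
  move=> t; rewrite /= in_itv /= => t01; rewrite dE -(@ler_pXn2r _ 2)// ?nnegrE ?sqrtr_ge0//.
  have [Q0|Q0] := leP 0 ((v *m g (y + t *: v) *m v^T) 0 0).
    by rewrite sqr_sqrtr//; exact: HM.
  by rewrite ltr0_sqrtr// expr0n sqr_ge0.
have -> : \int[mu]_(t in `[0, 1]) (cst M t) = M * fine (mu `[0%R, 1%R]%classic).
  exact: Rintegral_cst.
have -> : mu `[0%R, 1%R]%classic = 1%E.
  by rewrite lebesgue_measure_itv /= lte_fin ltr01 -EFinB subr0.
by rewrite mulr1.
Qed.

Lemma path_length_ge0 g c : 0 <= path_length g c.
Proof. by apply: Rintegral_ge0 => t _; exact: sqrtr_ge0. Qed.

Lemma torus_rel_refl (x : 'rV[R]_4) : torus_rel x x.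
Proof. by apply/torus_relE; split=> //; exists 0; rewrite addr0. Qed.

Lemma riem_dist_lt g (x y : 'rV[R]_4) (e : R) : riem_dist g x y < e ->
  exists c, [/\ C1_path c, torus_rel x (c 0), torus_rel y (c 1) & path_length g c < e].
Proof.
move=> /inf_lt[|L [c [c1 xc yc ->]] Le]; last by exists c.
(* The infimum carries information only if the set of lengths is nonempty; a straight segment shows
   that it is. *)
exists (path_length g (fun t => x + t *: (y - x))), (fun t => x + t *: (y - x)).
split=> //; first by have [] := line_C1_path x (y - x).
  by rewrite scale0r addr0; exact: torus_rel_refl.
by rewrite scale1r addrC subrK; exact: torus_rel_refl.
Qed.

Lemma riem_dist_le_line g (x y p : 'rV[R]_4) :
  torus_rel x y -> riem_dist g x p <= path_length g (fun t => y + t *: (p - y)).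
Proof.
move=> xy; apply: ge_inf.
  by exists 0 => _ [c [_ _ _ ->]]; exact: path_length_ge0.
exists (fun t => y + t *: (p - y)); split=> //.
- by have [] := line_C1_path y (p - y).
- by rewrite scale0r addr0.
- by rewrite scale1r addrC subrK; exact: torus_rel_refl.
Qed.

End PathLength.

(** * Cauchy sequences on the line and on the circle *)

Section CauchySequences.
Variable R : realType.

Lemma real_cauchy_limit (u : nat -> R) :
  (forall e : R, 0 < e -> exists N, forall m n, (N <= m)%N -> (N <= n)%N -> `|u m - u n| < e) ->
  exists l : R, u @ \oo --> l.
Proof.
move=> H.
have : cvgn u.
  apply/cauchy_cvgP/cauchy_ballP => e e0; near_simpl; have [N HN] := H e e0.
  exists ([set n | (N <= n)%N], [set n | (N <= n)%N]); first by split; exists N.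
  by move=> [m n] [/= Nm Nn]; rewrite /ball /=; exact: HN.
by move=> cu; exists (limn u).
Qed.

(** A sequence that is Cauchy modulo integers is lifted by choosing, for each late term, the
    representative within 1/4 of a fixed term. The lift is then an honest Cauchy sequence. *)
Lemma circle_cauchy_limit (u : nat -> R) :
  (forall e : R, 0 < e -> exists N, forall m n, (N <= m)%N -> (N <= n)%N ->
     exists z : int, `|u m - u n + z%:~R| < e) ->
  exists (l : R) (z : nat -> int), (fun n => u n + (z n)%:~R) @ \oo --> l.
Proof.
move=> H; have [N0 HN0] := H (4^-1) ltac:(by rewrite invr_gt0).
have [z Hz] : exists z : nat -> int, forall n, (N0 <= n)%N -> `|u n - u N0 + (z n)%:~R| < 4^-1.
  have : forall n, exists z : int, (N0 <= n)%N -> `|u n - u N0 + z%:~R| < 4^-1.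
    move=> n; case: (leqP N0 n) => h; last by exists 0.
    by have [z zE] := HN0 n N0 h (leqnn _); exists z.
  by move=> /choice[z Hz]; exists z.
have [l Hl] : exists l : R, (fun n => u n + (z n)%:~R) @ \oo --> l; last by exists l, z.
apply: real_cauchy_limit => e e0.
(* With 1/4 from each of the two lifts, the bound 1/2 makes the discrepancy of integers smaller than
   1 in absolute value, hence zero. *)
have e'0 : 0 < Num.min e 2^-1 by rewrite lt_min e0 invr_gt0/= ltr0n.
have [N HN] := H _ e'0; exists (maxn N N0) => m n.
rewrite !geq_max => /andP[Nm N0m] /andP[Nn N0n].
have [j] := HN m n Nm Nn; rewrite lt_min => /andP[je j2].
have hm := Hz m N0m; have hn := Hz n N0n.
suff jE : j = z m - z n by rewrite (_ : _ - _ = u m - u n + j%:~R)// jE intrB; ring.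
apply/eqP; rewrite -subr_eq0 -normr_eq0.
have : `|(j - (z m - z n))%:~R : R| < 1.
  rewrite !intrB; move: hm hn j2; rewrite !ltr_norml => /andP[? ?] /andP[? ?] /andP[? ?].
  by apply/andP; split; lra.
by rewrite -intr_norm ltrz1 -[`|_| < 1]/(`|_| < 0 + 1) ltzD1 normr_le0 normr_eq0.
Qed.

End CauchySequences.

Ltac nonneg :=
  repeat first [done | exact: sqr_ge0 | exact: ltW | rewrite invr_ge0
    | apply: mulr_ge0 | apply: addr_ge0].

(** * Completeness of the filling metrics *)

Section Completeness.
Variable R : realType.
Local Notation p := (@rplus R).
Local Notation k := (@theta_radius R).
Local Notation q := (@disc_norm2 R).
Variables (alpha l L : R).
Hypotheses (l0 : l != 0) (L0 : L != 0).
Local Notation g := (filling_metric alpha l L).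
Local Notation kap := (alpha / k).

(** Bounds the disc part of the metric below by a common lower bound [m] of its tangential and
    radial eigenvalues, with [s] in the role of [(x.w)^2]. *)
Lemma base_form_ge (A B s n d m : R) : 0 <= n -> 0 <= s -> s <= d * n -> 0 <= d ->
  m <= A -> m <= A + B * d -> m * n <= A * n + B * s.
Proof.
move=> n0 s0 sn d0 mA mD; have [B0|B0] := leP 0 B.
  by rewrite ler_wpDr ?mulr_ge0// ler_wpM2r.
have h1 : B * (d * n) <= B * s by rewrite ler_nM2l.
have h2 : m * n <= (A + B * d) * n by rewrite ler_wpM2r.
by apply: (le_trans h2); rewrite mulrDl lerD2l -mulrA.
Qed.

Lemma ler_ratio (c b D Q : R) : 0 <= c -> 0 < D -> b * D <= Q -> c * b <= c / D * Q.
Proof. by move=> c0 D0 h; rewrite mulrAC ler_pdivlMr// -mulrA ler_wpM2l. Qed.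

(** The weakest direction is the radial one, whose eigenvalue [4 r / N] decays like
    [1 / (1 + |x|^2)]; this dictates the weight of the first two components. *)
Lemma filling_metric_lower : exists2 K : R, 0 < K & forall x v : 'rV[R]_4,
  (v 0 0 ^+ 2 + v 0 1 ^+ 2) / (1 + q x) + v 0 2 ^+ 2 + v 0 3 ^+ 2
    <= K * (v *m g x *m v^T) 0 0.
Proof.
have pg := rplus_gt0 R; have kg := theta_radius_gt0 R.
(* The first number bounds [coefA] by [N >= r p]; the second bounds the radial eigenvalue by
   [N <= 3 r^2] and [r <= (p + 1) (1 + q)]. *)
pose c1 := Num.min (k ^+ 2 * p) (4 / (3 * (p + 1))).
have c10 : 0 < c1.
  by rewrite lt_min mulr_gt0 ?exprn_gt0//= divr_gt0// mulr_gt0// addr_gt0.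
have l20 : 0 < l ^+ 2 by rewrite exprn_even_gt0.
have L20 : 0 < L ^+ 2 by rewrite exprn_even_gt0.
have p20 : 0 < p ^+ 2 by rewrite exprn_gt0.
(* Pays for the third component once as such, and [2 * kap ^+ 2] times for undoing the twist in the
   disc components. *)
pose K2 := (2 * kap ^+ 2 + 1) / (p ^+ 2 * l ^+ 2).
have K20 : 0 <= K2.
  by nonneg.
exists (2 / c1 + K2 + (p ^+ 2 * L ^+ 2)^-1).
  apply: ltr_wpDr; first by nonneg.
  by apply: ltr_wpDr => //; apply: divr_gt0.
move=> x v; rewrite /filling_metric twisted_metricE.
have q0 := disc_norm2_ge0 x.
have q1 : 0 < 1 + q x by rewrite ltr_wpDr.
have r0 : 0 < p + q x by rewrite ltr_wpDr.
have N0 := numer_gt0 q0.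
pose t0 := tw0 kap x v; pose t1 := tw1 kap x v.
pose n := t0 ^+ 2 + t1 ^+ 2.
have n0 : 0 <= n by rewrite addr_ge0 ?sqr_ge0.
have Aq : c1 / (1 + q x) <= coefA (q x).
  apply: (@le_trans _ _ (k ^+ 2 * p)).
    rewrite ler_pdivrMr//; apply: (@le_trans _ _ (k ^+ 2 * p)); first by rewrite ge_min lexx.
    by apply: ler_peMr; [nonneg|rewrite lerDl].
  rewrite /coefA -mulrA ler_wpM2l ?sqr_ge0// ler_pdivlMr// /numer.
  have := sqr_ge0 (p + q x); have := ltW p20; rewrite mulrC => h1 h2.
  by rewrite -addrA [X in _ <= X]addrCA lerDl addr_ge0.
have Dq : c1 / (1 + q x) <= coefA (q x) + coefB (q x) * q x.
  rewrite coefD// ler_pdivrMr// mulrAC ler_pdivlMr//.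
  apply: (@le_trans _ _ (4 / (3 * (p + 1)) * numer (q x))).
    by rewrite ler_wpM2r ?(ltW N0)// ge_min lexx orbT.
  rewrite mulrAC ler_pdivrMr ?mulr_gt0 ?addr_gt0//.
  have hN : numer (q x) <= 3 * (p + q x) ^+ 2.
    have -> : 3 * (p + q x) ^+ 2 = numer (q x) + (3 * p * q x + 2 * q x ^+ 2) by rewrite /numer; ring.
    by rewrite lerDl; nonneg.
  have hr : p + q x <= (p + 1) * (1 + q x).
    rewrite -subr_ge0 (_ : _ - _ = 1 + p * q x); first by nonneg.
    by ring.
  apply: (@le_trans _ _ (4 * (3 * (p + q x) ^+ 2))); first by rewrite ler_wpM2l.
  have -> : 4 * (3 * (p + q x) ^+ 2) = 12 * (p + q x) * (p + q x) by ring.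
  have -> : 4 * (p + q x) * (1 + q x) * (3 * (p + 1)) = 12 * (p + q x) * ((p + 1) * (1 + q x)) by ring.
  by apply: ler_wpM2l => //; nonneg.
have cs : (x 0 0 * t0 + x 0 1 * t1) ^+ 2 <= q x * n.
  rewrite -subr_ge0 (_ : _ - _ = (x 0 0 * t1 - x 0 1 * t0) ^+ 2) ?sqr_ge0//.
  by rewrite /disc_norm2 /n; ring.
have base := base_form_ge n0 (sqr_ge0 _) cs q0 Aq Dq.
have cC : p ^+ 2 <= coefC (q x) by rewrite /coefC ler_pXn2r// ?lerDl// nnegrE; exact: ltW.
set Q := twisted_form _ _ _ _ _ _ _ _ _.
have QE : Q = coefA (q x) * n + coefB (q x) * (x 0 0 * t0 + x 0 1 * t1) ^+ 2
   + coefC (q x) * (l ^+ 2 * v 0 2 ^+ 2 + L ^+ 2 * v 0 3 ^+ 2).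
  by rewrite /Q /twisted_form /n /t0 /t1 /tw0 /tw1; ring.
pose a := n / (1 + q x); pose b2 := v 0 2 ^+ 2; pose b3 := v 0 3 ^+ 2.
have a0 : 0 <= a by rewrite divr_ge0// ltW.
have b20 : 0 <= b2 by exact: sqr_ge0.
have b30 : 0 <= b3 by exact: sqr_ge0.
have hQ : c1 * a + p ^+ 2 * (l ^+ 2 * b2) + p ^+ 2 * (L ^+ 2 * b3) <= Q.
  rewrite QE -addrA lerD//.
    by rewrite /a mulrA mulrAC.
  by rewrite -mulrDr; apply: ler_wpM2r => //; nonneg.
have Q0 : 0 <= Q.
  by apply: le_trans hQ; nonneg.
have x1 : 0 <= c1 * a by nonneg.
have x2 : 0 <= p ^+ 2 * (l ^+ 2 * b2) by nonneg.
have x3 : 0 <= p ^+ 2 * (L ^+ 2 * b3) by nonneg.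
have ha : 2 * a <= 2 / c1 * Q.
  by apply: ler_ratio => //; apply: le_trans hQ; lra.
have hb2 : (2 * kap ^+ 2 + 1) * b2 <= K2 * Q.
  apply: ler_ratio; [by nonneg|by rewrite mulr_gt0|].
  by apply: le_trans hQ; rewrite mulrC -mulrA; lra.
have hb3 : b3 <= (p ^+ 2 * L ^+ 2)^-1 * Q.
  rewrite -[b3]mul1r -[_^-1]mul1r; apply: ler_ratio; [by []|by rewrite mulr_gt0|].
  by apply: le_trans hQ; rewrite mulrC -mulrA; lra.
(* The disc part of [v] is its untwisted part minus [kap * v 0 2] times [x] turned by a right angle,
   and [q / (1 + q)] is at most 1. *)
have hv : (v 0 0 ^+ 2 + v 0 1 ^+ 2) / (1 + q x) <= 2 * a + 2 * kap ^+ 2 * b2.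
  rewrite ler_pdivrMr//.
  have -> : (2 * a + 2 * kap ^+ 2 * b2) * (1 + q x) = 2 * n + 2 * kap ^+ 2 * b2 * (1 + q x).
    have k0 := theta_radius_neq0 R; have q1' : 1 + q x != 0 by rewrite gt_eqF.
    by rewrite /a; field; rewrite ?k0 ?q1'.
  apply: (@le_trans _ _ (2 * n + 2 * kap ^+ 2 * b2 * q x)).
    rewrite -subr_ge0 (_ : _ - _ = (2 * t0 - v 0 0) ^+ 2 + (2 * t1 - v 0 1) ^+ 2) ?addr_ge0 ?sqr_ge0//.
    by rewrite /n /t0 /t1 /tw0 /tw1 /b2 /disc_norm2; ring.
  by rewrite lerD2l; apply: ler_wpM2l; [nonneg|rewrite lerDr].
rewrite -/b2 -/b3 [leRHS]mulrDl [X in _ <= X + _]mulrDl.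
move: hb2; rewrite mulrDl mul1r => hb2; lra.
Qed.

Lemma smooth_ln n U (f : 'rV[R]_n -> R) : open U -> (forall x, U x -> 0 < f x) ->
  smooth_on U f -> smooth_on U (fun x => ln (f x)).
Proof.
move=> oU f0 sf.
have sV : smooth_on U (fun x => (f x)^-1).
  by apply: smoothV => // x Ux; rewrite gt_eqF ?f0.
have dl x i : U x -> is_derive x (delta_mx 0 i) (fun x => ln (f x)) ((f x)^-1 * partial i f x).
  move=> Ux; apply: is_derive_comp1; first exact: is_derive1_ln (f0 x Ux).
  exact: smooth_partial_derive sf Ux.
apply: (@smooth_comp_bootstrap _ _ _ f (fun x => (f x)^-1)) => //.
- by move=> x Ux i; exact: dl.
- move=> x Ux; apply: (@continuous_comp _ _ _ f (@ln R)).
    by move: sf => /smooth_onE[+ _ _]; apply.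
  by apply: continuous_ln; exact: f0.
- by move=> k' _; have /smooth_onP := sV; apply.
Qed.

(** The factor 10 is a common bound for all the test functions; it is attained as 2 + 8 for
    [x_j / (1 + |x|^2)], while the logarithm needs only 4. *)
Lemma filling_lipschitz : exists2 K : R, 0 < K & forall N : 'rV[R]_4 -> R, smooth_on setT N ->
  (forall x v, ('D_v N x) ^+ 2 <= 10 * ((v 0 0 ^+ 2 + v 0 1 ^+ 2) / (1 + q x))
      + v 0 2 ^+ 2 + v 0 3 ^+ 2) ->
  forall c, C1_path c -> `|N (c 1) - N (c 0)| <= K * path_length g c.
Proof.
have [K0 K00 HK] := filling_metric_lower.
have [sg _ _] := filling_metric_R2T2 alpha l0 L0.
exists (Num.sqrt (10 * K0)); first by rewrite sqrtr_gt0 mulr_gt0.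
move=> N sN HN c c1; apply: length_lipschitz => //.
move=> x v; rewrite sqr_sqrtr ?mulr_ge0 ?(ltW K00)//; apply: (le_trans (HN x v)).
have := HK x v; have h2 := sqr_ge0 (v 0 2); have h3 := sqr_ge0 (v 0 3).
move=> h; rewrite -mulrA; move: h; set a := _ / _; set b := K0 * _ => h; lra.
Qed.

Lemma smooth_onep : smooth_on setT (fun x : 'rV[R]_4 => 1 + q x).
Proof.
have oT := @openT 'rV[R]_4.
have sq : smooth_on setT (fun x : 'rV[R]_4 => q x) by exact: smooth_disc_norm2.
by smooth_rules.
Qed.

Lemma dotu_sqr_le (x v : 'rV[R]_4) : dotu x v ^+ 2 <= q x * (v 0 0 ^+ 2 + v 0 1 ^+ 2).
Proof.
rewrite -subr_ge0 (_ : _ - _ = (x 0 0 * v 0 1 - x 0 1 * v 0 0) ^+ 2) ?sqr_ge0//.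
by rewrite /dotu /disc_norm2; ring.
Qed.

Lemma log_lipschitz (x v : 'rV[R]_4) :
  ('D_v (fun x => ln (1 + q x)) x) ^+ 2 <= 10 * ((v 0 0 ^+ 2 + v 0 1 ^+ 2) / (1 + q x))
      + v 0 2 ^+ 2 + v 0 3 ^+ 2.
Proof.
have q1 := onep_gt0 x; have q0 := disc_norm2_ge0 x.
have dq : is_derive x v (fun z : 'rV[R]_4 => q z) (2 * dotu x v) := is_derive_disc_norm2 x v.
have d1 : is_derive x v (fun z : 'rV[R]_4 => 1 + q z) (2 * dotu x v) by derive_with ltac:(ring).
have [_ ->] := @is_derive_comp1 R _ (fun z : 'rV[R]_4 => 1 + q z) (@ln R) x v _ _ (is_derive1_ln q1) d1.
apply: (@le_trans _ _ (10 * ((v 0 0 ^+ 2 + v 0 1 ^+ 2) / (1 + q x)))); last first.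
  by rewrite -addrA lerDl addr_ge0 ?sqr_ge0.
rewrite [leRHS]mulrA ler_pdivlMr// exprMn exprVn.
have -> : (1 + q x) ^- 2 * (2 * dotu x v) ^+ 2 * (1 + q x) = 4 * dotu x v ^+ 2 / (1 + q x).
  by field; rewrite gt_eqF.
rewrite ler_pdivrMr//; have := dotu_sqr_le x v.
set n := v 0 0 ^+ 2 + _; have n0 : 0 <= n by rewrite addr_ge0 ?sqr_ge0.
have := mulr_ge0 q0 n0 => h1 h2.
have -> : 10 * n * (1 + q x) = 10 * n + 10 * (q x * n) by ring.
lra.
Qed.

(** The coordinates [x_j] are not Lipschitz, as radial lengths shrink towards infinity. Division by
    [1 + |x|^2] repairs this, and the limit of [ln (1 + |x|^2)] allows the division to be undone. *)
Lemma ratio_lipschitz (x v : 'rV[R]_4) j : j = 0 \/ j = 1 ->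
  ('D_v (fun x : 'rV[R]_4 => x 0 j / (1 + q x)) x) ^+ 2 <= 10 * ((v 0 0 ^+ 2 + v 0 1 ^+ 2) / (1 + q x))
      + v 0 2 ^+ 2 + v 0 3 ^+ 2.
Proof.
move=> j01.
have q1 := onep_gt0 x; have q0 := disc_norm2_ge0 x; have q1' : 1 + q x != 0 by rewrite gt_eqF.
have dq : is_derive x v (fun z : 'rV[R]_4 => q z) (2 * dotu x v) := is_derive_disc_norm2 x v.
have [_ ->] : is_derive x v (fun z : 'rV[R]_4 => z 0 j / (1 + q z))
    ((v 0 j * (1 + q x) - 2 * x 0 j * dotu x v) / (1 + q x) ^+ 2).
  by derive_with ltac:(field); exact: q1'.
apply: (@le_trans _ _ (10 * ((v 0 0 ^+ 2 + v 0 1 ^+ 2) / (1 + q x)))); last first.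
  by rewrite -addrA lerDl addr_ge0 ?sqr_ge0.
have := dotu_sqr_le x v; set n := v 0 0 ^+ 2 + _.
have n0 : 0 <= n by rewrite addr_ge0 ?sqr_ge0.
have xj : x 0 j ^+ 2 <= q x.
  by case: j01 => ->; rewrite /disc_norm2 ?lerDl ?lerDr sqr_ge0.
have vj : v 0 j ^+ 2 <= n.
  by case: j01 => ->; rewrite /n ?lerDl ?lerDr sqr_ge0.
move=> hd; set s := 1 + q x in q1 q1' *.
rewrite expr_div_n [leRHS]mulrA ler_pdivlMr// mulrAC ler_pdivrMr ?exprn_gt0//.
have h1 : (v 0 j * s - 2 * x 0 j * dotu x v) ^+ 2 <= 2 * (v 0 j ^+ 2 * s ^+ 2) + 8 * (x 0 j ^+ 2 * dotu x v ^+ 2).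
  rewrite -subr_ge0 (_ : _ - _ = (v 0 j * s + 2 * x 0 j * dotu x v) ^+ 2) ?sqr_ge0//; ring.
have h2 : v 0 j ^+ 2 * s ^+ 2 <= n * s ^+ 2 by rewrite ler_wpM2r ?sqr_ge0.
have h3 : x 0 j ^+ 2 * dotu x v ^+ 2 <= n * s ^+ 2.
  apply: (@le_trans _ _ (q x * (q x * n))); first by apply: ler_pM => //; exact: sqr_ge0.
  rewrite mulrA -expr2 mulrC; apply: ler_wpM2l => //.
  by rewrite ler_pXn2r// ?nnegrE ?(ltW q1)// /s lerDr.
have h4 : (v 0 j * s - 2 * x 0 j * dotu x v) ^+ 2 <= 10 * (n * s ^+ 2) by lra.
have s1 : s <= s ^+ 2 by rewrite expr2 ler_peMr ?(ltW q1)// /s lerDl.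
apply: (@le_trans _ _ (10 * (n * s ^+ 2) * s)); first by rewrite ler_wpM2r ?(ltW q1).
have -> : 10 * n * (s ^+ 2) ^+ 2 = 10 * (n * s ^+ 2) * s ^+ 2 by ring.
by rewrite ler_wpM2l// mulr_ge0// mulr_ge0// sqr_ge0.
Qed.

Lemma matrix_entry_le m n (M : 'M[R]_(m, n)) i j : `|M i j| <= `|M|.
Proof.
by rewrite [leRHS]/Num.Def.normr/= mx_normrE; exact: (le_bigmax _ _ (i, j)).
Qed.

Lemma riem_dist_near (h : 'rV[R]_4 -> 'M[R]_4) (z : 'rV[R]_4) (e : R) :
  smooth_on setT h -> 0 < e ->
  exists2 d, 0 < d & forall x y, torus_rel x y -> (forall j, `|z 0 j - y 0 j| < d) ->
    riem_dist h x z < e.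
Proof.
move=> sh e0; have ch := smooth_continuous sh.
have [d0 d00 Hd0] : exists2 d0, 0 < d0 & forall y, ball z d0 y -> forall i j, `|h y i j| <= `|h z| + 1.
  have /cvgrPdist_le/(_ 1 ltr01)/nbhs_ballP[d0 /= d00 Hd0] := ch z.
  exists d0 => // y /Hd0 h1 i j; apply: (le_trans (matrix_entry_le _ i j)).
  rewrite -lerBlDl; apply: le_trans h1; rewrite distrC.
  exact: lerB_dist.
pose M := `|h z| + 1; have M0 : 0 < M by rewrite ltr_wpDl.
(* A segment with components at most [d] has squared speed at most [16 * d^2 * M], which is at most
   [(4 * M * d)^2] since [M >= 1]; the choice of [d] makes [4 * M * d] at most [e / 2]. *)
pose d := Num.min d0 (e / (8 * M)).
have d1 : 0 < d by rewrite lt_min d00 divr_gt0// mulr_gt0.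
exists d => // x y xy Hy.
have dd0 : d <= d0 by rewrite ge_min lexx.
have de : 4 * M * d <= e / 2.
  have : d <= e / (8 * M) by rewrite ge_min lexx orbT.
  rewrite ler_pdivlMr ?mulr_gt0// => hd; rewrite ler_pdivlMr//.
  by apply: le_trans hd; rewrite (_ : _ * 2 = d * (8 * M))//; ring.
apply: le_lt_trans (riem_dist_le_line h z xy) _.
apply: (@le_lt_trans _ _ (e / 2)); last by rewrite ltr_pdivrMr// ltr_pMr// ltr1n.
apply: line_length_le => //; first by rewrite divr_ge0// ltW.
move=> t /andP[t0 t1]; set v := z - y.
have vj j : `|v 0 j| <= d by rewrite !mxE ltW.
have inb : ball z d0 (y + t *: v).
  apply: row_ball => // j; apply: lt_le_trans dd0; rewrite !mxE.
  have -> : z 0 j - (y 0 j + t * (z 0 j - y 0 j)) = (1 - t) * (z 0 j - y 0 j) by ring.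
  rewrite normrM ger0_norm ?subr_ge0//; apply: le_lt_trans (Hy j).
  by rewrite ler_piMl// lerBlDr lerDl.
apply: (@le_trans _ _ ((4 * M * d) ^+ 2)); last first.
  by rewrite ler_pXn2r// ?nnegrE ?mulr_ge0 ?divr_ge0// ltW.
rewrite form4E.
apply: (@le_trans _ _ (\sum_(i < 4) \sum_(j < 4) d * M * d)).
  apply: ler_sum => i _; apply: ler_sum => j _; apply: le_trans (ler_norm _) _.
  by rewrite !normrM; apply: ler_pM => //; apply: ler_pM => //; exact: Hd0.
have -> : \sum_(i < 4) \sum_(j < 4) d * M * d = 16 * (d * M * d) by rewrite !sum4; ring.
have M1 : 1 <= M by rewrite lerDr.
have -> : (4 * M * d) ^+ 2 = 16 * (d * M * d) * M by ring.
by apply: ler_peMr => //; rewrite !mulr_ge0// ltW.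
Qed.

Lemma filling_complete : complete_metric g.
Proof.
move=> u cau.
have [K K0 HK] := filling_lipschitz.
have [sg _ _] := filling_metric_R2T2 alpha l0 L0.
have oT := @openT 'rV[R]_4.
(* A nearly minimal path joins some representatives of the two points of the quotient, so the
   estimate is obtained for those and not for [u m] and [u n] themselves. *)
have cau' (N : 'rV[R]_4 -> R) : smooth_on setT N ->
  (forall x v, ('D_v N x) ^+ 2 <= 10 * ((v 0 0 ^+ 2 + v 0 1 ^+ 2) / (1 + q x))
      + v 0 2 ^+ 2 + v 0 3 ^+ 2) ->
  forall e : R, 0 < e -> exists n0, forall m n, (n0 <= m)%N -> (n0 <= n)%N ->
    exists x y, [/\ torus_rel (u m) x, torus_rel (u n) y & `|N x - N y| < e].
  move=> sN HN e e0; have eK : 0 < e / K by rewrite divr_gt0.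
  have [n0 Hn0] := cau _ eK; exists n0 => m n hm hn.
  have [c [c1 h0 h1 hl]] := riem_dist_lt (Hn0 m n hm hn).
  exists (c 0), (c 1); split=> //; rewrite distrC.
  apply: le_lt_trans (HK N sN HN c c1) _.
  by rewrite mulrC -ltr_pdivlMr.
have inv_cau (N : 'rV[R]_4 -> R) : smooth_on setT N ->
  (forall x v, ('D_v N x) ^+ 2 <= 10 * ((v 0 0 ^+ 2 + v 0 1 ^+ 2) / (1 + q x))
      + v 0 2 ^+ 2 + v 0 3 ^+ 2) -> (forall x y, torus_rel x y -> N x = N y) ->
  exists l : R, (fun n => N (u n)) @ \oo --> l.
  move=> sN HN iN; apply: real_cauchy_limit => e e0.
  have [n0 Hn0] := cau' N sN HN e e0; exists n0 => m n hm hn.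
  have [x [y [ux uy]]] := Hn0 m n hm hn.
  by rewrite -(iN _ _ ux) -(iN _ _ uy).
have circ_cau j : j = 2 \/ j = 3 -> exists (l : R) (z : nat -> int),
    (fun n => u n 0 j + (z n)%:~R) @ \oo --> l.
  move=> j23; apply: circle_cauchy_limit => e e0.
  have HN (x v : 'rV[R]_4) : ('D_v (fun x : 'rV[R]_4 => x 0 j : R) x) ^+ 2 <=
      10 * ((v 0 0 ^+ 2 + v 0 1 ^+ 2) / (1 + q x)) + v 0 2 ^+ 2 + v 0 3 ^+ 2.
    have [_ ->] := is_derive_coord x v j.
    have h : 0 <= 10 * ((v 0 0 ^+ 2 + v 0 1 ^+ 2) / (1 + q x)).
      by rewrite mulr_ge0// divr_ge0 ?addr_ge0 ?sqr_ge0// ltW// onep_gt0.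
    have h2 := sqr_ge0 (v 0 2); have h3 := sqr_ge0 (v 0 3).
    by case: j23 => ->; lra.
  have [n0 Hn0] := cau' _ (@smooth_coord R 4 setT j) HN e e0; exists n0 => m n hm hn.
  have [x [y [/torus_relE[_ _ [m2 e2] [m3 e3]] /torus_relE[_ _ [n2 f2] [n3 f3]]]]] := Hn0 m n hm hn.
  case: j23 => ->; rewrite ?e2 ?e3 ?f2 ?f3 => he.
    by exists (m2 - n2); rewrite intrB (_ : _ + _ = u m 0 2 + m2%:~R - (u n 0 2 + n2%:~R))//; ring.
  by exists (m3 - n3); rewrite intrB (_ : _ + _ = u m 0 3 + m3%:~R - (u n 0 3 + n3%:~R))//; ring.
have s1 := smooth_onep.
have qinv (x y : 'rV[R]_4) : torus_rel x y -> q x = q y by exact: disc_norm2_torus.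
have [a0 h0] : exists l : R, (fun n => ln (1 + q (u n))) @ \oo --> l.
  apply: (inv_cau (fun x => ln (1 + q x))).
  - by apply: smooth_ln s1 => // x _; exact: onep_gt0.
  - exact: log_lipschitz.
  - by move=> x y /qinv ->.
have rat j : j = 0 \/ j = 1 -> exists l : R, (fun n => u n 0 j / (1 + q (u n))) @ \oo --> l.
  move=> j01; apply: (inv_cau (fun x => x 0 j / (1 + q x))).
  - have hn (x : 'rV[R]_4) : setT x -> 1 + q x != 0 by rewrite gt_eqF// onep_gt0.
    by have s2 := smoothV oT hn s1; smooth_rules.
  - by move=> x v; exact: ratio_lipschitz.
  - move=> x y xy; rewrite (qinv _ _ xy); case/torus_relE: xy => e0 e1 _ _.
    by case: j01 => ->; rewrite ?e0 ?e1.
(* The coordinate is [x_j / (1 + q)] times the exponential of [ln (1 + q)], and both factors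
   converge. *)
have lim j : j = 0 \/ j = 1 -> exists l : R, (fun n => u n 0 j) @ \oo --> l.
  move=> j01; have [b hb] := rat j j01; exists (b * expR a0).
  have he : (fun n => expR (ln (1 + q (u n)))) @ \oo --> expR a0.
    exact: (cvg_comp _ _ h0 (@continuous_expR R a0)).
  have -> : (fun n => u n 0 j) = (fun n => u n 0 j / (1 + q (u n)) * expR (ln (1 + q (u n)))).
    apply/funext => n; rewrite lnK ?divfK ?gt_eqF ?onep_gt0//.
    by rewrite posrE onep_gt0.
  exact: (cvgM hb he).
have [p0 l0'] := lim 0 (or_introl erefl); have [p1 l1'] := lim 1 (or_intror erefl).
have [p2 [z2 l2']] := circ_cau 2 (or_introl erefl).
have [p3 [z3 l3']] := circ_cau 3 (or_intror erefl).
exists (row4 p0 p1 p2 p3) => e e0.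
have [d d0 Hd] := riem_dist_near (row4 p0 p1 p2 p3) sg e0.
have /cvgrPdist_lt/(_ d d0) [n0 _ H0] := l0'.
have /cvgrPdist_lt/(_ d d0) [n1 _ H1] := l1'.
have /cvgrPdist_lt/(_ d d0) [n2 _ H2] := l2'.
have /cvgrPdist_lt/(_ d d0) [n3 _ H3] := l3'.
exists (maxn (maxn n0 n1) (maxn n2 n3)) => n.
rewrite !geq_max => /andP[/andP[h0' h1'] /andP[h2' h3']].
apply: (Hd _ (row4 (u n 0 0) (u n 0 1) (u n 0 2 + (z2 n)%:~R) (u n 0 3 + (z3 n)%:~R))).
  by apply/torus_relE; rewrite !row4s; split=> //; [exists (z2 n)|exists (z3 n)].
by apply: ord4P; rewrite !row4s; [exact: H0|exact: H1|exact: H2|exact: H3].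
Qed.

End Completeness.

(** * Homotheties of flat tori *)

Section Homotheties.
Variable R : realType.

Lemma scalar_inverse n (A : 'M[R]_n) (lam : R) : 0 < lam -> A *m A^T = (lam ^+ 2)%:M ->
  A *m ((lam ^+ 2)^-1 *: A^T) = 1%:M /\ ((lam ^+ 2)^-1 *: A^T) *m A = 1%:M.
Proof.
move=> lam0 AA; have l20 : lam ^+ 2 != 0 by rewrite expf_neq0// gt_eqF.
have h : A *m ((lam ^+ 2)^-1 *: A^T) = 1%:M.
  by rewrite -scalemxAr AA scale_scalar_mx mulVf.
by split=> //; exact: mulmx1C.
Qed.

Lemma affine_inverse n (A Ai : 'M[R]_n) (b x : 'rV[R]_n) : Ai *m A = 1%:M ->
  (x - b) *m Ai *m A + b = x.
Proof. by move=> AiA; rewrite -mulmxA AiA mulmx1 subrK. Qed.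

Lemma marked_homothety_sym n lam (B : 'M[R]_n) c B' c' :
  marked_homothety lam B c B' c' -> marked_homothety lam^-1 B' c' B c.
Proof.
move=> [lam0 [A [b [AA Hl Hc]]]]; split; first by rewrite invr_gt0.
have [AAi AiA] := scalar_inverse lam0 AA; set Ai := _ *: _ in AAi AiA.
exists Ai, (- (b *m Ai)).
have E x : x *m Ai - b *m Ai = (x - b) *m Ai by rewrite mulmxBl.
have K x : ((x - b) *m Ai) *m A + b = x by exact: affine_inverse.
have K' x : (x *m A + b - b) *m Ai = x by rewrite addrK -mulmxA AAi mulmx1.
split.
- have AtA : A^T *m A = (lam ^+ 2)%:M.
    have : lam ^+ 2 *: (Ai *m A) = lam ^+ 2 *: 1%:M by rewrite AiA.
    by rewrite /Ai -scalemxAl scalerA divff ?scale1r ?scale_scalar_mx ?mulr1// expf_neq0// gt_eqF.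
  rewrite /Ai linearZ /= trmxK -scalemxAl -scalemxAr scalerA AtA scale_scalar_mx.
  by congr _%:M; field; rewrite gt_eqF.
- by move=> x y; rewrite !E Hl !K.
move=> w; split=> -[t].
  rewrite E => h; have /(Hc (w *m A + b)).2 [s hs] : exists t, lattice_rel B' (c' t) (w *m A + b).
    by exists t; move: h; rewrite Hl K.
  by exists s; rewrite Hl.
move=> h; have /(Hc (w *m A + b)).1 [s hs] : exists t, lattice_rel B' (c t *m A + b) (w *m A + b).
  by exists t; rewrite -Hl.
by exists s; rewrite E Hl K.
Qed.

Lemma marked_homothety_trans n lam lam' (B : 'M[R]_n) c B' c' B'' c'' :
  marked_homothety lam B c B' c' -> marked_homothety lam' B' c' B'' c'' ->
  marked_homothety (lam * lam') B c B'' c''.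
Proof.
move=> [lam0 [A [b [AA Hl Hc]]]] [lam0' [A' [b' [AA' Hl' Hc']]]].
split; first exact: mulr_gt0.
have [AAi AiA] := scalar_inverse lam0' AA'; set Ai := _ *: _ in AAi AiA.
exists (A *m A'), (b *m A' + b').
have E x : x *m (A *m A') + (b *m A' + b') = (x *m A + b) *m A' + b'.
  by rewrite mulmxDl addrA mulmxA.
have K x : ((x - b') *m Ai) *m A' + b' = x by exact: affine_inverse.
split.
- rewrite trmx_mul mulmxA -(mulmxA A) AA' mul_mx_scalar -scalemxAl AA scale_scalar_mx.
  by congr _%:M; ring.
- by move=> x y; rewrite !E -Hl' -Hl.
move=> w; split=> -[t].
  rewrite E -{1}(K w) -Hl' => h.
  have /Hc [s hs] : exists t, lattice_rel B' (c t *m A + b) ((w - b') *m Ai) by exists t.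
  by apply/Hc'; exists s; rewrite -(K w) -Hl'.
move=> h; have /Hc' [s hs] : exists t, lattice_rel B'' (c'' t) w by exists t.
move: hs; rewrite -(K w) -Hl' => hs.
have /Hc [r hr] : exists t, lattice_rel B' (c' t) ((w - b') *m Ai) by exists s.
by exists r; rewrite E -Hl'.
Qed.

Lemma row2E (a b : R) : row2 a b 0 0 = a /\ row2 a b 0 1 = b.
Proof. by rewrite /row2 !mxE. Qed.

Lemma ord2P (P : 'I_2 -> Prop) : P 0 -> P 1 -> forall i, P i.
Proof.
move=> P0 P1 [[|[|//]] Hi].
  by rewrite (_ : Ordinal Hi = 0)//; exact: val_inj.
by rewrite (_ : Ordinal Hi = 1)//; exact: val_inj.
Qed.

Lemma row2_eq (T : Type) (x y : 'rV[T]_2) : x 0 0 = y 0 0 -> x 0 1 = y 0 1 -> x = y.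
Proof.
by move=> h0 h1; apply/rowP; exact: ord2P.
Qed.

Lemma sum2 (F : 'I_2 -> R) : \sum_(j < 2) F j = F 0 + F 1.
Proof. by rewrite !big_ord_recl big_ord0 addr0; congr (F _ + F _); exact: val_inj. Qed.

Lemma mulmx2 (x : 'rV[R]_2) (A : 'M[R]_2) j : (x *m A) 0 j = x 0 0 * A 0 j + x 0 1 * A 1 j.
Proof. by rewrite mxE sum2. Qed.

Lemma cylinder_latticeP (alpha ell : R) (x y : 'rV[R]_2) :
  lattice_rel (cylinder_lattice alpha ell) x y <->
  exists k m : int, y 0 0 = x 0 0 + k%:~R * beta R + m%:~R * alpha /\
                    y 0 1 = x 0 1 + m%:~R * ell.
Proof.
have C0 j : cylinder_lattice alpha ell 0 j = row2 (beta R) 0 0 j.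
  by have := col_mxEu (row2 (beta R) 0) (row2 alpha ell) 0 j;
    rewrite (_ : lshift 1 0 = 0)//; exact: val_inj.
have C1 j : cylinder_lattice alpha ell 1 j = row2 alpha ell 0 j.
  by have := col_mxEd (row2 (beta R) 0) (row2 alpha ell) 0 j;
    rewrite (_ : rshift 1 0 = 1)//; exact: val_inj.
have [b0 b1] := row2E (beta R) 0; have [a0 a1] := row2E alpha ell.
split=> [[z ->]|[k [m [h0 h1]]]].
  exists (z 0 0), (z 0 1); rewrite ![(x + _) 0 _]mxE !mulmx2 !C0 !C1 b0 b1 a0 a1 !mxE.
  by rewrite mulr0 add0r addrA.
exists (\row_j (if j == 0 then k else m)).
apply: row2_eq; rewrite [(x + _) 0 _]mxE mulmx2 !C0 !C1 ?b0 ?b1 ?a0 ?a1 !mxE /=.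
  by rewrite h0 addrA.
by rewrite h1 mulr0 add0r.
Qed.

Lemma lattice_rel_block n (B : 'M[R]_n) (b : R) (x y : 'rV[R]_(n + 1)) :
  lattice_rel (block_mx B 0 0 (b%:M : 'M[R]_1)) x y <->
  lattice_rel B (lsubmx x) (lsubmx y) /\
  exists m : int, rsubmx y 0 0 = rsubmx x 0 0 + m%:~R * b.
Proof.
split=> [[z ->]|[[z hz] [m hm]]].
  rewrite -(hsubmxK z) map_row_mx mul_row_block !mulmx0 addr0 add0r !linearD /=.
  rewrite row_mxKl row_mxKr; split; first by exists (lsubmx z).
  exists (rsubmx z 0 0); rewrite [LHS]mxE; congr (_ + _).
  by rewrite mul_mx_scalar mxE mulrC; congr (_ * _); rewrite mxE.
exists (row_mx z m%:M); rewrite map_row_mx mul_row_block !mulmx0 addr0 add0r.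
rewrite -(hsubmxK y) hz -{2}(hsubmxK x) add_row_mx; congr row_mx.
apply/rowP => j; rewrite (ord1 j) hm mul_mx_scalar !mxE eqxx /= mulr1n mulrC.
by [].
Qed.

Lemma marked_homothety_product lam (B B' : 'M[R]_2) (c c' : R -> 'rV[R]_2) (b2 : R) :
  marked_homothety lam B c B' c' ->
  marked_homothety lam
    (block_mx B 0 0 ((b2 / lam)%:M : 'M[R]_1)) (fun t => row_mx (c t) (0 : 'rV[R]_1))
    (block_mx B' 0 0 (b2%:M : 'M[R]_1)) (fun t => row_mx (c' t) (0 : 'rV[R]_1)).
Proof.
move=> [lam0 [A [b [AA Hl Hc]]]]; split=> //.
have l0 : lam != 0 by rewrite gt_eqF.
exists (block_mx A 0 0 (lam%:M : 'M[R]_1)), (row_mx b (0 : 'rV[R]_1)).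
have E (x : 'rV[R]_(2 + 1)) : x *m block_mx A 0 0 (lam%:M : 'M[R]_1) + row_mx b (0 : 'rV[R]_1)
   = row_mx (lsubmx x *m A + b) (lam *: rsubmx x).
  by rewrite -{1}(hsubmxK x) mul_row_block !mulmx0 addr0 add0r add_row_mx addr0 mul_mx_scalar.
have S (u v : R) : (exists m : int, v = u + m%:~R * (b2 / lam)) <->
    (exists m : int, lam * v = lam * u + m%:~R * b2).
  split=> -[m h]; exists m; first by rewrite h mulrDr; congr (_ + _); field.
  by apply: (mulfI l0); rewrite h mulrDr; congr (_ + _); field.
split.
- rewrite tr_block_mx !trmx0 tr_scalar_mx mulmx_block !mulmx0 !mul0mx !addr0 add0r AA.
  rewrite -scalar_mxM -expr2.
  exact/esym/scalar_mx_block.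
- move=> x y; rewrite !E !lattice_rel_block !row_mxKl !row_mxKr Hl.
  have -> u : (lam *: rsubmx u : 'rV[R]_1) 0 0 = lam * rsubmx u 0 0 by rewrite mxE.
  have -> u : (lam *: rsubmx u : 'rV[R]_1) 0 0 = lam * rsubmx u 0 0 by rewrite mxE.
  by rewrite S.
move=> w; split=> -[t]; rewrite ?E !lattice_rel_block ?row_mxKl ?row_mxKr.
  rewrite scaler0 => -[h1 h2].
  by have /Hc [s hs] : exists t, lattice_rel B' (c t *m A + b) (lsubmx w); [exists t|exists s; rewrite lattice_rel_block row_mxKl row_mxKr].
move=> [h1 h2].
have /Hc [s hs] : exists t, lattice_rel B' (c' t) (lsubmx w) by exists t.
by exists s; rewrite E lattice_rel_block row_mxKl row_mxKr row_mxKl row_mxKr scaler0.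
Qed.

Lemma unit_basis_completion (z : 'rV[int]_2) : coprimez (z 0 0) (z 0 1) ->
  exists a b : int, a * z 0 0 + b * z 0 1 = 1.
Proof. by move=> /coprimezP[[a b] /= h]; exists a, b. Qed.

(** If the coordinates of the closing vector had a common divisor [d > 1], the geodesic would be
    back at its base point at time [1 / d], against injectivity on [[0, 1)]. *)
Lemma geodesic_primitive (B : 'M[R]_2) (p v : 'rV[R]_2) :
  simple_closed_geodesic B p v ->
  exists z : 'rV[int]_2, v = map_mx intr z *m B /\ coprimez (z 0 0) (z 0 1).
Proof.
move=> [v0 [z hz] inj]; exists z.
have vE : v = map_mx intr z *m B.
  by move: hz; rewrite /line scale0r addr0 scale1r => /addrI.
split=> //; pose d := gcdz (z 0 0) (z 0 1).
have [d1|dn1] := eqVneq d 1; first by rewrite /coprimez -/d d1.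
have d0 : d != 0.
  apply: contraNneq v0 => d0; have /eqP := d0; rewrite /d gcdz_eq0 => /andP[/eqP z0 /eqP z1].
  have zE : z = 0 by apply: row2_eq; rewrite ?z0 ?z1 mxE.
  by rewrite vE zE map_mx0 mul0mx.
have dge : 0 <= d by [].
have dg2 : (1 : R) < d%:~R by rewrite ltr1z lt_neqAle eq_sym dn1 -gtz0_ge1 lt_neqAle eq_sym d0.
have dp : (0 : R) < d%:~R by rewrite (lt_trans ltr01).
have /divzK e0 : (d %| (z 0%R 0%R))%Z by exact: dvdz_gcdl.
have /divzK e1 : (d %| (z 0%R 1%R))%Z by exact: dvdz_gcdr.
have : (0 : R) = (d%:~R)^-1.
  apply: inj; rewrite ?lexx ?ltr01//; first by rewrite invr_ge0 ltW//= invf_lt1.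
  exists (\row_j (z 0%R j %/ d)%Z).
  rewrite /line scale0r addr0; congr (_ + _); rewrite vE scalemxAl; congr (_ *m _).
  have zd j : (z 0%R j %/ d)%Z * d = z 0 j.
    by move: j; apply: ord2P; [exact: e0|exact: e1].
  apply/rowP => j; rewrite !mxE -{1}(zd j) intrM mulrCA mulVf ?mulr1//.
  by rewrite gt_eqF.
by move/eqP; rewrite eq_sym invr_eq0 gt_eqF.
Qed.

(** The closing vector is completed to a lattice basis. The similarity that sends the theta-period
    to it has a second lattice vector as image of [(alpha, ell)], which defines these two
    numbers. *)
Lemma marked_homothety_exists (B : 'M[R]_2) (p v : 'rV[R]_2) :
  simple_closed_geodesic B p v ->
  exists lam alpha ell : R,
    marked_homothety lam (cylinder_lattice alpha ell) (fun theta => row2 theta 0) B (line p v).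
Proof.
move=> scg; have [v0 _ _] := scg.
have [z [vE /unit_basis_completion[a [b ab1]]]] := geodesic_primitive scg.
pose n2 := v 0 0 ^+ 2 + v 0 1 ^+ 2.
have n20 : 0 < n2.
  rewrite lt_neqAle eq_sym addr_ge0 ?sqr_ge0// andbT; apply: contraNneq v0.
  move/eqP; rewrite paddr_eq0 ?sqr_ge0// !sqrf_eq0 => /andP[/eqP h0 /eqP h1].
  by apply/eqP/row2_eq; rewrite ?h0 ?h1 mxE.
have b0 := beta_gt0 R; have b0' : beta R != 0 by rewrite gt_eqF.
(* The Bezout coefficients make the determinant of [z], [w] equal to 1. *)
pose w : 'rV[int]_2 := \row_j (if j == 0 then - b else a).
have [v2 v2E] : exists v2 : 'rV[R]_2, v2 = map_mx intr w *m B by eexists.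
pose lam := Num.sqrt n2 / beta R.
have lam0 : 0 < lam by rewrite divr_gt0// sqrtr_gt0.
have lam2 : lam ^+ 2 = n2 / beta R ^+ 2 by rewrite expr_div_n sqr_sqrtr// ltW.
have n20' : n2 != 0 by rewrite gt_eqF.
(* The components of [v2] along [v] and along [v] turned by a right angle, divided by the ratio
   [lam]. *)
pose alpha := (v2 0 0 * v 0 0 + v2 0 1 * v 0 1) * beta R / n2.
pose ell := (v2 0 1 * v 0 0 - v2 0 0 * v 0 1) * beta R / n2.
pose A : 'M[R]_2 := \matrix_(i, j) (if i == 0 then v 0 j / beta R
   else (if j == 0 then - v 0 1 / beta R else v 0 0 / beta R)).
exists lam, alpha, ell; split=> //; exists A, p.
have A00 : A 0 0 = v 0 0 / beta R by rewrite mxE.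
have A01 : A 0 1 = v 0 1 / beta R by rewrite mxE.
have A10 : A 1 0 = - v 0 1 / beta R by rewrite mxE.
have A11 : A 1 1 = v 0 0 / beta R by rewrite mxE.
have EA (x : 'rV[R]_2) (k m : R) : x 0 0 = k * beta R + m * alpha -> x 0 1 = m * ell ->
    x *m A = k *: v + m *: v2.
  move=> h0 h1; apply: row2_eq; rewrite mulmx2 h0 h1 ?A00 ?A01 ?A10 ?A11 !mxE /alpha /ell /n2;
    field; rewrite -/n2 n20' b0'; done.
have AAT : A *m A^T = (lam ^+ 2)%:M.
  apply/matrixP; apply: ord2P; apply: ord2P; rewrite !mxE sum2 ![A^T _ _]mxE ?A00 ?A01 ?A10 ?A11 lam2 /=;
  rewrite ?mulr1n ?mulr0n; by rewrite /n2; field.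
split=> //.
- move=> x y; rewrite cylinder_latticeP; split.
    move=> [k [m [h0 h1]]]; exists (k *: z + m *: w).
    have : (y - x) *m A = k%:~R *: v + m%:~R *: v2.
      by apply: EA; rewrite mxE [(- x) _ _]mxE ?h0 ?h1; ring.
    rewrite mulmxBl => /eqP; rewrite subr_eq => /eqP ->.
    rewrite map_mxD mulmxDl vE v2E.
    have -> (c : int) (u : 'rV[int]_2) : map_mx intr (c *: u) *m B = c%:~R *: (map_mx intr u *m B).
      by rewrite scalemxAl; congr (_ *m _); apply/rowP => j; rewrite !mxE intrM.
    have -> (c : int) (u : 'rV[int]_2) : map_mx intr (c *: u) *m B = c%:~R *: (map_mx intr u *m B).
      by rewrite scalemxAl; congr (_ *m _); apply/rowP => j; rewrite !mxE intrM.
    by rewrite addrAC addrC addrA addrAC.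
  (* Cramer's rule for the coordinates of [n] in the basis [z], [w] of determinant 1. *)
  move=> [n hn]; pose k := n 0 0 * a + n 0 1 * b; pose m := z 0 0 * n 0 1 - z 0 1 * n 0 0.
  exists k, m.
  have AA : A *m ((beta R ^+ 2 / n2) *: A^T) = 1%:M.
    by rewrite -scalemxAr AAT lam2 scale_scalar_mx; congr _%:M; field; rewrite n20' b0'.
  have hyx : (y - x) *m A = map_mx intr n *m B.
    by rewrite mulmxBl; move: hn; rewrite addrAC => /addIr ->; rewrite addrAC subrr add0r.
  have nE : map_mx intr n = k%:~R *: map_mx intr z + m%:~R *: map_mx intr w :> 'rV[R]_2.
    have h0 : n 0 0 = k * z 0 0 + m * w 0 0.
      rewrite /w mxE /= /k /m -[LHS]mulr1 -ab1; ring.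
    have h1 : n 0 1 = k * z 0 1 + m * w 0 1.
      rewrite /w mxE /= /k /m -[LHS]mulr1 -ab1; ring.
    by apply: row2_eq; rewrite !mxE; [rewrite h0|rewrite h1]; rewrite /w !mxE /= intrD !intrM.
  pose u := row2 (k%:~R * beta R + m%:~R * alpha) (m%:~R * ell).
  have uE : u *m A = (y - x) *m A.
    rewrite hyx nE mulmxDl -!scalemxAl -vE -v2E; apply: EA; by rewrite mxE.
  have : y - x = u.
    by rewrite -[y - x]mulmx1 -AA mulmxA -uE -mulmxA AA mulmx1.
  move=> yx; have [u0 u1] := row2E (k%:~R * beta R + m%:~R * alpha) (m%:~R * ell).
  have E j : y 0 j = x 0 j + u 0 j by rewrite -yx !mxE; ring.
  by rewrite !E u0 u1 addrA.
move=> q; have cE t : row2 t 0 *m A + p = line p v (t / beta R).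
  have [r0 r1] := row2E t 0.
  by rewrite /line addrC; congr (_ + _); apply: row2_eq; rewrite mulmx2 r0 r1 ?A00 ?A01 ?A10 ?A11 !mxE; field.
split=> -[t h]; first by exists (t / beta R); rewrite -cE.
by exists (t * beta R); rewrite cE mulfK.
Qed.

End Homotheties.

Section AffineMaps.
Variable R : realType.

Lemma smooth_affine n m (A : 'M[R]_(n, m)) (b : 'rV[R]_m) :
  smooth_on setT (fun u : 'rV[R]_n => u *m A + b).
Proof.
have oT := @openT 'rV[R]_n.
apply/smooth_mx => // i j; apply/smooth_onP => k.
apply: (@Ck_congr _ _ _ _ _ (fun u : 'rV[R]_n => \sum_l (u 0 l * A l j) + b 0 j)) => //.
  by move=> u _; rewrite (ord1 i) !mxE.
apply: CkD => //; last exact: Ck_cst.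
apply: Ck_sum => // l; apply: CkM => //; [exact: Ck_coord|exact: Ck_cst].
Qed.

Lemma jacobian_affine n m (A : 'M[R]_(n, m)) (b : 'rV[R]_m) u :
  'J (fun u : 'rV[R]_n => u *m A + b) u = A.
Proof.
have df : differentiable (fun u : 'rV[R]_n => u *m A + b) u.
  exact: (smooth_row_differentiable (@openT 'rV[R]_n) (smooth_affine A b)).
apply: mulmx_eq_row => v; rewrite -deriveEjacobian//.
apply/rowP => j; rewrite derive_row; last exact: diff_derivable.
suff [_ ->] : is_derive u v (fun u : 'rV[R]_n => (u *m A + b) 0 j) ((v *m A) 0 j) by [].
have -> : (fun u : 'rV[R]_n => (u *m A + b) 0 j) =
    (fun u : 'rV[R]_n => (\sum_l (fun (i : 'I_n) (u : 'rV[R]_n) => u 0 i * A i j) l) u + b 0 j).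
  by apply/funext => w; rewrite !mxE fct_sumE.
rewrite mxE; derive_with ltac:(rewrite addr0; reflexivity).
apply: is_derive_sum => l.
by derive_with ltac:(rewrite mulr0 addr0 mulrC).
Qed.

Lemma pullback_affine n m (A : 'M[R]_(n, m)) (b : 'rV[R]_m) g u :
  pullback (fun u : 'rV[R]_n => u *m A + b) g u = A *m g (u *m A + b) *m A^T.
Proof. by rewrite /pullback jacobian_affine. Qed.

End AffineMaps.

(** * The flat torus at infinity *)

Section ConformalInfinity.
Variable R : realType.
Variables alpha l L : R.
Hypotheses (l0 : l != 0) (L0 : L != 0).
Local Notation k := (theta_radius R).

(** The inverse screw motion at infinity, in coordinates (theta, s1, s2): the angle is taken from
    [theta - (alpha / l) s1], so the period [(alpha, l)] becomes a unit translation. *)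
Definition boundary_map (w : 'rV[R]_3) : 'rV[R]_4 :=
  row4 (cos ((w 0 0 - alpha / l * w 0 1) * k^-1)) (sin ((w 0 0 - alpha / l * w 0 1) * k^-1))
    (w 0 1 * l^-1) (w 0 2 * L^-1).

Lemma smooth_boundary_map : smooth_on setT boundary_map.
Proof.
have oT := @openT 'rV[R]_3.
by rewrite /boundary_map; apply: (smooth_row4 oT); smooth_rules.
Qed.

Lemma boundary_mapP w : disc_boundary (boundary_map w).
Proof. by rewrite /disc_boundary /= /disc_norm2 !row4s cos2Dsin2. Qed.

Definition period_lattice : 'M[R]_3 :=
  block_mx (cylinder_lattice alpha l) 0 0 (L%:M : 'M[R]_1).

Lemma period_latticeP (x y : 'rV[R]_3) : lattice_rel period_lattice x y <->
  exists a m n : int, [/\ y 0 0 = x 0 0 + a%:~R * beta R + m%:~R * alpha,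
    y 0 1 = x 0 1 + m%:~R * l & y 0 2 = x 0 2 + n%:~R * L].
Proof.
have e0 (u : 'rV[R]_3) : (lsubmx (u : 'rV[R]_(2 + 1))) 0 0 = u 0 0.
  by rewrite mxE; congr (u 0 _); exact: val_inj.
have e1 (u : 'rV[R]_3) : (lsubmx (u : 'rV[R]_(2 + 1))) 0 1 = u 0 1.
  by rewrite mxE; congr (u 0 _); exact: val_inj.
have e2 (u : 'rV[R]_3) : (rsubmx (u : 'rV[R]_(2 + 1))) 0 0 = u 0 2.
  by rewrite mxE; congr (u 0 _); exact: val_inj.
rewrite (@lattice_rel_block R 2 _ L x y) cylinder_latticeP !e0 !e1 !e2.
split=> [[[a [m [h0 h1]]] [n h2]]|[a [m [n [h0 h1 h2]]]]]; first by exists a, m, n.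
by split; [exists a, m|exists n].
Qed.

Lemma boundary_map_lattice (x y : 'rV[R]_3) :
  lattice_rel period_lattice x y <-> torus_rel (boundary_map x) (boundary_map y).
Proof.
have k0 := theta_radius_neq0 R; rewrite period_latticeP torus_relE /boundary_map !row4s.
split=> [[a [m [n [h0 h1 h2]]]]|[c s [m h1] [n h2]]].
  have [ca sa] := cos_sin_int ((x 0 0 - alpha / l * x 0 1) * k^-1) a.
  have -> : (y 0 0 - alpha / l * y 0 1) * k^-1 =
      (x 0 0 - alpha / l * x 0 1) * k^-1 + a%:~R * (2 * pi).
    by rewrite h0 h1 betaE; field; rewrite k0 l0.
  rewrite ca sa h1 h2; split=> //; [exists m|exists n]; by field.
have [a ha] := cos_sin_eqP c s; exists a, m, n.
have h1' : y 0 1 = x 0 1 + m%:~R * l.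
  by rewrite -[LHS](divfK l0) h1; field.
split=> //; last by rewrite -[LHS](divfK L0) h2; field.
have : y 0 0 - alpha / l * y 0 1 = x 0 0 - alpha / l * x 0 1 + a%:~R * (2 * pi) * k.
  by rewrite -[LHS](mulfK (invr_neq0 k0)) ha; field; rewrite k0 l0.
move/eqP; rewrite subr_eq => /eqP ->; rewrite h1' betaE; field.
by rewrite l0.
Qed.

Lemma boundary_map_onto y : disc_boundary y -> exists w, boundary_map w = y.
Proof.
move=> /unit_circle_angle[t [c s]]; have k0 := theta_radius_neq0 R.
exists (\row_j [:: k * t + alpha * y 0 2; l * y 0 2; L * y 0 3]`_j).
rewrite [RHS]row4_eta c s /boundary_map !mxE /=; congr row4.
- by congr cos; field; rewrite k0 l0.
- by congr sin; field; rewrite k0 l0.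
- by field.
- by field.
Qed.

Lemma sum3 (F : 'I_3 -> R) : \sum_(j < 3) F j = F 0 + F 1 + F 2.
Proof.
rewrite !big_ord_recl big_ord0 addr0 addrA.
by congr (F _ + F _ + F _); exact: val_inj.
Qed.

Lemma pullback_boundary_map w : pullback boundary_map
  (twisted_metric (@bdryA R) (@bdryB R) (@bdryC R) (alpha / k) l L) w = 1%:M.
Proof.
have k0 := theta_radius_neq0 R.
apply: symmetric_form_eq; [exact/pullback_sym/twisted_metric_sym|exact: tr_scalar_mx|move=> v].
rewrite pullback_form; last exact: (smooth_row_differentiable openT smooth_boundary_map).
pose phi := (w 0 0 - alpha / l * w 0 1) * k^-1.
pose dphi := (v 0 0 - alpha / l * v 0 1) * k^-1.
have dp : is_derive w v (fun w : 'rV[R]_3 => (w 0 0 - alpha / l * w 0 1) * k^-1) dphi.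
  by derive_with ltac:(rewrite /dphi; ring).
have d0 := is_derive_cos_comp dp; have d1 := is_derive_sin_comp dp.
have d2 : is_derive w v (fun w : 'rV[R]_3 => w 0 1 * l^-1) (v 0 1 * l^-1).
  by derive_with ltac:(ring).
have d3 : is_derive w v (fun w : 'rV[R]_3 => w 0 2 * L^-1) (v 0 2 * L^-1).
  by derive_with ltac:(ring).
have [_ ->] := is_derive_row4 d0 d1 d2 d3.
rewrite twisted_metricE boundary_mapP /twisted_form /boundary_map !row4s -/phi.
have -> : bdryC 1 = 1 :> R by rewrite /bdryC /bdry_radius; ring.
have -> : bdryA 1 = k ^+ 2 :> R.
  have r1 : bdry_radius 1 = 1 :> R by rewrite /bdry_radius; ring.
  by rewrite /bdryA /bdry_numer r1; field.
rewrite mulmx1 mxE sum3 ![v^T _ _]mxE.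
have cs1 := cos2Dsin2 phi; move: (cos phi) (sin phi) cs1 => c s cs1.
set T0 := (X in X * X + _); set T1 := (X in _ + X * X).
(* The twist of the metric adds [(alpha / k) v1 / l] to the angular velocity and thereby cancels the
   shear of [boundary_map]. *)
have -> : T0 = - s * (v 0 0 / k) by rewrite /T0 /dphi; field; rewrite k0 l0.
have -> : T1 = c * (v 0 0 / k) by rewrite /T1 /dphi; field; rewrite k0 l0.
have -> : k ^+ 2 * (- s * (v 0 0 / k) * (- s * (v 0 0 / k)) + c * (v 0 0 / k) * (c * (v 0 0 / k)))
   = (c ^+ 2 + s ^+ 2) * (v 0 0 * v 0 0) by field.
by rewrite cs1; field; rewrite l0 L0.
Qed.

End ConformalInfinity.

Section FillingInfinity.
Variable R : realType.

(** With [l = 0] all vectors of the cylinder lattice would lie on one line, whereas the lattice of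
    [B] spans the plane. *)
Lemma marked_homothety_pitch lam alpha l (B : 'M[R]_2) c c' : B \in unitmx ->
  marked_homothety lam (cylinder_lattice alpha l) c B c' -> l != 0.
Proof.
move=> uB [lam0 [A [b [AA Hl _]]]]; apply/eqP => l0.
have [AAi AiA] := scalar_inverse lam0 AA; set Ai := _ *: _ in AAi AiA.
have K (i : 'I_2) : (B *m Ai) i 1 = 0.
  have /Hl/cylinder_latticeP[_ [m [_]]] : lattice_rel B (0 *m A + b) (row i (B *m Ai) *m A + b).
    exists (delta_mx 0 i); rewrite mul0mx add0r addrC; congr (_ + _).
    by rewrite -row_mul -mulmxA AiA mulmx1 rowE; congr (_ *m _); apply/rowP => j; rewrite !mxE; case: (_ && _).
  by rewrite l0 mulr0 addr0 !mxE.
have : B *m Ai \in unitmx.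
  by rewrite unitmx_mul uB /=; have [] := mulmx1_unit AAi.
have := K; move: (B *m Ai) => M K' /mulmxV/mulmx1C /matrixP/(_ 1 1).
by rewrite !mxE sum2 !K' !mulr0 addr0 eqxx => /eqP; rewrite eq_sym oner_eq0.
Qed.

Lemma filling_conformal_infinity (D : filling_data R) (lam alpha l : R) :
  marked_homothety lam (cylinder_lattice alpha l) (fun theta => row2 theta 0)
    (fd_lattice D) (fd_sigma D) ->
  has_conformal_infinity (filling_metric alpha l (fd_beta2 D / lam)) (product_lattice D).
Proof.
move=> mh; have l0 := marked_homothety_pitch (fd_lattice_unit D) mh.
have lam0 := mh.1.
have L0 : fd_beta2 D / lam != 0 by rewrite gt_eqF// divr_gt0// fd_beta2_gt0.
have [lami0 [A [b [AA Hl _]]]] := marked_homothety_sym (marked_homothety_product (fd_beta2 D) mh).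
have [AAi AiA] := scalar_inverse lami0 AA.
have oT := @openT 'rV[R]_3.
have sb := smooth_boundary_map alpha l (fd_beta2 D / lam).
have sa := @smooth_affine R 3 3 A b.
eexists _, _, _; split; first exact: (filling_compactification (alpha / theta_radius R) l0 L0).
exists (fun u => boundary_map alpha l (fd_beta2 D / lam) (u *m A + b)); split.
  by apply: (@smooth_comp R 3 3 1 4 setT setT (fun u : 'rV[R]_3 => u *m A + b)).
split; first by move=> u; exact: boundary_mapP.
split; first by move=> u v; rewrite /product_lattice Hl -boundary_map_lattice.
split.
  move=> y /(boundary_map_onto alpha l0 L0)[w <-].
  by exists ((w - b) *m ((lam^-1 ^+ 2)^-1 *: A^T)); rewrite affine_inverse//; exact: torus_rel_refl.
move=> u; exists (lam^-1 ^+ 2); first by rewrite exprn_gt0.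
rewrite (@pullback_comp R 3 3 4 (fun u => u *m A + b)).
- by rewrite pullback_affine pullback_boundary_map// mulmx1 AA.
- exact: (smooth_row_differentiable oT sa).
- exact: (smooth_row_differentiable oT sb).
Qed.

Lemma filling_exists (D : filling_data R) : exists g : 'rV[R]_4 -> 'M[R]_4,
  [/\ associated D g, complete_AH_einstein g & has_conformal_infinity g (product_lattice D)].
Proof.
have [lam [alpha [l mh]]] := marked_homothety_exists (fd_geodesic D).
have l0 := marked_homothety_pitch (fd_lattice_unit D) mh.
have L0 : fd_beta2 D / lam != 0 by rewrite gt_eqF// divr_gt0// ?fd_beta2_gt0//; exact: mh.1.
exists (filling_metric alpha l (fd_beta2 D / lam)); split.
- exists (@core_metric R), alpha, l, lam, (screw (alpha / theta_radius R) l (fd_beta2 D / lam)).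
  split=> //; [exact: core_metric_is_g1|exact: screw_quotient_diffeo|].
  by move=> x; rewrite pullback_screw.
- split; [exact: filling_metric_R2T2|exact: filling_complete|exact: filling_einstein|].
  by eexists _, _, _; exact: (filling_compactification (alpha / theta_radius R) l0 L0).
- exact: filling_conformal_infinity.
Qed.

End FillingInfinity.

(** * Deck transformations and isometries *)

Section DeckGroup.
Variable R : realType.
Local Notation k := (theta_radius R).
Local Notation G := (@core_metric R).

(** If two values differed, the intermediate value theorem on the segment between the points would
    produce a value half an integer above the smaller one; doubling contradicts parity. *)
Lemma integer_valued_const n (r : 'rV[R]_n -> R) : continuous r ->
  (forall x, exists m : int, r x = m%:~R) -> forall x y, r x = r y.
Proof.
move=> cr ir x y; apply/eqP/negPn/negP => rxy.
pose f (t : R) := r (x + t *: (y - x)).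
have f0 : f 0 = r x by rewrite /f scale0r addr0.
have f1 : f 1 = r y by rewrite /f scale1r addrC subrK.
have cf : continuous f.
  move=> t; apply: (@continuous_comp _ _ _ (fun t : R => x + t *: (y - x)) r); last exact: cr.
  have di : derivable (id : 'rV[R]_n -> _) (x + t *: (y - x)) (y - x) by exact: derivable_id.
  by apply: differentiable_continuous; apply/derivable1_diffP; have [] := is_derive_line di.
have [m mx] := ir x; have [m' my] := ir y.
have mm' : m != m' by move: rxy; rewrite mx my eqr_int.
have [c _] : exists2 c, c \in `[0, 1]%R & f c = (Num.min m m')%:~R + 2^-1.
  apply: IVT; [exact: ler01|exact: continuous_subspaceT|].
  rewrite f0 f1 mx my ge_min le_max.
  have H (i j : int) : i < j -> i%:~R + 2^-1 <= j%:~R :> R.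
    by rewrite -lezD1 -(ler_int R) intrD; lra.
  by case: (ltgtP m m') mm' => // /H h _; apply/andP; split; apply/orP; [left|right|right|left]; lra.
have [j jE] := ir (x + c *: (y - x)); rewrite /f jE => h.
have : (2 * j)%:~R = (2 * Num.min m m' + 1)%:~R :> R.
  have -> : (2 * j)%:~R = 2 * j%:~R :> R by rewrite intrM.
  have -> : (2 * Num.min m m' + 1)%:~R = 2 * (Num.min m m')%:~R + 1 :> R by rewrite intrD intrM.
  by rewrite h; field.
by move/eqP; rewrite eqr_int ![2 * _]mulrC => /eqP/(congr1 (modz^~ 2)); rewrite modzMl modzMDl.
Qed.

Lemma shift_shift (a b c a' b' c' : R) x :
  @Defs.shift R a b c (@Defs.shift R a' b' c' x) = @Defs.shift R (a + a') (b + b') (c + c') x.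
Proof.
rewrite !shiftE !row4s mulrDl cosD sinD; congr row4; ring.
Qed.

Lemma shift0 x : @Defs.shift R 0 0 0 x = x.
Proof. by rewrite shiftE mul0r cos0 sin0 [RHS]row4_eta; congr row4; ring. Qed.

Lemma smooth_shift (a b c : R) : smooth_on setT (@Defs.shift R a b c).
Proof.
have oT := @openT 'rV[R]_4.
by rewrite /Defs.shift; apply: (smooth_row4 oT); smooth_rules.
Qed.

Lemma derive_shift (a b c : R) (x v : 'rV[R]_4) :
  'D_v (@Defs.shift R a b c) x = @Defs.shift R a 0 0 v.
Proof.
have d0 : is_derive x v (fun y : 'rV[R]_4 => cos (2 * pi * a / beta R) * y 0 0
    - sin (2 * pi * a / beta R) * y 0 1) (cos (a / k) * v 0 0 - sin (a / k) * v 0 1).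
  by rewrite angleE; derive_with ltac:(ring).
have d1 : is_derive x v (fun y : 'rV[R]_4 => sin (2 * pi * a / beta R) * y 0 0
    + cos (2 * pi * a / beta R) * y 0 1) (sin (a / k) * v 0 0 + cos (a / k) * v 0 1).
  by rewrite angleE; derive_with ltac:(ring).
have d2 : is_derive x v (fun y : 'rV[R]_4 => y 0 2 + b) (v 0 2) by derive_with ltac:(ring).
have d3 : is_derive x v (fun y : 'rV[R]_4 => y 0 3 + c) (v 0 3) by derive_with ltac:(ring).
by have [_ ->] := is_derive_row4 d0 d1 d2 d3; rewrite shiftE !addr0.
Qed.

Lemma pullback_shift (a b c : R) x : pullback (@Defs.shift R a b c) G x = G x.
Proof.
apply: symmetric_form_eq.
- by apply: pullback_sym; exact: twisted_metric_sym.
- exact: twisted_metric_sym.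
move=> v; rewrite pullback_form; last exact: (smooth_row_differentiable openT (smooth_shift _ _ _)).
rewrite !twisted_metricE derive_shift.
have cs1 := cos2Dsin2 (a / k).
have -> : disc_norm2 (@Defs.shift R a b c x) = disc_norm2 x.
  rewrite /disc_norm2 shiftE !row4s -[RHS]mul1r -cs1; ring.
rewrite /twisted_form !shiftE !row4s.
move: (cos _) (sin _) cs1 => u w cs1.
rewrite !mul0r !subr0 !addr0 !expr1n !mul1r.
have -> : (u * v 0 0 - w * v 0 1) * (u * v 0 0 - w * v 0 1)
    + (w * v 0 0 + u * v 0 1) * (w * v 0 0 + u * v 0 1)
  = v 0 0 * v 0 0 + v 0 1 * v 0 1 by rewrite -[RHS]mul1r -cs1; ring.
have -> : (u * x 0 0 - w * x 0 1) * (u * v 0 0 - w * v 0 1) +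
   (w * x 0 0 + u * x 0 1) * (w * v 0 0 + u * v 0 1) = x 0 0 * v 0 0 + x 0 1 * v 0 1.
  by rewrite -[RHS]mul1r -cs1; ring.
by [].
Qed.

Definition deck (alpha l L : R) (m n : int) : 'rV[R]_4 -> 'rV[R]_4 :=
  @Defs.shift R (m%:~R * alpha) (m%:~R * l) (n%:~R * L).

Lemma deck23 alpha l L m n x : deck alpha l L m n x 0 2 = x 0 2 + m%:~R * l /\
  deck alpha l L m n x 0 3 = x 0 3 + n%:~R * L.
Proof. by rewrite /deck shiftE !row4s. Qed.

Lemma deckD alpha l L m n m' n' x :
  deck alpha l L m n (deck alpha l L m' n' x) = deck alpha l L (m + m') (n + n') x.
Proof. by rewrite /deck shift_shift !intrD !mulrDl. Qed.

Lemma deck0 alpha l L x : deck alpha l L 0 0 x = x.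
Proof. by rewrite /deck !mul0r shift0. Qed.

Lemma action_rel_refl (alpha l L : R) x : action_rel alpha l L x x.
Proof. by exists 0, 0; exact/esym/deck0. Qed.

Lemma action_rel_trans (alpha l L : R) x y z : action_rel alpha l L x y ->
  action_rel alpha l L y z -> action_rel alpha l L x z.
Proof.
move=> [m [n ->]] [m' [n' ->]]; exists (m' + m), (n' + n).
by rewrite shift_shift !intrD !mulrDl.
Qed.

Lemma torus_rel_trans (x y z : 'rV[R]_4) : torus_rel x y -> torus_rel y z -> torus_rel x z.
Proof.
move=> /torus_relE[a0 a1 [m a2] [n a3]] /torus_relE[b0 b1 [m' b2] [n' b3]].
apply/torus_relE; split; rewrite ?b0 ?b1//; [exists (m + m')|exists (n + n')];
  by rewrite intrD addrA ?b2 ?b3 ?a2 ?a3.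
Qed.

(* The integers relating T x to F x depend continuously on x. *)
Lemma deck_constant alpha l L (F T : 'rV[R]_4 -> 'rV[R]_4) : l != 0 -> L != 0 ->
  continuous F -> continuous T -> (forall x, action_rel alpha l L (F x) (T x)) ->
  exists m n, forall x, T x = deck alpha l L m n (F x).
Proof.
move=> l0 L0 cF cT FT.
have cc (j : 'I_4) (c : R) : continuous (fun x => (T x 0 j - F x 0 j) / c).
  have cc : continuous (fun _ : 'rV[R]_4 => c^-1) by move=> x; exact: cst_continuous.
  have cT' : continuous (fun x => T x 0 j : R) by exact: continuous_entry.
  have cF' : continuous (fun x => F x 0 j : R) by exact: continuous_entry.
  by move=> x; exact: (cvgM (cvgB (cT' x) (cF' x)) (cc x)).
have E x : exists m n : int, [/\ T x = deck alpha l L m n (F x),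
    (T x 0 2 - F x 0 2) / l = m%:~R & (T x 0 3 - F x 0 3) / L = n%:~R].
  have [m [n h]] := FT x; exists m, n; rewrite h; split=> //.
    by have [-> _] := deck23 alpha l L m n (F x); rewrite addrC addKr mulfK.
  by have [_ ->] := deck23 alpha l L m n (F x); rewrite addrC addKr mulfK.
have [m [n [_ hm hn]]] := E 0; exists m, n => x.
have [m' [n' [hT hm' hn']]] := E x.
rewrite {1}hT.
have i2 y : exists m : int, (T y 0 2 - F y 0 2) / l = m%:~R.
  by have [a [b [_ h _]]] := E y; exists a.
have i3 y : exists m : int, (T y 0 3 - F y 0 3) / L = m%:~R.
  by have [a [b [_ _ h]]] := E y; exists b.
have e2 := integer_valued_const (cc 2 l) i2 0 x.
have e3 := integer_valued_const (cc 3 L) i3 0 x.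
have /eqP := etrans (esym hm) (etrans e2 hm'); rewrite eqr_int => /eqP ->.
by have /eqP := etrans (esym hn) (etrans e3 hn'); rewrite eqr_int => /eqP ->.
Qed.

End DeckGroup.

(** * Isometries between quotients of g1 *)

Section CoreIsometries.
Variable R : realType.
Local Notation G := (@core_metric R).
Local Notation M := ('rV[R]_4 -> 'rV[R]_4).
Implicit Types (E : 'rV[R]_4 -> 'rV[R]_4 -> Prop) (f h : M).

Lemma quotient_diffeo_trans E E' E'' f f' :
  (forall x y z, E x y -> E y z -> E x z) ->
  (forall x y z, E'' x y -> E'' y z -> E'' x z) ->
  quotient_diffeo setT E setT E' f -> quotient_diffeo setT E' setT E'' f' ->
  quotient_diffeo setT E setT E'' (fun x => f' (f x)).
Proof.
move=> tE tE'' [sf [_ [fE [h [sh [_ [hE [hf fh]]]]]]]] [sf' [_ [fE' [h' [sh' [_ [hE' [hf' fh']]]]]]]].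
have oT := @openT 'rV[R]_4.
split; first exact: (smooth_comp oT oT (fun _ _ => I) sf sf').
split; first by [].
split; first by move=> x y _ _ xy; exact: (fE' _ _ I I (fE _ _ I I xy)).
exists (fun x => h (h' x)); split; first exact: (smooth_comp oT oT (fun _ _ => I) sh' sh).
split; first by [].
split; first by move=> x y _ _ xy; exact: (hE _ _ I I (hE' _ _ I I xy)).
split=> x _.
  exact: (tE _ (h (f x)) _ (hE _ _ I I (hf' _ I)) (hf _ I)).
exact: (tE'' _ (f' (h' x)) _ (fE' _ _ I I (fh _ I)) (fh' _ I)).
Qed.

Lemma smooth_pullback_comp f h (g : 'rV[R]_4 -> 'M[R]_4) x :
  smooth_on setT f -> smooth_on setT h ->
  pullback (fun y => h (f y)) g x = pullback f (pullback h g) x.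
Proof.
move=> sf sh; apply: pullback_comp.
  exact: (smooth_row_differentiable (@openT 'rV[R]_4) sf).
exact: (smooth_row_differentiable (@openT 'rV[R]_4) sh).
Qed.

Definition core_isometry E E' f :=
  quotient_diffeo setT E setT E' f /\ forall x, pullback f G x = G x.

(** The inverse of [f] supplied by [quotient_diffeo] is an inverse only up to the action. The
    composite is a single deck transformation, which preserves [core_metric], so the inverse is
    isometric as well. *)
Lemma associated_inverse alpha l L f (g : 'rV[R]_4 -> 'M[R]_4) : l != 0 -> L != 0 ->
  quotient_diffeo setT (@torus_rel R) setT (action_rel alpha l L) f ->
  (forall x, g x = pullback f G x) ->
  exists2 h, quotient_diffeo setT (action_rel alpha l L) setT (@torus_rel R) h &
             forall x, pullback h g x = G x.
Proof.
move=> l0 L0 [sf [_ [fE [h [sh [_ [hE [hf fh]]]]]]]] gE; exists h.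
  by do 3! split=> //; exists f; do 4! split=> //.
have oT := @openT 'rV[R]_4.
have sfh : smooth_on setT (fun x => f (h x)) by exact: (smooth_comp oT oT (fun _ _ => I) sh sf).
move=> x.
have idE y : action_rel alpha l L (f (h y)) (id y) by exact: fh.
have [m [n H]] := deck_constant l0 L0 (smooth_continuous sfh) (fun=> cvg_id) idE.
have fhE : (fun x => f (h x)) = deck alpha l L (- m) (- n).
  by apply/funext => y; rewrite {2}[y]H deckD !addNr deck0.
rewrite (_ : g = pullback f G); last by apply/funext => y; exact: gE.
by rewrite -(smooth_pullback_comp _ x sh sf) fhE pullback_shift.
Qed.

End CoreIsometries.

(** * Homotheties of period lattices and the isometries that they induce *)

Section HolonomyCompatible.
Variable R : realType.
Local Notation k := (theta_radius R).
Local Notation G := (@core_metric R).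

(* The map diag(e, P) of (theta, s1, s2)-space sends the period lattice of the
   first action into that of the second one. *)
Definition holonomy_compatible (e : int) (P : 'M[R]_2) (alpha l L alpha' l' L' : R) : Prop :=
  forall m n : int, exists a m' n' : int,
    [/\ e%:~R * (m%:~R * alpha) = a%:~R * beta R + m'%:~R * alpha',
        m%:~R * l * P 0 0 + n%:~R * L * P 1 0 = m'%:~R * l' &
        m%:~R * l * P 0 1 + n%:~R * L * P 1 1 = n'%:~R * L'].

(** The theta-axis of (theta, s1, s2)-space; modulo the periods it is the meridian circle, of length
    [beta], that bounds a disc. *)
Definition core_line (t : R) : 'rV[R]_3 := row_mx (row2 t 0) (0 : 'rV[R]_1).

Lemma core_lineE t : [/\ core_line t 0 0 = t, core_line t 0 1 = 0 & core_line t 0 2 = 0].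
Proof.
have [r0 r1] := row2E t 0.
split.
- rewrite -[RHS]r0 -(row_mxEl (row2 t 0) (0 : 'rV[R]_1) 0 0); congr (row_mx _ _ 0 _); exact: val_inj.
- rewrite -[RHS]r1 -(row_mxEl (row2 t 0) (0 : 'rV[R]_1) 0 1); congr (row_mx _ _ 0 _); exact: val_inj.
- have h := row_mxEr (row2 t 0) (0 : 'rV[R]_1) 0 0; rewrite [RHS]mxE in h.
  by rewrite -[RHS]h; congr (row_mx _ _ 0 _); exact: val_inj.
Qed.

Lemma ord3P (P : 'I_3 -> Prop) : P 0 -> P 1 -> P 2 -> forall i, P i.
Proof.
move=> P0 P1 P2 [[|[|[|//]]] Hi].
- by rewrite (_ : Ordinal Hi = 0)//; exact: val_inj.
- by rewrite (_ : Ordinal Hi = 1)//; exact: val_inj.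
- by rewrite (_ : Ordinal Hi = 2)//; exact: val_inj.
Qed.

Lemma row3_eq (x y : 'rV[R]_3) : x 0 0 = y 0 0 -> x 0 1 = y 0 1 -> x 0 2 = y 0 2 -> x = y.
Proof. by move=> h0 h1 h2; apply/rowP; exact: ord3P. Qed.

Lemma affine3 (x b : 'rV[R]_3) (A : 'M[R]_3) j :
  (x *m A + b) 0 j = x 0 0 * A 0 j + x 0 1 * A 1 j + x 0 2 * A 2 j + b 0 j.
Proof. by rewrite mxE mxE sum3. Qed.

Lemma affine_integer_slope (a b c : R) : c != 0 ->
  (forall t, exists m : int, t * a + b = m%:~R * c) -> a = 0.
Proof.
move=> c0 H; pose r (u : 'rV[R]_1) := (u 0 0 * a + b) * c^-1.
have sr : smooth_on setT r by have oT := @openT 'rV[R]_1; rewrite /r; smooth_rules.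
have ir u : exists m : int, r u = m%:~R.
  by have [m h] := H (u 0 0); exists m; rewrite /r h mulfK.
have := integer_valued_const (smooth_continuous sr) ir (const_mx 1) 0.
by rewrite /r !mxE mul1r mul0r => /(mulIf (invr_neq0 c0))/addIr.
Qed.

(** Preservation of the theta-direction makes the linear part block diagonal. Since the
    theta-periods of both lattices are the multiples of the same [beta], the first block is a unit
    of the integers; hence the ratio is 1 and the second block is orthogonal. *)
Lemma core_line_homothety mu alpha l L alpha' l' L' : l != 0 -> L != 0 -> l' != 0 -> L' != 0 ->
  marked_homothety mu (period_lattice alpha l L) core_line
    (period_lattice alpha' l' L') core_line ->
  exists (e : int) (P : 'M[R]_2), [/\ e * e = 1, P *m P^T = 1%:M,
    holonomy_compatible e P alpha l L alpha' l' L' &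
    holonomy_compatible e P^T alpha' l' L' alpha l L].
Proof.
move=> l0 L0 l'0 L'0 [mu0 [A [b [AA Hl Hc]]]].
have b0 : beta R != 0 by rewrite gt_eqF// beta_gt0.
have AE (i j : 'I_3) : A i 0 * A j 0 + A i 1 * A j 1 + A i 2 * A j 2 = (mu ^+ 2) *+ (i == j).
  by have /matrixP/(_ i j) := AA; rewrite !mxE sum3 !mxE.
(* The image of the theta-axis lies in lattice translates of the theta-axis, so its s-coordinates,
   affine in [t], take values in a discrete set. *)
have [A01 A02] : A 0 1 = 0 /\ A 0 2 = 0.
  have H t : exists m n : int, t * A 0 1 + b 0 1 = m%:~R * l' /\ t * A 0 2 + b 0 2 = n%:~R * L'.
    have [] : exists s, lattice_rel (period_lattice alpha' l' L') (core_line s) (core_line t *m A + b).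
      apply/(Hc _).1; exists t; apply/period_latticeP; exists 0, 0, 0.
      by split; rewrite !mul0r !addr0.
    move=> s /period_latticeP[a [m [n []]]]; rewrite !affine3.
    have [-> -> ->] := core_lineE t; have [-> -> ->] := core_lineE s.
    by rewrite !mul0r !addr0 !add0r => _ h1 h2; exists m, n.
  split; [apply: (affine_integer_slope l'0) => t|apply: (affine_integer_slope L'0) => t].
    by have [m [n [h _]]] := H t; exists m; exact: h.
  by have [m [n [_ h]]] := H t; exists n; exact: h.
have A00mu : A 0 0 * A 0 0 = mu ^+ 2 by have := AE 0 0; rewrite A01 A02 !mulr0 !addr0.
have A00n0 : A 0 0 != 0.
  by apply: contraTneq mu0 => h; move/eqP: A00mu; rewrite h mulr0 eq_sym sqrf_eq0 => /eqP ->; rewrite ltxx.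
have A10 : A 1 0 = 0.
  by have /eqP := AE 0 1; rewrite A01 A02 !mul0r !addr0 mulr0n mulf_eq0 (negbTE A00n0) => /eqP.
have A20 : A 2 0 = 0.
  by have /eqP := AE 0 2; rewrite A01 A02 !mul0r !addr0 mulr0n mulf_eq0 (negbTE A00n0) => /eqP.
have lat z : lattice_rel (period_lattice alpha l L) 0 z <->
    lattice_rel (period_lattice alpha' l' L') b (z *m A + b).
  by rewrite Hl mul0mx add0r.
(* The image of the theta-period is a period without s-component, which forces an integer multiple
   of [beta]. *)
have [e eE] : exists e : int, A 0 0 = e%:~R.
  have : lattice_rel (period_lattice alpha l L) 0 (core_line (beta R)).
    apply/period_latticeP; exists 1, 0, 0; have [-> -> ->] := core_lineE (beta R).
    by rewrite !mxE; split; ring.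
  move=> /lat/period_latticeP[a [m [n []]]]; rewrite !affine3 A01 A02.
  have [-> -> ->] := core_lineE (beta R) => h0 h1 _.
  have m0 : m%:~R = 0 :> R.
    have /eqP : m%:~R * l' = 0 by move: h1; lra.
    by rewrite mulf_eq0 (negbTE l'0) orbF => /eqP.
  exists a; apply: (mulfI b0); apply: (addIr (b 0 0)); move: h0; rewrite m0; lra.
(* The same for the inverse map, so that [e] is a unit. *)
have [e' e'E] : exists e' : int, (A 0 0)^-1 = e'%:~R.
  have : lattice_rel (period_lattice alpha' l' L') b (core_line (beta R / A 0 0) *m A + b).
    apply/period_latticeP; exists 1, 0, 0; rewrite !affine3 A01 A02.
    have [-> -> ->] := core_lineE (beta R / A 0 0).
    by split; field.
  move=> /lat/period_latticeP[a [m [n []]]].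
  have [-> -> ->] := core_lineE (beta R / A 0 0); rewrite !mxE !add0r => h0 h1 _.
  have m0 : m%:~R = 0 :> R by move/esym/eqP: h1; rewrite mulf_eq0 (negbTE l0) orbF => /eqP.
  by exists a; apply: (mulfI b0); rewrite h0 m0; ring.
have ee' : e * e' = 1.
  by apply/eqP; rewrite -(eqr_int R) intrM -eE -e'E divff.
have ee : e * e = 1.
  have : (`|e| * `|e'|)%N = 1%N by rewrite -abszM ee'.
  move/eqP; rewrite muln_eq1 => /andP[/eqP + _].
  by case: (e) => [[|[|]]|[|]].
have mu1 : mu ^+ 2 = 1 by rewrite -A00mu eE -intrM ee.
have [P [P00 P01 P10 P11]] : exists P : 'M[R]_2, [/\ P 0 0 = A 1 1, P 0 1 = A 1 2,
    P 1 0 = A 2 1 & P 1 1 = A 2 2].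
  exists (\matrix_(i, j) A (lift 0 i) (lift 0 j)); rewrite !mxE.
  by split; congr (A _ _); exact: val_inj.
exists e, P; split=> //.
- have A11 := AE 1 1; have A12 := AE 1 2; have A21 := AE 2 1; have A22 := AE 2 2.
  apply/matrixP; apply: ord2P; apply: ord2P; rewrite !mxE sum2 !mxE ?P00 ?P01 ?P10 ?P11 /=.
  + by rewrite A10 mul0r add0r mu1 in A11.
  + by rewrite A10 mul0r add0r mu1 in A12.
  + by rewrite A20 mul0r add0r mu1 in A21.
  + by rewrite A20 mul0r add0r mu1 in A22.
- move=> m n; pose z : 'rV[R]_3 := \row_j [:: m%:~R * alpha; m%:~R * l; n%:~R * L]`_j.
  have : lattice_rel (period_lattice alpha l L) 0 z.
    by apply/period_latticeP; exists 0, m, n; rewrite !mxE /=; split; ring.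
  move=> /lat/period_latticeP[a [m' [n' []]]]; rewrite !affine3 A01 A02 A10 A20 eE !mxE /=.
  by move=> h0 h1 h2; exists a, m', n'; rewrite P00 P01 P10 P11; split; lra.
- move=> m n.
  pose y : 'rV[R]_3 := \row_j [:: m%:~R * alpha'; m%:~R * l'; n%:~R * L']`_j.
  have AtA : A^T *m A = 1%:M by apply: mulmx1C; rewrite AA mu1.
  have : lattice_rel (period_lattice alpha' l' L') b ((y *m A^T) *m A + b).
    apply/period_latticeP; exists 0, m, n; rewrite -mulmxA AtA mulmx1.
    by rewrite ![(y + b) _ _]mxE /y !mxE /=; split; ring.
  move=> /lat/period_latticeP[a [m' [n' []]]].
  have yE j : (y *m A^T) 0 j = m%:~R * alpha' * A j 0 + m%:~R * l' * A j 1 + n%:~R * L' * A j 2.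
    by rewrite mxE sum3 !mxE.
  rewrite !yE A01 A02 A10 A20 eE !mxE => h0 h1 h2; exists a, m', n'.
  by rewrite P00 P01 P10 P11; split; lra.
Qed.

Lemma orthogonal2 (P : 'M[R]_2) : P *m P^T = 1%:M ->
  [/\ P 0 0 * P 0 0 + P 0 1 * P 0 1 = 1, P 0 0 * P 1 0 + P 0 1 * P 1 1 = 0 &
      P 1 0 * P 1 0 + P 1 1 * P 1 1 = 1].
Proof.
move=> PP; have PE i j : P i 0 * P j 0 + P i 1 * P j 1 = (i == j)%:R.
  by have /matrixP/(_ i j) := PP; rewrite !mxE sum2 !mxE.
by rewrite !PE.
Qed.

Lemma homothety_core_line e P alpha l L alpha' l' L' :
  e * e = 1 -> P *m P^T = 1%:M ->
  holonomy_compatible e P alpha l L alpha' l' L' ->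
  holonomy_compatible e P^T alpha' l' L' alpha l L ->
  marked_homothety 1 (period_lattice alpha l L) core_line
    (period_lattice alpha' l' L') core_line.
Proof.
move=> ee PP H H'; split=> //.
have eeR : e%:~R * e%:~R = 1 :> R by rewrite -intrM ee.
have [p00 p01 p11] := orthogonal2 PP.
pose A : 'M[R]_3 := \matrix_(i, j)
  (nth [::] [:: [:: e%:~R; 0; 0]; [:: 0; P 0 0; P 0 1]; [:: 0; P 1 0; P 1 1]] i)`_j.
have E (x : 'rV[R]_3) : [/\ (x *m A + 0) 0 0 = x 0 0 * e%:~R,
    (x *m A + 0) 0 1 = x 0 1 * P 0 0 + x 0 2 * P 1 0 &
    (x *m A + 0) 0 2 = x 0 1 * P 0 1 + x 0 2 * P 1 1].
  by rewrite !affine3 !mxE /=; split; ring.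
exists A, 0; split.
- apply/matrixP; apply: ord3P; apply: ord3P; rewrite !mxE sum3 !mxE /= expr1n ?mulr1n ?mulr0n;
  rewrite ?mulr0 ?mul0r ?addr0 ?add0r//.
  + by rewrite -[RHS]p01; ring.
- move=> x y; rewrite !period_latticeP; have [-> -> ->] := E x; have [-> -> ->] := E y.
  split=> -[a [m [n [h0 h1 h2]]]].
    have [a' [m' [n' [k0 k1 k2]]]] := H m n; exists (e * a + a'), m', n'.
    by rewrite -k1 -k2 h1 h2 h0 intrD intrM -addrA; split; lra.
  have [a' [m' [n' [k0 k1 k2]]]] := H' m n; exists (e * a + a'), m', n'.
  rewrite !mxE in k1 k2.
  have T (u v : R) : u * e%:~R = v -> u = v * e%:~R by move=> <-; rewrite -mulrA eeR mulr1.
  have hu : m%:~R * l' = (y 0 1 - x 0 1) * P 0 0 + (y 0 2 - x 0 2) * P 1 0 by lra.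
  have hv : n%:~R * L' = (y 0 1 - x 0 1) * P 0 1 + (y 0 2 - x 0 2) * P 1 1 by lra.
  split.
  + rewrite (T _ _ h0) !mulrDl -mulrA eeR intrD intrM; lra.
  + transitivity (x 0 1 + ((y 0 1 - x 0 1) * (P 0 0 * P 0 0 + P 0 1 * P 0 1)
        + (y 0 2 - x 0 2) * (P 0 0 * P 1 0 + P 0 1 * P 1 1))); first by rewrite p00 p01; ring.
    by rewrite -k1 hu hv; ring.
  + transitivity (x 0 2 + ((y 0 1 - x 0 1) * (P 0 0 * P 1 0 + P 0 1 * P 1 1)
        + (y 0 2 - x 0 2) * (P 1 0 * P 1 0 + P 1 1 * P 1 1))); first by rewrite p11 p01; ring.
    by rewrite -k2 hu hv; ring.
move=> w.
have cE t : core_line t *m A + 0 = core_line (e%:~R * t).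
  have [a0 a1 a2] := E (core_line t); have [b0 b1 b2] := core_lineE t.
  have [c0 c1 c2] := core_lineE (e%:~R * t).
  by apply: row3_eq; rewrite ?a0 ?a1 ?a2 ?c0 ?c1 ?c2 ?b0 ?b1 ?b2; ring.
split=> -[t h]; first by exists (e%:~R * t); rewrite -cE.
by exists (e%:~R * t); rewrite cE mulrA eeR mul1r.
Qed.

(** Realizes diag(e, P) on the filled-in space: for [e = -1] the disc is reflected, and conjugation
    by a reflection reverses rotation angles. *)
Definition core_map (e : int) (P : 'M[R]_2) (x : 'rV[R]_4) : 'rV[R]_4 :=
  row4 (x 0 0) (e%:~R * x 0 1) (x 0 2 * P 0 0 + x 0 3 * P 1 0) (x 0 2 * P 0 1 + x 0 3 * P 1 1).

Lemma smooth_core_map e P : smooth_on setT (core_map e P).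
Proof.
have oT := @openT 'rV[R]_4.
by rewrite /core_map; apply: (smooth_row4 oT); smooth_rules.
Qed.

Lemma core_mapK e P : e * e = 1 -> P *m P^T = 1%:M -> cancel (core_map e P) (core_map e P^T).
Proof.
move=> ee PP x.
have eeR : e%:~R * e%:~R = 1 :> R by rewrite -intrM ee.
have [p00 p01 p11] := orthogonal2 PP.
rewrite [RHS]row4_eta /core_map !row4s !mxE; congr row4.
- by rewrite mulrA eeR mul1r.
- transitivity (x 0 2 * (P 0 0 * P 0 0 + P 0 1 * P 0 1)
    + x 0 3 * (P 0 0 * P 1 0 + P 0 1 * P 1 1)); first by ring.
  by rewrite p00 p01; ring.
- transitivity (x 0 2 * (P 0 0 * P 1 0 + P 0 1 * P 1 1)
    + x 0 3 * (P 1 0 * P 1 0 + P 1 1 * P 1 1)); first by ring.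
  by rewrite p11 p01; ring.
Qed.

Lemma sign_angle (e : int) (t : R) : e * e = 1 ->
  cos (e%:~R * t) = cos t /\ sin (e%:~R * t) = e%:~R * sin t.
Proof.
move=> ee; have /orP[/eqP->|/eqP->] : (e == 1) || (e == -1) by rewrite -sqrf_eq1 expr2 ee.
  by rewrite !mul1r.
by rewrite !mulN1r cosN sinN.
Qed.

Lemma core_map_action e P alpha l L alpha' l' L' x y : e * e = 1 ->
  holonomy_compatible e P alpha l L alpha' l' L' ->
  action_rel alpha l L x y -> action_rel alpha' l' L' (core_map e P x) (core_map e P y).
Proof.
move=> ee H [m [n ->]]; have [a [m' [n' [h0 h1 h2]]]] := H m n; exists m', n'.
have eeR : e%:~R * e%:~R = 1 :> R by rewrite -intrM ee.
have k0 := theta_radius_neq0 R.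
rewrite !shiftE /core_map !row4s -h1 -h2.
have [ce se] := sign_angle (m%:~R * alpha / k) ee.
have E : e%:~R * (m%:~R * alpha / k) = m'%:~R * alpha' / k + a%:~R * (2 * pi).
  by rewrite mulrA h0 betaE; field.
have [ca sa] := cos_sin_int (m'%:~R * alpha' / k) a.
rewrite -ca -sa -E ce se; congr row4.
- by rewrite [e%:~R * _ * (e%:~R * _)]mulrACA eeR mul1r.
- by ring.
- by ring.
- by ring.
Qed.

Lemma derive_core_map e P x v : 'D_v (core_map e P) x = core_map e P v.
Proof.
have d0 : is_derive x v (fun x : 'rV[R]_4 => x 0 0 : R) (v 0 0) by exact: is_derive_coord.
have d1 : is_derive x v (fun x : 'rV[R]_4 => e%:~R * x 0 1) (e%:~R * v 0 1).
  by derive_with ltac:(ring).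
have d2 : is_derive x v (fun x : 'rV[R]_4 => x 0 2 * P 0 0 + x 0 3 * P 1 0)
   (v 0 2 * P 0 0 + v 0 3 * P 1 0) by derive_with ltac:(ring).
have d3 : is_derive x v (fun x : 'rV[R]_4 => x 0 2 * P 0 1 + x 0 3 * P 1 1)
   (v 0 2 * P 0 1 + v 0 3 * P 1 1) by derive_with ltac:(ring).
by have [_ ->] := is_derive_row4 d0 d1 d2 d3.
Qed.

Lemma pullback_core_map e P x : e * e = 1 -> P *m P^T = 1%:M ->
  pullback (core_map e P) G x = G x.
Proof.
move=> ee PP; apply: symmetric_form_eq.
- by apply: pullback_sym; exact: twisted_metric_sym.
- exact: twisted_metric_sym.
move=> v; rewrite pullback_form; last exact: (smooth_row_differentiable openT (smooth_core_map _ _)).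
rewrite !twisted_metricE derive_core_map.
have eeR : e%:~R * e%:~R = 1 :> R by rewrite -intrM ee.
have [p00 p01 p11] := orthogonal2 PP.
have -> : disc_norm2 (core_map e P x) = disc_norm2 x.
  by rewrite /disc_norm2 !row4s exprMn expr2 [e%:~R ^+ 2]expr2 eeR; ring.
rewrite /twisted_form !row4s !mul0r !subr0 !addr0 !expr1n !mul1r.
have -> : e%:~R * v 0 1 * (e%:~R * v 0 1) = v 0 1 * v 0 1 by rewrite mulrACA eeR mul1r.
have -> : e%:~R * x 0 1 * (e%:~R * v 0 1) = x 0 1 * v 0 1 by rewrite mulrACA eeR mul1r.
congr (_ + _); congr (_ * _).
transitivity (v 0 2 * v 0 2 * (P 0 0 * P 0 0 + P 0 1 * P 0 1) +
  v 0 3 * v 0 3 * (P 1 0 * P 1 0 + P 1 1 * P 1 1) +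
  2 * (v 0 2 * v 0 3) * (P 0 0 * P 1 0 + P 0 1 * P 1 1)); first by ring.
by rewrite p00 p01 p11; ring.
Qed.

Lemma core_map_isometry e P alpha l L alpha' l' L' : e * e = 1 -> P *m P^T = 1%:M ->
  holonomy_compatible e P alpha l L alpha' l' L' ->
  holonomy_compatible e P^T alpha' l' L' alpha l L ->
  core_isometry (action_rel alpha l L) (action_rel alpha' l' L') (core_map e P).
Proof.
move=> ee PP H H'; split; last by move=> x; exact: pullback_core_map.
have PtP : P^T *m P^T^T = 1%:M by rewrite trmxK; exact: mulmx1C.
have K := core_mapK ee PtP; rewrite trmxK in K.
split; first exact: smooth_core_map.
split; first by [].
split; first by move=> x y _ _; exact: core_map_action.
exists (core_map e P^T); split; first exact: smooth_core_map.
split; first by [].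
split; first by move=> x y _ _; exact: core_map_action.
split=> x _; first by rewrite (core_mapK ee PP); exact: action_rel_refl.
by rewrite K; exact: action_rel_refl.
Qed.

End HolonomyCompatible.

(** * Isometries along the core *)

Section RigidTranslation.
Variable R : realType.
Local Notation p := (@rplus R).
Local Notation q := (@disc_norm2 R).
Local Notation G := (@core_metric R).
Variable F : 'rV[R]_4 -> 'rV[R]_4.
Hypothesis sF : smooth_on setT F.
Hypothesis pF : forall x, pullback F G x = G x.

Lemma disc_norm2_eq0 (x : 'rV[R]_4) : q x = 0 -> x 0 0 = 0 /\ x 0 1 = 0.
Proof.
by move/eqP; rewrite /disc_norm2 paddr_eq0 ?sqr_ge0// !sqrf_eq0 => /andP[/eqP-> /eqP->].
Qed.

Lemma core_form (x v : 'rV[R]_4) : (v *m G x *m v^T) 0 0 =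
  (coefA (q x) * (v 0 0 ^+ 2 + v 0 1 ^+ 2) + coefB (q x) * dotu x v ^+ 2)
  + coefC (q x) * (v 0 2 ^+ 2 + v 0 3 ^+ 2).
Proof. by rewrite twisted_metricE /twisted_form /dotu; ring. Qed.

Lemma core_form_ge (x v : 'rV[R]_4) :
  (p + q x) ^+ 2 * (v 0 2 ^+ 2 + v 0 3 ^+ 2) <= (v *m G x *m v^T) 0 0.
Proof.
have q0 := disc_norm2_ge0 x.
rewrite core_form -/(coefC (q x)) lerDr.
have m0 : 0 <= Num.min (coefA (q x)) (coefA (q x) + coefB (q x) * q x).
  by rewrite le_min !ltW// ?coefA_gt0// coefD_gt0.
have n0 : 0 <= v 0 0 ^+ 2 + v 0 1 ^+ 2 by rewrite addr_ge0// sqr_ge0.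
apply: le_trans (mulr_ge0 m0 n0) _.
apply: base_form_ge (sqr_ge0 _) (dotu_sqr_le x v) q0 _ _ => //.
- by rewrite ge_min lexx.
- by rewrite ge_min lexx orbT.
Qed.

Lemma velocity_le (x v : 'rV[R]_4) : x 0 0 = 0 -> x 0 1 = 0 -> v 0 0 = 0 -> v 0 1 = 0 ->
  (p + q (F x)) ^+ 2 * (('D_v F x) 0 2 ^+ 2 + ('D_v F x) 0 3 ^+ 2) <=
  p ^+ 2 * (v 0 2 ^+ 2 + v 0 3 ^+ 2).
Proof.
move=> x0 x1 v0 v1; apply: le_trans (core_form_ge _ _) _.
rewrite -pullback_form; last exact: (smooth_row_differentiable openT sF).
rewrite pF core_form /dotu.
have -> : q x = 0 by rewrite /disc_norm2 x0 x1 expr0n addr0.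
by rewrite v0 v1 /coefC addr0 expr0n !mulr0 !addr0 mulr0 expr0n mulr0 !add0r.
Qed.

Lemma is_derive_along (y v : 'rV[R]_4) (t : R) (a b : R) :
  is_derive t 1 (fun t : R => a * F (y + t *: v) 0 2 + b * F (y + t *: v) 0 3)
    (a * ('D_v F (y + t *: v)) 0 2 + b * ('D_v F (y + t *: v)) 0 3).
Proof.
have H j : is_derive t 1 (fun t : R => F (y + t *: v) 0 j) (('D_v F (y + t *: v)) 0 j).
  have dF : derivable F (y + t *: v) v.
    by apply: diff_derivable; exact: (smooth_row_differentiable openT sF).
  have dj : derivable (fun x => F x 0 j : R) (y + t *: v) v.
    by have /derivable_mxP := dF; apply.
  rewrite (derive_row j dF); exact: (is_derive_line dj).
have h2 := H 2; have h3 := H 3.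
by derive_with ltac:(ring).
Qed.

(** Any value is squeezed between values at translates of 0 by integers, which all agree. *)
Lemma periodic_nonincreasing_const (h dh : R -> R) : (forall t : R, is_derive t 1 h (dh t)) ->
  (forall t, dh t <= 0) -> (forall t, h (t + 1) = h t) -> dh 0 = 0.
Proof.
move=> Hh dh0 per.
have mono s t : s <= t -> h t <= h s.
  move=> st; have Hs (u : R) : `|u| <= `|t - s| -> is_derive u 1 (fun u => h (s + u)) (dh (s + u)).
    move=> _; have ds : is_derive u 1 (fun u : R => s + u) 1 by derive_with ltac:(ring).
    by have := is_derive_comp1 (Hh (s + u)) ds; rewrite mulr1.
  have [c _] := mean_value_abs Hs; rewrite addr0 (addrC s) subrK => E.
  by rewrite -subr_le0 E mulr_le0_ge0// subr_ge0.
have hc t : h t = h 0.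
  have [n nt] : exists n : nat, `|t| <= n%:R.
    exists (Num.truncn `|t|).+1; apply: ltW; exact: truncnS_gt.
  have perN s (m : nat) : h (s + m%:R) = h s.
    by elim: m s => [|m IH] s; rewrite ?addr0// -natr1 addrA per IH.
  apply/eqP; rewrite eq_le; apply/andP; split.
    rewrite -(perN t n); apply: mono; move: nt; rewrite ler_norml; lra.
  rewrite -(perN 0 n) add0r; apply: mono; move: nt; rewrite ler_norml; lra.
have [_ <-] := Hh 0; have -> : h = cst (h 0) by apply/funext => t; exact: hc.
exact: derive_cst.
Qed.

Variables a b a' b' : R.
Hypothesis tF : forall y : 'rV[R]_4, y 0 0 = 0 -> y 0 1 = 0 ->
  F (y + row4 0 0 a b) 0 2 = F y 0 2 + a' /\ F (y + row4 0 0 a b) 0 3 = F y 0 3 + b'.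

Let v := row4 0 0 a b.

Let core_line_pt (y : 'rV[R]_4) (t : R) : y 0 0 = 0 -> y 0 1 = 0 ->
  (y + t *: v) 0 0 = 0 /\ (y + t *: v) 0 1 = 0.
Proof. by move=> y0 y1; rewrite !mxE /= y0 y1 mulr0 addr0. Qed.

Let velocity_bound (y : 'rV[R]_4) (t : R) : y 0 0 = 0 -> y 0 1 = 0 ->
  ('D_v F (y + t *: v)) 0 2 ^+ 2 + ('D_v F (y + t *: v)) 0 3 ^+ 2 <= a ^+ 2 + b ^+ 2.
Proof.
move=> y0 y1; have [z0 z1] := core_line_pt t y0 y1.
have := velocity_le z0 z1; move=> /(_ v); rewrite /v !row4s => /(_ erefl erefl).
have := disc_norm2_ge0 (F (y + t *: row4 0 0 a b)); have := rplus_gt0 R.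
set Q := q _; set u := (X in X 0 2 ^+ 2); set N := a ^+ 2 + b ^+ 2.
have : 0 <= u 0 2 ^+ 2 + u 0 3 ^+ 2 by rewrite addr_ge0// sqr_ge0.
move: (u 0 2 ^+ 2 + _) => S S0 p0 Q0 h.
rewrite -(ler_pM2l (exprn_gt0 2 p0)); apply: le_trans h.
apply: ler_wpM2r => //; rewrite -subr_ge0 (_ : _ - _ = Q * (2 * p + Q)); last by ring.
by apply: mulr_ge0; lra.
Qed.

(** With lambda = (a, b) and lambda' = (a', b'), the pairing of lambda' with the s-part of [F] grows
    by [|lambda'|^2] over one period. By the mean value theorem this is the pairing of lambda' with
    a velocity of length at most [|lambda|]. *)
Lemma rigid_translation_le : a' ^+ 2 + b' ^+ 2 <= a ^+ 2 + b ^+ 2.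
Proof.
have H (t : R) : `|t| <= `|1| ->
   is_derive t 1 (fun t : R => a' * F (0 + t *: v) 0 2 + b' * F (0 + t *: v) 0 3) _ :=
  fun _ => is_derive_along 0 v t a' b'.
have [c _] := mean_value_abs H; rewrite scale1r scale0r addr0 mulr1.
have [||-> ->] := tF (y := 0); rewrite ?mxE//.
have := velocity_bound c (y := 0); rewrite !mxE => /(_ erefl erefl).
set u := ('D_v F _ 0 2); set w := ('D_v F _ 0 3) => h E.
have := sqr_ge0 (a' - u); have := sqr_ge0 (b' - w); rewrite !sqrrB; lra.
Qed.

(** Equality in Cauchy-Schwarz makes the s-velocity equal to (a', b'). As its length is then already
    that of the source vector, the image point must lie where the s-directions are shortest, on the
    core, and nothing is left for the disc components of the velocity. *)
Lemma rigid_translation_eq (y : 'rV[R]_4) : 0 < a ^+ 2 + b ^+ 2 ->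
  a' ^+ 2 + b' ^+ 2 = a ^+ 2 + b ^+ 2 -> y 0 0 = 0 -> y 0 1 = 0 ->
  q (F y) = 0 /\ 'D_v F y = row4 0 0 a' b'.
Proof.
move=> N0 NE y0 y1; set N := a ^+ 2 + b ^+ 2 in N0 NE.
(* Nonincreasing by Cauchy-Schwarz and the velocity bound; periodic because one period adds
   [a' ^+ 2 + b' ^+ 2 = N] to the pairing. *)
pose h (t : R) := a' * F (y + t *: v) 0 2 + b' * F (y + t *: v) 0 3 - t * N.
pose dh (t : R) := a' * ('D_v F (y + t *: v)) 0 2 + b' * ('D_v F (y + t *: v)) 0 3 - N.
have Hh (t : R) : is_derive t 1 h (dh t).
  have H := is_derive_along y v t a' b'.
  rewrite /h; derive_with ltac:(rewrite /dh; ring).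
have dh0 t : dh t <= 0.
  have := velocity_bound t y0 y1; rewrite -/N /dh.
  set u := ('D_v F _ 0 2); set w := ('D_v F _ 0 3).
  have := sqr_ge0 (a' - u); have := sqr_ge0 (b' - w); rewrite !sqrrB; lra.
have per t : h (t + 1) = h t.
  have [z0 z1] := core_line_pt t y0 y1; have [h2 h3] := tF z0 z1.
  by rewrite /h scalerDl scale1r addrA h2 h3 -NE; ring.
have := periodic_nonincreasing_const Hh dh0 per.
have := velocity_bound 0 y0 y1; have vl := @velocity_le y v y0 y1.
rewrite /dh !scale0r !addr0 -/N; move: vl; rewrite /v !row4s -/v => /(_ erefl erefl); rewrite -/N.
set u := ('D_v F _ 0 2); set w := ('D_v F _ 0 3) => vl uN uE.
have [ua wb] : u = a' /\ w = b'.
  have : (u - a') ^+ 2 + (w - b') ^+ 2 = 0.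
    apply/eqP; rewrite eq_le addr_ge0 ?sqr_ge0// andbT !sqrrB; lra.
  by move/eqP; rewrite paddr_eq0 ?sqr_ge0// !sqrf_eq0 !subr_eq0 => /andP[/eqP-> /eqP->].
have qF : q (F y) = 0.
  apply/eqP; rewrite eq_le disc_norm2_ge0 andbT.
  move: vl (disc_norm2_ge0 (F y)) (rplus_gt0 R); rewrite ua wb NE ler_pM2r// => vl Q0 p0.
  rewrite leNgt; apply/negP => Qp; have : 0 < q (F y) * (2 * p + q (F y)) by apply: mulr_gt0; lra.
  by move: vl; rewrite sqrrD mulr2n expr2 [X in _ + X <= _]expr2; lra.
split=> //; have := pullback_form G v v (smooth_row_differentiable openT sF (x := y) I).
rewrite pF => /(congr1 (fun M : 'M[R]_1 => M 0 0)); rewrite !core_form /dotu.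
have -> : q y = 0 by rewrite /disc_norm2 y0 y1 expr0n addr0.
rewrite qF; have [-> ->] := disc_norm2_eq0 qF; rewrite y0 y1 -/u -/w ua wb NE /v !row4s -/v -/N.
set s := ('D_v F y) 0 0; set t := ('D_v F y) 0 1.
rewrite !mul0r !addr0 expr0n !mulr0 !addr0 mulr0 add0r.
move=> E; have : coefA 0 * (s ^+ 2 + t ^+ 2) = 0 :> R by lra.
move/eqP; rewrite mulf_eq0 gt_eqF ?coefA_gt0//= paddr_eq0 ?sqr_ge0// !sqrf_eq0.
move=> /andP[/eqP s0 /eqP t0].
by apply: row4_eq; rewrite row4s.
Qed.

End RigidTranslation.

Section ProductDerivatives.
Variables (R : realType) (V : normedModType R) (x v : V).

Lemma is_derive_dot2 (f g f' g' : V -> R) (df dg df' dg' : R) :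
  is_derive x v f df -> is_derive x v g dg -> is_derive x v f' df' -> is_derive x v g' dg' ->
  is_derive x v (fun y => f y * g y + f' y * g' y) (df * g x + f x * dg + df' * g' x + f' x * dg').
Proof. by move=> hf hg hf' hg'; derive_with ltac:(ring). Qed.

Lemma is_derive_form (a b c s t u w : V -> R) (b' ds dt du dw : R) : t x = 0 -> u x = 0 ->
  is_derive x v a 0 -> is_derive x v b b' -> is_derive x v c 0 ->
  is_derive x v s ds -> is_derive x v t dt -> is_derive x v u du -> is_derive x v w dw ->
  is_derive x v (fun y => a y * s y + b y * (t y * u y) + c y * w y) (a x * ds + c x * dw).
Proof. by move=> t0 u0 ha hb hc hs ht hu hw; derive_with ltac:(rewrite t0 u0; ring). Qed.

End ProductDerivatives.

(** The algebra behind the vanishing of a quantity that is both symmetric and skew in two indices: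
    the first two equations give [s = t], the third [s = - t]. *)
Lemma symmetric_skew_eq0 (R : realType) (A C s t r : R) : A != 0 ->
  A * s + C * r = 0 -> A * t + C * r = 0 -> s + t = 0 -> s = 0.
Proof. by move=> A0 h1 h2 h3; have /(mulfI A0) E : A * s = A * t; lra. Qed.

(** * The normal frame along the core *)

Section CoreFrame.
Variable R : realType.
Local Notation p := (@rplus R).
Local Notation q := (@disc_norm2 R).
Local Notation G := (@core_metric R).
Local Notation e_ := (@basis4 R).
Variable F : 'rV[R]_4 -> 'rV[R]_4.
Hypothesis sF : smooth_on setT F.
Hypothesis pF : forall x, pullback F G x = G x.

(** The [j]-th component of the image under [dF] of the [i]-th basis vector. On the core, indices 0
    and 1 are normal, 2 and 3 tangent. *)
Definition frame (i j : 'I_4) : 'rV[R]_4 -> R := partial i (fun x => F x 0 j : R).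
Definition frame2 (l i j : 'I_4) : 'rV[R]_4 -> R := partial l (frame i j).

Let oT := @openT 'rV[R]_4.

Lemma smooth_component j : smooth_on setT (fun x => F x 0 j : R).
Proof. exact: (smooth_mx _ oT).1. Qed.

Lemma smooth_frame i j : smooth_on setT (frame i j).
Proof. by have /smooth_onE[_ _] := smooth_component j; apply. Qed.

Lemma is_derive_component y l j : is_derive y (e_ l) (fun x => F x 0 j : R) (frame l j y).
Proof. exact: (smooth_partial_derive l (smooth_component j) (I : setT y)). Qed.

Lemma is_derive_frame y l i j : is_derive y (e_ l) (frame i j) (frame2 l i j y).
Proof. exact: (smooth_partial_derive l (smooth_frame i j) (I : setT y)). Qed.

Lemma frame2C l i j x : frame2 l i j x = frame2 i l j x.
Proof.
rewrite /frame2 /frame; apply: (@partialC R 4 setT) => //.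
by have /smooth_onP := smooth_component j; apply.
Qed.

Lemma derive_frame x v j : ('D_v F x) 0 j = \sum_i v 0 i * frame i j x.
Proof.
rewrite derive_row; last by apply: diff_derivable; exact: (smooth_row_differentiable oT sF).
have /smooth_onP/(_ 1%N) s1 := smooth_component j.
by have [_ ->] := Ck1_differentiable oT s1 (I : setT x).
Qed.

Lemma derive_basis x i j : ('D_(e_ i) F x) 0 j = frame i j x.
Proof.
rewrite derive_row//; apply: diff_derivable; exact: (smooth_row_differentiable oT sF).
Qed.

Lemma derive_frame_line y v l j (t : R) :
  is_derive t 1 (fun t : R => frame l j (y + t *: v)) (\sum_i v 0 i * frame2 i l j (y + t *: v)).
Proof.
have /smooth_onP/(_ 1%N) s1 := smooth_frame l j.
have [dfr dE] := Ck1_differentiable oT s1 (I : setT (y + t *: v)).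
have d : derivable (frame l j) (y + t *: v) v by exact: diff_derivable.
by have := is_derive_line d; rewrite dE.
Qed.

Local Opaque frame frame2.

Definition frame_form (i j : 'I_4) (x : 'rV[R]_4) : R :=
  coefA (q (F x)) * (frame i 0 x * frame j 0 x + frame i 1 x * frame j 1 x)
  + coefB (q (F x)) * ((F x 0 0 * frame i 0 x + F x 0 1 * frame i 1 x)
                       * (F x 0 0 * frame j 0 x + F x 0 1 * frame j 1 x))
  + coefC (q (F x)) * (frame i 2 x * frame j 2 x + frame i 3 x * frame j 3 x).

Lemma frame_formE i j x : frame_form i j x = G x i j.
Proof.
have -> : G x i j = (e_ i *m G x *m (e_ j)^T) 0 0 by rewrite /basis4 -rowE trmx_delta -colE !mxE.
rewrite -pF pullback_form; last exact: (smooth_row_differentiable oT sF).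
rewrite /frame_form -!derive_basis twisted_metricE /twisted_form.
move: ('D_(e_ i) F x) ('D_(e_ j) F x) (F x) => v w z.
by rewrite !mul0r !subr0 !addr0 !expr1n !mul1r.
Qed.

Lemma core_metric_block x i j : i = 0 \/ i = 1 -> j = 2 \/ j = 3 -> G x i j = 0.
Proof.
rewrite twisted_metric_entry /twisted_form; have [b0 b1 b2 b3] := basis4E R.
by move=> [->|->] [->|->]; rewrite ?b0 ?b1 ?b2 ?b3 !row4s; ring.
Qed.

(** The values are immaterial: they get multiplied by the derivative of [q (F x)], a sum of two
    squares that vanish on the core. *)
Lemma is_derive_coefs0 : exists a b c, [/\ is_derive (0 : R) 1 (@coefA R) a,
  is_derive (0 : R) 1 (@coefB R) b & is_derive (0 : R) 1 (@coefC R) c].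
Proof.
have p0 := rplus_neq0 R.
eexists _, _, _; split; rewrite /coefA /coefB /coefC /numer; derive_rules.
- by rewrite addr0.
- by rewrite !addr0 mulf_neq0// (_ : _ + _ = 3 * p ^+ 2) ?mulf_neq0 ?expf_neq0 ?pnatr_eq0//; ring.
Qed.

Hypothesis coreF : forall y : 'rV[R]_4, y 0 0 = 0 -> y 0 1 = 0 -> q (F y) = 0.

Section AtCorePoint.
Variable y : 'rV[R]_4.
Hypotheses (y0 : y 0 0 = 0) (y1 : y 0 1 = 0).

Let qF : q (F y) = 0. Proof. exact: coreF. Qed.
Let Fy0 : F y 0 0 = 0. Proof. by have [] := disc_norm2_eq0 qF. Qed.
Let Fy1 : F y 0 1 = 0. Proof. by have [] := disc_norm2_eq0 qF. Qed.
Let qy : q y = 0. Proof. by rewrite /disc_norm2 y0 y1 expr0n addr0. Qed.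

Lemma frame_core i j : coefA 0 * (frame i 0 y * frame j 0 y + frame i 1 y * frame j 1 y)
  + coefC 0 * (frame i 2 y * frame j 2 y + frame i 3 y * frame j 3 y) = G y i j.
Proof. by rewrite -frame_formE /frame_form qF Fy0 Fy1 !mul0r addr0 !mulr0 addr0. Qed.

Lemma is_derive_frame_form l i j : is_derive y (e_ l) (frame_form i j)
  (coefA 0 * (frame2 l i 0 y * frame j 0 y + frame i 0 y * frame2 l j 0 y
              + frame2 l i 1 y * frame j 1 y + frame i 1 y * frame2 l j 1 y)
   + coefC 0 * (frame2 l i 2 y * frame j 2 y + frame i 2 y * frame2 l j 2 y
              + frame2 l i 3 y * frame j 3 y + frame i 3 y * frame2 l j 3 y)).
Proof.
have dF := is_derive_component y l; have df := is_derive_frame y l.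
have dF0 := dF 0; have dF1 := dF 1.
have dq : is_derive y (e_ l) (fun x => q (F x)) 0.
  by rewrite /disc_norm2; derive_with ltac:(rewrite Fy0 Fy1; ring).
have [a [b [c [da db dc]]]] := is_derive_coefs0.
have dA : is_derive y (e_ l) (fun x => coefA (q (F x))) 0.
  by rewrite -(mulr0 a); apply: is_derive_comp1 dq; rewrite qF.
have dB : is_derive y (e_ l) (fun x => coefB (q (F x))) 0.
  by rewrite -(mulr0 b); apply: is_derive_comp1 dq; rewrite qF.
have dC : is_derive y (e_ l) (fun x => coefC (q (F x))) 0.
  by rewrite -(mulr0 c); apply: is_derive_comp1 dq; rewrite qF.
have h01 := is_derive_dot2 (df i 0) (df j 0) (df i 1) (df j 1).
have h23 := is_derive_dot2 (df i 2) (df j 2) (df i 3) (df j 3).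
have hi := is_derive_dot2 (dF 0) (df i 0) (dF 1) (df i 1).
have hj := is_derive_dot2 (dF 0) (df j 0) (dF 1) (df j 1).
have ti : F y 0 0 * frame i 0 y + F y 0 1 * frame i 1 y = 0 by rewrite Fy0 Fy1 !mul0r addr0.
have tj : F y 0 0 * frame j 0 y + F y 0 1 * frame j 1 y = 0 by rewrite Fy0 Fy1 !mul0r addr0.
have := is_derive_form (t := fun x => F x 0 0 * frame i 0 x + F x 0 1 * frame i 1 x)
  (u := fun x => F x 0 0 * frame j 0 x + F x 0 1 * frame j 1 x) ti tj dA dB dC h01 hi hj h23; rewrite qF.
exact.
Qed.

End AtCorePoint.

Lemma derive_const_line (f : 'rV[R]_4 -> R) y v d : is_derive y v f d ->
  (forall t : R, f (y + t *: v) = f y) -> d = 0.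
Proof.
move=> [dfv <-] fc.
have dl : derivable f (y + (0 : R) *: v) v by rewrite scale0r addr0.
have [_] := is_derive_line dl.
have -> : (fun s : R => f (y + s *: v)) = cst (f y) by apply/funext => t; exact: fc.
by rewrite derive_cst scale0r addr0 => <-.
Qed.

Lemma core_tangent_line (y : 'rV[R]_4) j (t : R) : y 0 0 = 0 -> y 0 1 = 0 -> j = 2 \/ j = 3 ->
  (y + t *: e_ j) 0 0 = 0 /\ (y + t *: e_ j) 0 1 = 0.
Proof.
by move=> y0 y1 [->|->]; rewrite !mxE /= y0 y1 !mulr0 addr0.
Qed.

Variable P : 'M[R]_2.
Hypothesis tangent : forall y : 'rV[R]_4, y 0 0 = 0 -> y 0 1 = 0 ->
  'D_(e_ 2) F y = row4 0 0 (P 0 0) (P 0 1) /\ 'D_(e_ 3) F y = row4 0 0 (P 1 0) (P 1 1).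

Let frame_tangent (y : 'rV[R]_4) : y 0 0 = 0 -> y 0 1 = 0 ->
  [/\ [/\ frame 2 0 y = 0, frame 2 1 y = 0, frame 2 2 y = P 0 0 & frame 2 3 y = P 0 1] &
      [/\ frame 3 0 y = 0, frame 3 1 y = 0, frame 3 2 y = P 1 0 & frame 3 3 y = P 1 1]].
Proof.
by move=> y0 y1; have [t2 t3] := tangent y0 y1; rewrite -!derive_basis t2 t3 !row4s.
Qed.

Let A0 : coefA 0 != 0 :> R. Proof. by rewrite gt_eqF// coefA_gt0. Qed.
Let C0 : coefC 0 != 0 :> R. Proof. by rewrite gt_eqF// coefC_gt0. Qed.

Lemma tangent_orthogonal : P *m P^T = 1%:M.
Proof.
have z0 : (0 : 'rV[R]_4) 0 0 = 0 by rewrite mxE.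
have z1 : (0 : 'rV[R]_4) 0 1 = 0 by rewrite mxE.
have [[a0 a1 a2 a3] [b0 b1 b2 b3]] := frame_tangent z0 z1.
have qz : q (0 : 'rV[R]_4) = 0 by rewrite /disc_norm2 z0 z1 expr0n addr0.
have [_ _ c2 c3] := basis4E R.
have h22 := frame_core z0 z1 2 2; have h23 := frame_core z0 z1 2 3; have h33 := frame_core z0 z1 3 3.
rewrite a0 a1 a2 a3 ?b0 ?b1 ?b2 ?b3 !twisted_metric_entry /twisted_form qz z0 z1 ?c2 ?c3 !row4s in h22 h23 h33.
move: (coefA 0) (coefB 0) (coefC 0) C0 h22 h23 h33 => A B C Cn0 h22 h23 h33 {a0 a1 a2 a3 b0 b1 b2 b3 c2 c3 qz z0 z1}.
have E (a b : R) : C * a = C * b -> a = b by exact: (mulfI Cn0).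
have p00 : P 0 0 * P 0 0 + P 0 1 * P 0 1 = 1 by apply: E; move: h22; lra.
have p01 : P 0 0 * P 1 0 + P 0 1 * P 1 1 = 0 by apply: E; move: h23; lra.
have p11 : P 1 0 * P 1 0 + P 1 1 * P 1 1 = 1 by apply: E; move: h33; lra.
apply/matrixP; apply: ord2P; apply: ord2P; rewrite !mxE sum2 !mxE ?p00 ?p01 ?p11//.
by rewrite [P 1 0 * _]mulrC [P 1 1 * _]mulrC p01.
Qed.

Lemma orthogonal2_eq0 (u v : R) : P 0 0 * u + P 0 1 * v = 0 -> P 1 0 * u + P 1 1 * v = 0 ->
  u = 0 /\ v = 0.
Proof.
have PtP : P^T *m P^T^T = 1%:M by rewrite trmxK; exact: mulmx1C tangent_orthogonal.
have [p00 p01 p11] := orthogonal2 PtP; rewrite !mxE in p00 p01 p11.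
move=> h0 h1; split.
  transitivity (P 0 0 * (P 0 0 * u + P 0 1 * v) + P 1 0 * (P 1 0 * u + P 1 1 * v));
    last by rewrite h0 h1; ring.
  transitivity ((P 0 0 * P 0 0 + P 1 0 * P 1 0) * u + (P 0 0 * P 0 1 + P 1 0 * P 1 1) * v); last by ring.
  by rewrite p00 p01; ring.
transitivity (P 0 1 * (P 0 0 * u + P 0 1 * v) + P 1 1 * (P 1 0 * u + P 1 1 * v));
    last by rewrite h0 h1; ring.
transitivity ((P 0 0 * P 0 1 + P 1 0 * P 1 1) * u + (P 0 1 * P 0 1 + P 1 1 * P 1 1) * v); last by ring.
by rewrite p11 p01; ring.
Qed.

(** An isometry keeps normal vectors orthogonal to the images of the two tangent ones, and these
    span the s-plane because [P] is orthogonal. *)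
Lemma frame_normal (y : 'rV[R]_4) (i : 'I_4) : y 0 0 = 0 -> y 0 1 = 0 -> i = 0 \/ i = 1 ->
  frame i 2 y = 0 /\ frame i 3 y = 0.
Proof.
move=> y0 y1 iN; have [[a0 a1 a2 a3] [b0 b1 b2 b3]] := frame_tangent y0 y1.
have h2 := frame_core y0 y1 i 2; have h3 := frame_core y0 y1 i 3.
rewrite a0 a1 a2 a3 core_metric_block in h2; [|exact: iN|by left].
rewrite b0 b1 b2 b3 core_metric_block in h3; [|exact: iN|by right].
rewrite !mulr0 addr0 mulr0 add0r [frame i 2 y * _]mulrC [frame i 3 y * _]mulrC in h2.
rewrite !mulr0 addr0 mulr0 add0r [frame i 2 y * _]mulrC [frame i 3 y * _]mulrC in h3.
by apply: orthogonal2_eq0; apply: (mulfI C0); rewrite mulr0.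
Qed.

Lemma frame_orthonormal (y : 'rV[R]_4) (i j : 'I_4) : y 0 0 = 0 -> y 0 1 = 0 -> i = 0 \/ i = 1 -> j = 0 \/ j = 1 ->
  frame i 0 y * frame j 0 y + frame i 1 y * frame j 1 y = (i == j)%:R.
Proof.
move=> y0 y1 iN jN; have := frame_core y0 y1 i j.
have [-> ->] := frame_normal y0 y1 iN; have [-> ->] := frame_normal y0 y1 jN.
have qy : q y = 0 by rewrite /disc_norm2 y0 y1 expr0n addr0.
rewrite twisted_metric_entry /twisted_form qy y0 y1; have [b0 b1 _ _] := basis4E R.
move=> h; apply: (mulfI A0); move: h.
move: (frame i 0 y) (frame i 1 y) (frame j 0 y) (frame j 1 y) (coefA 0) (coefB 0) (coefC 0).
by move=> a b c d A B C; case: iN => ->; case: jN => ->; rewrite ?b0 ?b1 !row4s /=; lra.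
Qed.

(** Disc and s-directions are orthogonal for g1 at every point, so the relation between the images
    of [i] and [j] may be differentiated in the normal direction [l]. *)
Lemma frame2_core (y : 'rV[R]_4) (i j l : 'I_4) : y 0 0 = 0 -> y 0 1 = 0 -> i = 0 \/ i = 1 -> l = 0 \/ l = 1 ->
  j = 2 \/ j = 3 ->
  coefA 0 * (frame i 0 y * frame2 l j 0 y + frame i 1 y * frame2 l j 1 y)
  + coefC 0 * (frame2 l i 2 y * frame j 2 y + frame2 l i 3 y * frame j 3 y) = 0.
Proof.
move=> y0 y1 iN lN jT.
have fc x : frame_form i j x = 0 by rewrite frame_formE core_metric_block.
have := derive_const_line (is_derive_frame_form y0 y1 l i j) (fun t => etrans (fc _) (esym (fc _))).
have [-> ->] := frame_normal y0 y1 iN.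
have [-> ->] : frame j 0 y = 0 /\ frame j 1 y = 0.
  by have [[a0 a1 _ _] [b0 b1 _ _]] := frame_tangent y0 y1; case: jT => ->.
move: (frame i 0 y) (frame i 1 y) (frame j 2 y) (frame j 3 y) => s t u v.
move: (frame2 l i 0 y) (frame2 l i 1 y) (frame2 l i 2 y) (frame2 l i 3 y) => a b c d.
move: (frame2 l j 0 y) (frame2 l j 1 y) (frame2 l j 2 y) (frame2 l j 3 y) => e f g h.
by move: (coefA 0) (coefC 0) => A C <-; ring.
Qed.

(** The normal frame is orthonormal only on the core; its relations are therefore differentiated
    along the core, in the tangent direction [j], and the derivatives are then interchanged. *)
Lemma frame2_skew (y : 'rV[R]_4) (i j l : 'I_4) : y 0 0 = 0 -> y 0 1 = 0 -> i = 0 \/ i = 1 -> l = 0 \/ l = 1 ->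
  j = 2 \/ j = 3 ->
  (frame i 0 y * frame2 l j 0 y + frame i 1 y * frame2 l j 1 y)
  + (frame l 0 y * frame2 i j 0 y + frame l 1 y * frame2 i j 1 y) = 0.
Proof.
move=> y0 y1 iN lN jT.
have df := is_derive_frame y j.
have d : is_derive y (e_ j) (fun x => frame i 0 x * frame l 0 x + frame i 1 x * frame l 1 x)
  ((frame i 0 y * frame2 l j 0 y + frame i 1 y * frame2 l j 1 y)
  + (frame l 0 y * frame2 i j 0 y + frame l 1 y * frame2 i j 1 y)).
  apply: is_derive_val (is_derive_dot2 (df i 0) (df l 0) (df i 1) (df l 1)) _.
  rewrite (frame2C j i 0) (frame2C j i 1) (frame2C j l 0) (frame2C j l 1).
  move: (frame i 0 y) (frame i 1 y) (frame l 0 y) (frame l 1 y) => s t u v.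
  by move: (frame2 i j 0 y) (frame2 i j 1 y) (frame2 l j 0 y) (frame2 l j 1 y) => a b c e; ring.
apply: (derive_const_line d) => t.
by have [z0 z1] := core_tangent_line t y0 y1 jT; rewrite !frame_orthonormal.
Qed.

(* The second derivatives of F in two normal directions, being symmetric, and
   the skew-symmetry of the derivative of an orthonormal frame leave no room for
   a rotation of the normal frame along the core. *)
Lemma frame2_eq0 (y : 'rV[R]_4) (l j : 'I_4) : y 0 0 = 0 -> y 0 1 = 0 -> l = 0 \/ l = 1 -> j = 2 \/ j = 3 ->
  frame2 j l 0 y = 0 /\ frame2 j l 1 y = 0.
Proof.
move=> y0 y1 lN jT; rewrite !(frame2C j).
have S i : i = 0 \/ i = 1 -> frame i 0 y * frame2 l j 0 y + frame i 1 y * frame2 l j 1 y = 0.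
  move=> iN; have h1 := frame2_core y0 y1 iN lN jT; have h2 := frame2_core y0 y1 lN iN jT.
  rewrite !(frame2C i l) in h2; have h3 := frame2_skew y0 y1 iN lN jT.
  exact: (symmetric_skew_eq0 A0 h1 h2 h3).
have S0 := S 0 (or_introl erefl); have S1 := S 1 (or_intror erefl).
have o i j' := @frame_orthonormal y i j' y0 y1.
have o00 := o 0 0 (or_introl erefl) (or_introl erefl).
have o01 := o 0 1 (or_introl erefl) (or_intror erefl).
have o11 := o 1 1 (or_intror erefl) (or_intror erefl).
move: o00 o01 o11 S0 S1; rewrite /=.
move: (frame 0 0 y) (frame 0 1 y) (frame 1 0 y) (frame 1 1 y) (frame2 l j 0 y) (frame2 l j 1 y).
move=> a b c d u v o00 o01 o11 S0 S1.
have D0 : (a * d - b * c) * (a * d - b * c) = 1.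
  transitivity ((a * a + b * b) * (c * c + d * d) - (a * c + b * d) * (a * c + b * d)); first by ring.
  by rewrite o00 o01 o11; ring.
have Dn0 : a * d - b * c != 0 by apply: contra_eq_neq D0 => ->; rewrite mulr0 eq_sym oner_eq0.
split; apply: (mulfI Dn0); rewrite mulr0.
  by transitivity (d * (a * u + b * v) - b * (c * u + d * v)); [ring|rewrite S0 S1; ring].
by transitivity (a * (c * u + d * v) - c * (a * u + b * v)); [ring|rewrite S0 S1; ring].
Qed.

Lemma frame_constant (y z : 'rV[R]_4) (l j : 'I_4) : y 0 0 = 0 -> y 0 1 = 0 -> z 0 0 = 0 -> z 0 1 = 0 ->
  l = 0 \/ l = 1 -> j = 0 \/ j = 1 -> frame l j y = frame l j z.
Proof.
move=> y0 y1 z0 z1 lN jN.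
have C (t : R) : (y + t *: (z - y)) 0 0 = 0 /\ (y + t *: (z - y)) 0 1 = 0.
  by rewrite !mxE y0 y1 z0 z1 subrr mulr0 addr0.
have H (t : R) : `|t| <= `|1| -> is_derive t 1 (fun t : R => frame l j (y + t *: (z - y))) 0.
  move=> _; have [c0 c1] := C t.
  have E2 := frame2_eq0 c0 c1 lN (or_introl erefl : 2 = 2 \/ 2 = 3 :> 'I_4).
  have E3 := frame2_eq0 c0 c1 lN (or_intror erefl : 3 = 2 \/ 3 = 3 :> 'I_4).
  have {}E2 : frame2 2 l j (y + t *: (z - y)) = 0 by case: jN => ->; [exact: E2.1|exact: E2.2].
  have {}E3 : frame2 3 l j (y + t *: (z - y)) = 0 by case: jN => ->; [exact: E3.1|exact: E3.2].
  apply: is_derive_val (derive_frame_line y (z - y) l j t) _; rewrite sum4 E2 E3.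
  have zy0 : (z - y) 0 0 = 0 by rewrite !mxE z0 y0 subrr.
  have zy1 : (z - y) 0 1 = 0 by rewrite !mxE z1 y1 subrr.
  rewrite zy0 zy1; move: (frame2 0 l j _) (frame2 1 l j _) ((z - y) 0 2) ((z - y) 0 3) => u v a b.
  by rewrite !mul0r !mulr0 !addr0.
have yz : y + (z - y) = z by rewrite addrC subrK.
have [c _] := mean_value_abs H; rewrite scale1r scale0r addr0 mul0r yz.
by move/eqP; rewrite subr_eq0 => /eqP ->.
Qed.

End CoreFrame.

(** * Isometries determine the holonomy *)

Section CoreRigidity.
Variable R : realType.
Local Notation k := (theta_radius R).
Local Notation q := (@disc_norm2 R).
Local Notation G := (@core_metric R).
Local Notation e_ := (@basis4 R).
Implicit Types (F H : 'rV[R]_4 -> 'rV[R]_4) (alpha l L : R) (x y : 'rV[R]_4).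

Lemma derive_comp_rows F H x v : smooth_on setT F -> smooth_on setT H ->
  'D_v (fun y => F (H y)) x = 'D_('D_v H x) F (H x).
Proof.
move=> sF sH.
have dF := smooth_row_differentiable (@openT 'rV[R]_4) sF (I : setT (H x)).
have dH := smooth_row_differentiable (@openT 'rV[R]_4) sH (I : setT x).
have dc : differentiable (F \o H) x by exact: differentiable_comp.
by rewrite (deriveE _ dc) diff_comp//= (deriveE _ dF) (deriveE _ dH).
Qed.

Definition equivariant alpha l L alpha' l' L' F (m n m' n' : int) : Prop :=
  forall x, F (deck alpha l L m n x) = deck alpha' l' L' m' n' (F x).

Lemma equivariant_exists alpha l L alpha' l' L' F : l' != 0 -> L' != 0 -> smooth_on setT F ->
  (forall x y, action_rel alpha l L x y -> action_rel alpha' l' L' (F x) (F y)) ->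
  forall m n, exists m' n', equivariant alpha l L alpha' l' L' F m n m' n'.
Proof.
move=> l0 L0 sF FE m n.
have sT : smooth_on setT (fun x => F (deck alpha l L m n x)).
  exact: (smooth_comp (@openT 'rV[R]_4) (@openT 'rV[R]_4) (fun _ _ => I) (smooth_shift _ _ _) sF).
apply: (deck_constant l0 L0 (smooth_continuous sF) (smooth_continuous sT)) => x.
by apply: FE; exists m, n.
Qed.

Lemma deck_inj alpha l L m n m' n' x : l != 0 -> L != 0 ->
  deck alpha l L m n x = deck alpha l L m' n' x -> m = m' /\ n = n'.
Proof.
move=> l0 L0 E; have [a2 a3] := deck23 alpha l L m n x; have [b2 b3] := deck23 alpha l L m' n' x.
rewrite E b2 in a2; rewrite E b3 in a3.
split; apply/eqP; rewrite -(eqr_int R); apply/eqP.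
  by move/addrI: a2 => /(mulIf l0).
by move/addrI: a3 => /(mulIf L0).
Qed.

(** Partners found through [H] are partners for [F]: [F] has some partner for [(m, n)], and
    evaluation at a single point identifies it, since deck transformations commute and are
    determined by one value. *)
Lemma equivariant_inverse alpha l L alpha' l' L' F H m n m' n' (a b : int) : l' != 0 -> L' != 0 ->
  (forall y, F (H y) = deck alpha' l' L' a b y) ->
  equivariant alpha' l' L' alpha l L H m' n' m n ->
  (exists m3 n3, equivariant alpha l L alpha' l' L' F m n m3 n3) ->
  equivariant alpha l L alpha' l' L' F m n m' n'.
Proof.
move=> l0 L0 FH HE [m3 [n3 FE]].
have : F (H (deck alpha' l' L' m' n' 0)) = F (deck alpha l L m n (H 0)) by rewrite HE.
rewrite FE !FH !deckD => /(deck_inj l0 L0)[hm hn].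
have <- : m3 = m' by apply: (addIr a); rewrite -hm addrC.
by have <- : n3 = n' by apply: (addIr b); rewrite -hn addrC.
Qed.

Lemma deck_core alpha l L m n x : x 0 0 = 0 -> x 0 1 = 0 ->
  deck alpha l L m n x = x + row4 0 0 (m%:~R * l) (n%:~R * L).
Proof.
move=> x0 x1; rewrite /deck shiftE x0 x1; apply: row4_eq; rewrite row4s !mxE /= ?x0 ?x1; ring.
Qed.

Lemma equivariant_translation alpha l L alpha' l' L' F m n m' n' :
  equivariant alpha l L alpha' l' L' F m n m' n' ->
  forall y, y 0 0 = 0 -> y 0 1 = 0 ->
   F (y + row4 0 0 (m%:~R * l) (n%:~R * L)) 0 2 = F y 0 2 + m'%:~R * l' /\
   F (y + row4 0 0 (m%:~R * l) (n%:~R * L)) 0 3 = F y 0 3 + n'%:~R * L'.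
Proof.
by move=> FE y y0 y1; rewrite -(deck_core alpha l L m n y0 y1) FE; exact: deck23.
Qed.

(** If the orthogonal matrix with rows (a, b), (c, d) intertwines two rotations, the cosines agree
    and the sines agree up to its determinant. *)
Lemma rotation_intertwine (a b c d x y x' y' : R) :
  a * a + b * b = 1 -> a * c + b * d = 0 ->
  x * a + y * c = x' * a - y' * b -> x * b + y * d = y' * a + x' * b ->
  x' = x /\ y' = (a * d - b * c) * y.
Proof.
move=> o00 o01 h0 h1; split.
  transitivity (x' * (a * a + b * b)); first by rewrite o00 mulr1.
  transitivity (a * (x' * a - y' * b) + b * (y' * a + x' * b)); first by ring.
  rewrite -h0 -h1; transitivity (x * (a * a + b * b) + y * (a * c + b * d)); first by ring.
  by rewrite o00 o01; ring.
transitivity (y' * (a * a + b * b)); first by rewrite o00 mulr1.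
transitivity (a * (y' * a + x' * b) - b * (x' * a - y' * b)); first by ring.
by rewrite -h0 -h1; ring.
Qed.

Lemma orthogonal_det (a b c d : R) :
  a * a + b * b = 1 -> a * c + b * d = 0 -> c * c + d * d = 1 ->
  exists2 e : int, e * e = 1 & a * d - b * c = e%:~R.
Proof.
move=> o00 o01 o11; have : (a * d - b * c) ^+ 2 = 1.
  transitivity ((a * a + b * b) * (c * c + d * d) - (a * c + b * d) * (a * c + b * d)); first by ring.
  by rewrite o00 o01 o11; ring.
by move/eqP; rewrite sqrf_eq1 => /orP[]/eqP->; [exists 1|exists (-1)].
Qed.

(** Differentiates the equivariance at the origin in the direction of the first axis. The normal
    derivative of [F] enters at two different core points, which is why its constancy along the core
    matters. *)
Lemma equivariant_rotation alpha l L alpha' l' L' F m n m' n' (Q : 'I_4 -> 'I_4 -> R) :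
  smooth_on setT F -> equivariant alpha l L alpha' l' L' F m n m' n' ->
  (forall i j y, y 0 0 = 0 -> y 0 1 = 0 -> i = 0 \/ i = 1 -> j = 0 \/ j = 1 ->
    frame F i j y = Q i j) ->
  let t := m%:~R * alpha / k in let t' := m'%:~R * alpha' / k in
  cos t * Q 0 0 + sin t * Q 1 0 = cos t' * Q 0 0 - sin t' * Q 0 1 /\
  cos t * Q 0 1 + sin t * Q 1 1 = sin t' * Q 0 0 + cos t' * Q 0 1.
Proof.
move=> sF FE FQ t t'.
have z0 : (0 : 'rV[R]_4) 0 0 = 0 by rewrite mxE.
have z1 : (0 : 'rV[R]_4) 0 1 = 0 by rewrite mxE.
have [w0 w1] : (deck alpha l L m n 0) 0 0 = 0 /\ (deck alpha l L m n 0) 0 1 = 0.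
  by rewrite deck_core// !mxE /= addr0.
have sd := smooth_shift (m%:~R * alpha) (m%:~R * l) (n%:~R * L).
have sd' := smooth_shift (m'%:~R * alpha') (m'%:~R * l') (n'%:~R * L').
have FEf : (fun y => F (deck alpha l L m n y)) = (fun y => deck alpha' l' L' m' n' (F y)).
  by apply/funext => y; exact: FE.
have E := derive_comp_rows 0 (e_ 0) sF sd; rewrite -/(deck _ _ _ _ _) FEf in E.
rewrite (derive_comp_rows 0 (e_ 0) sd' sF) !derive_shift in E.
have S i : (@Defs.shift R (m%:~R * alpha) 0 0 (e_ 0)) 0 i = row4 (cos t) (sin t) 0 0 0 i.
  have [-> _ _ _] := basis4E R; rewrite shiftE !row4s !mulr1 !mulr0 subr0 !addr0.
  by [].
have D j : j = 0 \/ j = 1 -> ('D_(Defs.shift (m%:~R * alpha) 0 0 (e_ 0)) F (deck alpha l L m n 0)) 0 j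
    = cos t * Q 0 j + sin t * Q 1 j.
  move=> jN; rewrite derive_frame// sum4 !S !row4s !mul0r !addr0.
  by rewrite (FQ 0 j _ w0 w1 (or_introl erefl) jN) (FQ 1 j _ w0 w1 (or_intror erefl) jN).
rewrite -!D; [|by right|by left]; rewrite -E shiftE !row4s !derive_basis//.
by rewrite !(FQ _ _ _ z0 z1); auto.
Qed.

(** Linearity of [dF] on the core. The zero translation, which [rigid_translation_eq] excludes, is
    handled by equality of lengths. *)
Lemma translation_rows F (P : 'M[R]_2) (a b a' b' : R) : smooth_on setT F ->
  'D_(e_ 2) F 0 = row4 0 0 (P 0 0) (P 0 1) -> 'D_(e_ 3) F 0 = row4 0 0 (P 1 0) (P 1 1) ->
  a' ^+ 2 + b' ^+ 2 = a ^+ 2 + b ^+ 2 ->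
  (0 < a ^+ 2 + b ^+ 2 -> 'D_(row4 0 0 a b) F 0 = row4 0 0 a' b') ->
  a * P 0 0 + b * P 1 0 = a' /\ a * P 0 1 + b * P 1 1 = b'.
Proof.
move=> sF t2 t3 nE D; have := addr_ge0 (sqr_ge0 a) (sqr_ge0 b); rewrite le_eqVlt => /orP[/eqP N0|/D{}D].
  have /eqP : a' ^+ 2 + b' ^+ 2 = 0 by rewrite nE -N0.
  rewrite paddr_eq0 ?sqr_ge0// !sqrf_eq0 => /andP[/eqP -> /eqP ->].
  move/esym/eqP: N0; rewrite paddr_eq0 ?sqr_ge0// !sqrf_eq0.
  by move=> /andP[/eqP -> /eqP ->]; rewrite !mul0r addr0.
have f2 j := etrans (esym (derive_basis sF 0 2 j)) (congr1 (fun v : 'rV[R]_4 => v 0 j) t2).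
have f3 j := etrans (esym (derive_basis sF 0 3 j)) (congr1 (fun v : 'rV[R]_4 => v 0 j) t3).
have E j := etrans (esym (derive_frame sF 0 (row4 0 0 a b) j)) (congr1 (fun v : 'rV[R]_4 => v 0 j) D).
have := E 2; have := E 3; rewrite !sum4 !f2 !f3 !row4s.
by rewrite !mul0r !add0r => -> ->.
Qed.

Lemma scale_angle (x u v w c : R) : c != 0 -> x * (u / c) = v / c + w -> x * u = w * c + v.
Proof.
move=> c0 E; transitivity (x * (u / c) * c); first by field.
by rewrite E; field.
Qed.

Lemma core_isometry_rigid alpha l L alpha' l' L' F : l != 0 -> L != 0 -> l' != 0 -> L' != 0 ->
  core_isometry (action_rel alpha l L) (action_rel alpha' l' L') F ->
  exists (e : int) (P : 'M[R]_2), [/\ e * e = 1, P *m P^T = 1%:M,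
    holonomy_compatible e P alpha l L alpha' l' L' &
    holonomy_compatible e P^T alpha' l' L' alpha l L].
Proof.
move=> l0 L0 l'0 L'0 [[sF [_ [FE [H [sH [_ [HE [HF FH]]]]]]]] pF].
have oT := @openT 'rV[R]_4.
have FE' x y : action_rel alpha l L x y -> action_rel alpha' l' L' (F x) (F y) by exact: FE.
have HE' x y : action_rel alpha' l' L' x y -> action_rel alpha l L (H x) (H y) by exact: HE.
have sFH := smooth_comp oT oT (fun _ _ => I) sH sF.
have sHF := smooth_comp oT oT (fun _ _ => I) sF sH.
have [a [b FHd]] : exists a b, forall y, F (H y) = deck alpha' l' L' a b y.
  have idE y : action_rel alpha' l' L' (F (H y)) (id y) by exact: FH.
  have [m [n E]] := deck_constant l'0 L'0 (smooth_continuous sFH) (fun=> cvg_id) idE.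
  by exists (- m), (- n) => y; rewrite {2}[y]E deckD !addNr deck0.
have [c [d HFd]] : exists a b, forall x, H (F x) = deck alpha l L a b x.
  have idE y : action_rel alpha l L (H (F y)) (id y) by exact: HF.
  have [m [n E]] := deck_constant l0 L0 (smooth_continuous sHF) (fun=> cvg_id) idE.
  by exists (- m), (- n) => y; rewrite {2}[y]E deckD !addNr deck0.
have pH x : pullback H G x = G x.
  rewrite -{1}(_ : pullback F G = G); last by apply/funext => y; exact: pF.
  rewrite -smooth_pullback_comp// (_ : (fun y => F (H y)) = deck alpha' l' L' a b).
    exact: pullback_shift.
  by apply/funext => y; exact: FHd.
have eqF := equivariant_exists l'0 L'0 sF FE'.
have eqH := equivariant_exists l0 L0 sH HE'.
(* Equivariance is recorded for both maps at once, so that [rigid_translation_le] applies in both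
   directions. *)
pose pair m n m' n' := equivariant alpha l L alpha' l' L' F m n m' n' /\
  equivariant alpha' l' L' alpha l L H m' n' m n.
have pairF m n : exists m' n', pair m n m' n'.
  have [m' [n' h]] := eqF m n; exists m', n'; split=> //.
  exact: (equivariant_inverse l0 L0 HFd h (eqH m' n')).
have pairH m' n' : exists m n, pair m n m' n'.
  have [m [n h]] := eqH m' n'; exists m, n; split=> //.
  exact: (equivariant_inverse l'0 L'0 FHd h (eqF m n)).
have norm m n m' n' : pair m n m' n' ->
    (m'%:~R * l') ^+ 2 + (n'%:~R * L') ^+ 2 = (m%:~R * l) ^+ 2 + (n%:~R * L) ^+ 2.
  move=> [h h']; apply/eqP; rewrite eq_le.
  rewrite (rigid_translation_le sF pF (equivariant_translation h)).
  by rewrite (rigid_translation_le sH pH (equivariant_translation h')).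
have rigid m n m' n' y : pair m n m' n' -> 0 < (m%:~R * l) ^+ 2 + (n%:~R * L) ^+ 2 ->
    y 0 0 = 0 -> y 0 1 = 0 ->
    q (F y) = 0 /\ 'D_(row4 0 0 (m%:~R * l) (n%:~R * L)) F y = row4 0 0 (m'%:~R * l') (n'%:~R * L').
  move=> h N0; apply: (rigid_translation_eq sF pF (equivariant_translation h.1)) => //.
  exact: norm.
have [m1 [n1 h1]] := pairF 1 0; have [m2 [n2 h2]] := pairF 0 1.
have N1 : 0 < (1%:~R * l) ^+ 2 + (0%:~R * L) ^+ 2.
  by rewrite mul1r mul0r expr0n addr0 lt_neqAle eq_sym sqrf_eq0 l0 sqr_ge0.
have N2 : 0 < (0%:~R * l) ^+ 2 + (1%:~R * L) ^+ 2.
  by rewrite mul1r mul0r expr0n add0r lt_neqAle eq_sym sqrf_eq0 L0 sqr_ge0.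
have coreF y : y 0 0 = 0 -> y 0 1 = 0 -> q (F y) = 0.
  by move=> y0 y1; have [] := rigid _ _ _ _ y h1 N1 y0 y1.
(* The two generators translate by [l] and [L] along the axes of the core, and [dF] sends these
   vectors to the translations of their partners; division normalizes the axes. *)
pose P : 'M[R]_2 := \matrix_(i, j) (if i == 0 then (if j == 0 then m1%:~R * l' else n1%:~R * L') / l
   else (if j == 0 then m2%:~R * l' else n2%:~R * L') / L).
have tangent y : y 0 0 = 0 -> y 0 1 = 0 ->
  'D_(e_ 2) F y = row4 0 0 (P 0 0) (P 0 1) /\ 'D_(e_ 3) F y = row4 0 0 (P 1 0) (P 1 1).
  move=> y0 y1; have [_ r1] := rigid _ _ _ _ y h1 N1 y0 y1.
  have [_ r2] := rigid _ _ _ _ y h2 N2 y0 y1.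
  have E1 j : frame F 2 j y = row4 0 0 (P 0 0) (P 0 1) 0 j.
    have := congr1 (fun v : 'rV[R]_4 => v 0 j) r1; rewrite derive_frame// sum4 !row4s.
    rewrite !mul0r mul1r !add0r addr0 => E; apply: (mulfI l0); rewrite E.
    by move: j {E}; apply: ord4P; rewrite !row4s ?mulr0// mxE /=; field.
  have E2 j : frame F 3 j y = row4 0 0 (P 1 0) (P 1 1) 0 j.
    have := congr1 (fun v : 'rV[R]_4 => v 0 j) r2; rewrite derive_frame// sum4 !row4s.
    rewrite !mul0r mul1r !add0r => E; apply: (mulfI L0); rewrite E.
    by move: j {E}; apply: ord4P; rewrite !row4s ?mulr0// mxE /=; field.
  by split; apply/rowP => j; rewrite derive_basis.
have PP := tangent_orthogonal sF pF coreF tangent.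
pose Q i j := frame F i j 0.
have z0 : (0 : 'rV[R]_4) 0 0 = 0 by rewrite mxE.
have z1 : (0 : 'rV[R]_4) 0 1 = 0 by rewrite mxE.
have FQ i j y : y 0 0 = 0 -> y 0 1 = 0 -> i = 0 \/ i = 1 -> j = 0 \/ j = 1 -> frame F i j y = Q i j.
  move=> y0 y1 iN jN; exact: (frame_constant sF pF coreF tangent y0 y1 z0 z1 iN jN).
have o i j := @frame_orthonormal R F sF pF coreF P tangent 0 i j z0 z1.
have o00 := o 0 0 (or_introl erefl) (or_introl erefl).
have o01 := o 0 1 (or_introl erefl) (or_intror erefl).
have o11 := o 1 1 (or_intror erefl) (or_intror erefl).
have [e ee eE] := orthogonal_det o00 o01 o11.
have eeR : e%:~R * e%:~R = 1 :> R by rewrite -intrM ee.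
have k0 := theta_radius_neq0 R.
have compat m n m' n' : pair m n m' n' -> exists j : int,
   [/\ e%:~R * (m%:~R * alpha) = j%:~R * beta R + m'%:~R * alpha',
       m%:~R * l * P 0 0 + n%:~R * L * P 1 0 = m'%:~R * l' &
       m%:~R * l * P 0 1 + n%:~R * L * P 1 1 = n'%:~R * L'].
  move=> h.
  have [r0 r1] := equivariant_rotation sF h.1 FQ.
  have [c' s'] := rotation_intertwine o00 o01 r0 r1.
  have [ce se] := sign_angle (m%:~R * alpha / k) ee.
  (* Rotation parts are known only modulo full turns; the integer [j] supplies the multiple of
     [beta] in the compatibility. *)
  have [|| j jE] := @cos_sin_eqP R (e%:~R * (m%:~R * alpha / k)) (m'%:~R * alpha' / k).
  - by rewrite ce c'.
  - by rewrite se s' eE.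
  have [t2 t3] := tangent 0 z0 z1.
  have D N0 := (rigid _ _ _ _ 0 h N0 z0 z1).2.
  have [c2 c3] := translation_rows sF t2 t3 (norm _ _ _ _ h) D.
  exists j; split; [|exact: c2|exact: c3].
  by rewrite betaE [j%:~R * _]mulrA; exact: scale_angle k0 jE.
exists e, P; split=> //.
  move=> m n; have [m' [n' /compat[j h]]] := pairF m n; by exists j, m', n'.
move=> m' n'; have [m [n /compat[j [c1 c2 c3]]]] := pairH m' n'; exists (- (e * j)), m, n.
have [p00 p01 p11] := orthogonal2 PP.
rewrite ![P^T _ _]mxE -c2 -c3; split.
- have -> : m'%:~R * alpha' = e%:~R * (m%:~R * alpha) - j%:~R * beta R by rewrite c1; ring.
  by rewrite mulrBr mulrA eeR mul1r mulrNz intrM; ring.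
- transitivity (m%:~R * l * (P 0 0 * P 0 0 + P 0 1 * P 0 1)
    + n%:~R * L * (P 0 0 * P 1 0 + P 0 1 * P 1 1)); first by ring.
  by rewrite p00 p01; ring.
- transitivity (m%:~R * l * (P 0 0 * P 1 0 + P 0 1 * P 1 1)
    + n%:~R * L * (P 1 0 * P 1 0 + P 1 1 * P 1 1)); first by ring.
  by rewrite p11 p01; ring.
Qed.

End CoreRigidity.

(** * Classification up to isometry *)

Section Classification.
Variable R : realType.
Local Notation G := (@core_metric R).

Lemma associatedP (D : filling_data R) (g : 'rV[R]_4 -> 'M[R]_4) : associated D g ->
  exists (alpha l lam : R) (f h : 'rV[R]_4 -> 'rV[R]_4),
   [/\ l != 0, fd_beta2 D / lam != 0,
       marked_homothety lam (period_lattice alpha l (fd_beta2 D / lam)) (@core_line R)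
         (product_lattice D) (product_sigma D) &
       [/\ quotient_diffeo setT (@torus_rel R) setT (action_rel alpha l (fd_beta2 D / lam)) f,
           quotient_diffeo setT (action_rel alpha l (fd_beta2 D / lam)) setT (@torus_rel R) h,
           g = pullback f G & G = pullback h g]].
Proof.
move=> [G' [alpha [l [lam [f [isG mh qf gE]]]]]]; rewrite (is_g1_unique isG) in gE.
have l0 := marked_homothety_pitch (fd_lattice_unit D) mh.
have L0 : fd_beta2 D / lam != 0 by rewrite gt_eqF// divr_gt0// ?fd_beta2_gt0//; exact: mh.1.
have [h qh hE] := associated_inverse l0 L0 qf gE.
exists alpha, l, lam, f, h; split=> //.
  exact: (marked_homothety_product (fd_beta2 D) mh).
by split=> //; apply/funext => x; [exact: gE|exact/esym/hE].
Qed.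

(** Both metrics are covered by the same g1, so going up along one covering and down along the other
    is a local isometry defined on all of R^4. *)
Lemma associated_locally_isometric (D D' : filling_data R) g g' :
  associated D g -> associated D' g' -> locally_isometric g g'.
Proof.
move=> /associatedP[alpha [l [lam [f [_ [_ _ _ [[sf _] _ gE _]]]]]]].
move=> /associatedP[alpha' [l' [lam' [_ [h' [_ _ _ [_ [sh' _] _ GE']]]]]]] p.
have oT := @openT 'rV[R]_4.
exists setT, (fun x => h' (f x)); split; [exact: oT|exact: I| |].
  exact: (smooth_comp oT oT (fun _ _ => I) sf sh').
by move=> x _; rewrite (smooth_pullback_comp _ x sf sh') -GE' gE.
Qed.

Lemma isometric_core_isometry alpha l L alpha' l' L' f h f' h' (g g' : 'rV[R]_4 -> 'M[R]_4) :
  quotient_diffeo setT (@torus_rel R) setT (action_rel alpha l L) f ->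
  quotient_diffeo setT (action_rel alpha l L) setT (@torus_rel R) h ->
  g = pullback f G -> G = pullback h g ->
  quotient_diffeo setT (@torus_rel R) setT (action_rel alpha' l' L') f' ->
  quotient_diffeo setT (action_rel alpha' l' L') setT (@torus_rel R) h' ->
  g' = pullback f' G -> G = pullback h' g' ->
  isometric g g' <-> exists F, core_isometry (action_rel alpha l L) (action_rel alpha' l' L') F.
Proof.
move=> qf qh gE GE qf' qh' gE' GE'.
have tT := @torus_rel_trans R; have tA := @action_rel_trans R alpha l L.
have tA' := @action_rel_trans R alpha' l' L'.
have sf := qf.1; have sh := qh.1; have sf' := qf'.1; have sh' := qh'.1.
split=> [[phi qphi phiE]|[F [qF FE]]].
  have qfp := quotient_diffeo_trans tT tA' qphi qf'.
  exists (fun x => f' (phi (h x))); split; first exact: (quotient_diffeo_trans tA tA' qh qfp).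
  have E : pullback (fun x => f' (phi x)) G = g.
    by apply/funext => y; rewrite (smooth_pullback_comp _ y qphi.1 sf') -gE' phiE.
  by move=> x; rewrite (smooth_pullback_comp _ x sh qfp.1) E -GE.
have qhF := quotient_diffeo_trans tA tT qF qh'.
exists (fun x => h' (F (f x))); first exact: (quotient_diffeo_trans tT tT qf qhF).
have E : pullback (fun x => h' (F x)) g' = G.
  by apply/funext => y; rewrite (smooth_pullback_comp _ y qF.1 sh') -GE' FE.
by move=> x; rewrite (smooth_pullback_comp _ x sf qhF.1) E -gE.
Qed.

(** The data enter through the homotheties between period lattices and product lattices. Conjugation
    by these reduces both directions to period lattices, where isometries and marked homotheties are
    both governed by pairs [e], [P]. *)
Lemma associated_isometric (D D' : filling_data R) g g' :
  associated D g -> associated D' g' -> (isometric g g' <-> same_data D D').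
Proof.
move=> /associatedP[alpha [l [lam [f [h [l0 L0 mh [qf qh gE GE]]]]]]].
move=> /associatedP[alpha' [l' [lam' [f' [h' [l0' L0' mh' [qf' qh' gE' GE']]]]]]].
rewrite (isometric_core_isometry qf qh gE GE qf' qh' gE' GE'); split=> [[F cF]|[mu hmu]].
  have [e [P [ee PP H H']]] := core_isometry_rigid l0 L0 l0' L0' cF.
  exists (lam^-1 * (1 * lam')).
  apply: marked_homothety_trans (marked_homothety_sym mh) _.
  exact: marked_homothety_trans (homothety_core_line ee PP H H') mh'.
have hm := marked_homothety_trans mh (marked_homothety_trans hmu (marked_homothety_sym mh')).
have [e [P [ee PP H H']]] := core_line_homothety l0 L0 l0' L0' hm.
by exists (core_map e P); exact: core_map_isometry.
Qed.

End Classification.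

Theorem proposition4p4 (R : realType) :
  (forall D : filling_data R,
     exists g : 'rV[R]_4 -> 'M[R]_4,
       [/\ associated D g,
           complete_AH_einstein g &
           has_conformal_infinity g (product_lattice D)]) /\
  (forall (D D' : filling_data R) (g g' : 'rV[R]_4 -> 'M[R]_4),
     associated D g -> associated D' g' ->
     locally_isometric g g' /\
     (isometric g g' <-> same_data D D')).
Proof.
split=> [D|D D' g g' aD aD']; first exact: filling_exists.
split; first exact: associated_locally_isometric aD aD'.
exact: associated_isometric.
Qed.
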